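(* For any finite Legendrian knot $K$, \begin{equation} E(K) =\iint_{K\times K}\frac{1-\cos\theta_K(p,q)}{d_{\mathcal{H}}(p,q)^2}\,dp\,dq \end{equation} holds.
   Context: $\mathcal{H}=\mathbb{C}\times\mathbb{R}$ is the 3-dimensional Heisenberg group with coordinates $(z,u)=(x,y,u)$, group law $(z,u)\cdot(z',u')=(z+z',u+u'-\tfrac{1}{2}\Im(z\overline{z'}))$, horizontal distribution spanned by $X=\partial_x-\tfrac12 y\,\partial_u$, $Y=\partial_y+\tfrac12 x\,\partial_u$ (orthonormal, norm $|\cdot|$). The Korányi distance is $d_{\mathcal{H}}(p,q)=\|p^{-1}q\|_{\mathcal{H}}$, $\|(x,y,u)\|_{\mathcal{H}}=\sqrt[4]{(x^2+y^2)^2+16u^2}$. A finite Legendrian knot $K\subset\mathcal{H}$ is a smooth embedded closed Legendrian curve; $dp$, $dq$ are arc-length measures, and the energy $E(K)=B_K(-2)$ is the value at $\zeta=-2$ of the meromorphic continuation of $B_K(\zeta)=\iint_{K\times K}d_{\mathcal{H}}(p,q)^\zeta\,dp\,dq$ (from $\Re\zeta>-1$). $\mathbb{R}$-circles are the intersections of $\partial B^2_{\mathbb{C}}\cong\mathcal{H}\cup\{\infty\}$ with closures of totally geodesic totally real surfaces in the complex hyperbolic ball; for distinct $p,q$ and a horizontal direction at $p$ there is a unique $\mathbb{R}$-circle through $p,q$ tangent to that direction. For distinct $p,q\in K$, $\Gamma_K(p,q)$ denotes the $\mathbb{R}$-circle through $p$ and $q$ tangent to $K$ at $p$, and $\theta_K(p,q)\in[0,\pi]$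 is the angle between $\Gamma_K(p,q)$ and $\Gamma_K(q,p)$ (measured at $p$ or equivalently at $q$, in the contact plane, with orientations induced by an orientation of $K$). *)

(* Defs.v *)
From mathcomp Require Import all_boot all_order all_algebra.
From mathcomp Require Import all_classical all_reals all_analysis.
From mathcomp Require Export complex.
Import Order.TTheory GRing.Theory Num.Theory.
Set Implicit Arguments. Unset Strict Implicit. Unset Printing Implicit Defensive.
Local Open Scope ring_scope.
Local Open Scope classical_set_scope.

Section Heisenberg.
Variable R : realType.

(** Points of the Heisenberg group H = C x R, written ((x, y), u). *)
Definition hpt := (R * R * R)%type.
Definition hx (p : hpt) : R := p.1.1.
Definition hy (p : hpt) : R := p.1.2.
Definition hu (p : hpt) : R := p.2.

(** Group law (z,u).(z',u') = (z+z', u+u' - 1/2 Im(z conj z')),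
    with Im(z conj z') = y x' - x y'. *)
Definition hmul (p q : hpt) : hpt :=
  ((hx p + hx q, hy p + hy q),
   hu p + hu q - 2^-1 * (hy p * hx q - hx p * hy q)).
Definition hinv (p : hpt) : hpt := ((- hx p, - hy p), - hu p).

Definition koranyi_norm (p : hpt) : R :=
  powR ((hx p ^+ 2 + hy p ^+ 2) ^+ 2 + 16 * hu p ^+ 2) (4^-1).
Definition dH (p q : hpt) : R := koranyi_norm (hmul (hinv p) q).

Definition cx (c : R -> hpt) := fun s => hx (c s).
Definition cy (c : R -> hpt) := fun s => hy (c s).
Definition cu (c : R -> hpt) := fun s => hu (c s).

Definition D1 (f : R -> R) : R -> R := @derive1 R R f.

Definition smooth_fun (f : R -> R) : Prop :=
  forall (n : nat) (s : R), derivable (iter n D1 f) s 1.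

(** [g] is a unit-speed (horizontal arc length) parametrization, with period
    (= length) [L], of a finite Legendrian knot: a smooth embedded closed
    curve in H whose velocity lies in the horizontal distribution
    span(X, Y), X = d_x - y/2 d_u, Y = d_y + x/2 d_u, i.e.
    u' = (x y' - y x')/2; the velocity x' X + y' Y has norm
    sqrt(x'^2 + y'^2) = 1. *)
Definition legendrian_knot (L : R) (g : R -> hpt) : Prop :=
  [/\ 0 < L,
      forall s, g (s + L) = g s,
      (forall s t, 0 <= s < L -> 0 <= t < L -> g s = g t -> s = t),
      [/\ smooth_fun (cx g), smooth_fun (cy g) & smooth_fun (cu g)] &
      [/\ (forall s, (D1 (cu g)) s =
          2^-1 * (cx g s * (D1 (cy g)) s - cy g s * (D1 (cx g)) s)) &
      (forall s, ((D1 (cx g)) s) ^+ 2 + ((D1 (cy g)) s) ^+ 2 = 1)]].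

(** Projective model: C^{2,1} with Hermitian form
    <Z,W> = Z1 conj(W3) + Z2 conj(W2) + Z3 conj(W1); the boundary of the
    complex hyperbolic plane (Siegel domain) is H u {infinity}, where the
    point (z,u) corresponds to the null vector
    phi(z,u) = ((-|z|^2 - 4 i u)/2, z, 1)
    (this is the standard Heisenberg lift with t = -4u, which matches the
    group law and Koranyi norm above; Heisenberg translations act by
    unitary matrices). *)
Definition cre (z : R[i]) : R := let: Complex a _ := z in a.
Definition cim (z : R[i]) : R := let: Complex _ b := z in b.
Definition cconj (z : R[i]) : R[i] := Complex (cre z) (- cim z).
Definition C3 := (R[i] * R[i] * R[i])%type.
Definition herm (Z W : C3) : R[i] :=
  Z.1.1 * cconj W.2 + Z.1.2 * cconj W.1.2 + Z.2 * cconj W.1.1.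
Definition c3scale (a : R[i]) (Z : C3) : C3 := ((a * Z.1.1, a * Z.1.2), a * Z.2).
Definition c3add (Z W : C3) : C3 := ((Z.1.1 + W.1.1, Z.1.2 + W.1.2), Z.2 + W.2).
Definition c3comb (a b c : R[i]) (w1 w2 w3 : C3) : C3 :=
  c3add (c3add (c3scale a w1) (c3scale b w2)) (c3scale c w3).
Definition rC (a : R) : R[i] := Complex a 0.
Definition phi (p : hpt) : C3 :=
  ((Complex ((- (hx p ^+ 2 + hy p ^+ 2)) / 2) (- (2 * hu p)), Complex (hx p) (hy p)), 1).

(** A totally real, totally geodesic plane of the complex hyperbolic plane
    is the projectivization of a real 3-dimensional subspace V (spanned by
    w1 w2 w3, linearly independent over C, i.e. V is totally real and
    V (x) C = C^3) on which the Hermitian form is real-valued, and which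
    contains a negative vector (so that it meets the ball).  Its closure
    meets the boundary in the projectivized null vectors of V.  The
    R-circle (intersected with H) is the set of Heisenberg points whose lift
    is, up to a non-zero complex scalar, in V. *)
Definition rcircle (S : set hpt) : Prop :=
  exists w1 w2 w3 : C3,
    [/\ (forall a b c : R[i], c3comb a b c w1 w2 w3 = ((0, 0), 0) ->
           [/\ a = 0, b = 0 & c = 0]),
        (forall a b c a' b' c' : R,
           cim (herm (c3comb (rC a) (rC b) (rC c) w1 w2 w3)
                    (c3comb (rC a') (rC b') (rC c') w1 w2 w3)) = 0),
        (exists a b c : R,
           cre (herm (c3comb (rC a) (rC b) (rC c) w1 w2 w3)
                    (c3comb (rC a) (rC b) (rC c) w1 w2 w3)) < 0) &
        S = [set p | exists lam : R[i], lam != 0 /\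
              exists a b c : R,
                c3scale lam (phi p) = c3comb (rC a) (rC b) (rC c) w1 w2 w3]].

Definition regular_path_in (S : set hpt) (c : R -> hpt) : Prop :=
  [/\ forall r, S (c r),
      forall r, [/\ derivable (cx c) r 1, derivable (cy c) r 1
                  & derivable (cu c) r 1] &
      forall r, ((D1 (cx c)) r, (D1 (cy c)) r, (D1 (cu c)) r) != (0, 0, 0)].

(** theta_K(p,q) for p = g s, q = g t: the angle at p between the oriented
    R-circle Gamma_K(p,q) (whose oriented tangent at p is the unit tangent
    T_p of K) and the R-circle Gamma_K(q,p), the latter oriented so that its
    tangent at q is a positive multiple of T_q, this orientation being
    transported to p along the circle by a regular parametrization.  The
    angle is measured in the contact plane, where X, Y are orthonormal, so
    the horizontal vector aX + bY has coordinates (a, b) = (x', y'). *)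
Definition theta_rel (L : R) (g : R -> hpt) (s t th : R) : Prop :=
  0 <= th <= pi /\
  exists (S : set hpt) (c : R -> hpt) (k r : R),
    [/\ [/\ rcircle S, S (g s), S (g t) & regular_path_in S c],
        [/\ c 0 = g t, 0 < k &
            ((D1 (cx c)) 0, (D1 (cy c)) 0, (D1 (cu c)) 0) =
            (k * (D1 (cx g)) t, k * (D1 (cy g)) t, k * (D1 (cu g)) t)],
        c r = g s &
        cos th * Num.sqrt (((D1 (cx c)) r) ^+ 2 + ((D1 (cy c)) r) ^+ 2) =
          (D1 (cx g)) s * (D1 (cx c)) r + (D1 (cy g)) s * (D1 (cy c)) r].

Definition thetaK (L : R) (g : R -> hpt) (s t : R) : R :=
  xget 0 [set th | theta_rel L g s t th].

Definition mu := (@lebesgue_measure R).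

Definition cpowR (d : R) (z : R[i]) : R[i] :=
  Complex (powR d (cre z) * cos (cim z * ln d)) (powR d (cre z) * sin (cim z * ln d)).

(** B_K(zeta) = \iint_{K x K} d_H(p,q)^zeta dp dq, for cre zeta > -1,
    computed in the arc-length parametrization over [0,L]^2. *)
Definition BK (L : R) (g : R -> hpt) (z : R[i]) : R[i] :=
  Complex
   (Rintegral mu `[0, L] (fun s => Rintegral mu `[0, L]
       (fun t => cre (cpowR (dH (g s) (g t)) z))))
   (Rintegral mu `[0, L] (fun s => Rintegral mu `[0, L]
       (fun t => cim (cpowR (dH (g s) (g t)) z)))).

Definition cnorm (z : R[i]) : R := Num.sqrt (cre z ^+ 2 + cim z ^+ 2).
Definition copen (U : set R[i]) : Prop :=
  forall z, U z -> exists2 e : R, 0 < e & forall w, cnorm (w - z) < e -> U w.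
Definition cconnected (U : set R[i]) : Prop :=
  forall A B : set R[i], copen A -> copen B -> U = A `|` B -> A `&` B = set0 ->
    A = set0 \/ B = set0.
Definition cdifferentiable (F : R[i] -> R[i]) (z : R[i]) : Prop :=
  exists l : R[i], forall e : R, 0 < e -> exists2 d : R, 0 < d &
    forall h : R[i], h != 0 -> cnorm h < d ->
      cnorm ((F (z + h) - F z) / h - l) < e.

(** F on U is an analytic continuation of B_K from the half-plane
    cre zeta > -1 to a connected open set U containing that half-plane and
    the point -2 (e.g. the complement of the poles of the meromorphic
    continuation). *)
Definition BK_continuation (L : R) (g : R -> hpt) (U : set R[i])
    (F : R[i] -> R[i]) : Prop :=
  [/\ copen U, cconnected U,
      (forall z, -1 < cre z -> U z) /\ U (rC (-2)),
      (forall z, U z -> cdifferentiable F z) &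
      (forall z, -1 < cre z -> F z = BK L g z)].

Definition energy_integrand (L : R) (g : R -> hpt) (s t : R) : R :=
  (1 - cos (thetaK L g s t)) / (dH (g s) (g t)) ^+ 2.

Definition I0L (L : R) : set R := `[0, L].

Definition energy_rhs (L : R) (g : R -> hpt) : \bar R :=
  (\int[mu]_(s in I0L L) \int[mu]_(t in I0L L) (energy_integrand L g s t)%:E)%E.

End Heisenberg.

(* Main.v *)
(** Write [d(s, t)] for the distance between the points of arc length [s] and [t] and [a = L / 2].
    By symmetry [B(z)] is twice the integral of [d(s, s + t)^z] over [0 <= s <= L], [0 < t <= a],
    where [d(s, s + t) = t * (1 + O(t^2))]. Integrating by parts in [t] gives
    [(z + 1) B(z) = 2 (boundary term - z * J(z))] with [J] analytic for [Re z > -3], and repeated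
    integration by parts combined with Goursat's theorem forces every analytic continuation on a
    connected domain to take the value at [-2] given by this formula.

    On the geometric side let [P], [Q] be null lifts of the points [p], [q], [A = -2 <P, Q>] and
    [Tp], [Tq] the unit tangents. An [R]-circle through [p] and [q] is a conic [Q + x W + x^2 P / A]
    with [x] in the real projective line; following it from [q] in the direction [Tq] one arrives at
    [p] in the direction [A^3 Tq], so that [cos theta / d^2 = Re (conj Tp * Tq * A^3) / |A|^4], which
    is the mixed second derivative of [ln d] with respect to the arc lengths of [p] and [q]. Hence the
    integral of [(1 - cos theta) / d^2] in [t] is again a boundary term minus an integral; the extra
    boundary term is the first derivative of [ln d] at opposite points of the knot, whose integral in
    [s] vanishes. *)
Require Import Defs.
From mathcomp Require Import all_boot all_order all_algebra.
From mathcomp Require Import all_classical all_reals all_analysis measurable_realfun.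
From mathcomp Require Import complex ring lra.
Import Order.TTheory GRing.Theory Num.Theory numFieldNormedType.Exports.
Local Open Scope ring_scope.
Local Open Scope classical_set_scope.

(** * Integrals of continuous functions over segments *)

Section segment_integral.
Context {R : realType}.
Implicit Types (f : R -> R) (a b c : R).

(** The domain of a continuation is only known to be connected: it may lead from the half plane
    [-1 < Re z] to [-2] through points arbitrarily far to the left, where a single integration by
    parts says nothing. Hence the iteration is unbounded, polynomial factors clear the poles, and
    the identity theorem is applied to the cleared functions. Differentiability is given pointwise,
    so the identity theorem rests on subdivision of rectangles. Expansions at the diagonal are
    obtained by dividing by the arc length difference [t] and showing that the quotients stay smooth
    and bounded. Two facts produce these quotients: acceleration is orthogonal to velocity, which
    removes the first correction to the distance, and the contact condition makes the vertical
    displacement of order [t^3]. The angle is selected from a relation that admits every regular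
    parametrization of an [R]-circle; it may wind several times and its velocity may be
    discontinuous. Reality of triple Hermitian products ties such a path to a point moving on the
    unit circle, whose sense of rotation cannot change. *)

Definition sint f a b : R := (\int[@lebesgue_measure R]_(x in `[a, b]) f x)%R.

(** Two-sided continuity at every point, end points included: it passes to subsegments and follows
    directly from differentiability. *)
Definition cont_on f a b := forall x, a <= x <= b -> {for x, continuous f}.

Lemma cont_on_within f a b : cont_on f a b -> {within `[a, b], continuous f}.
Proof.
move=> H; apply: continuous_in_subspaceT => x; rewrite inE/= in_itv/= => xab.
exact: H.
Qed.

Lemma cont_on_integrable f a b : cont_on f a b ->
  (@lebesgue_measure R).-integrable `[a, b] (EFin \o f).
Proof.
move=> H; apply: continuous_compact_integrable; first exact: segment_compact.
exact: cont_on_within.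
Qed.

Lemma sint_split f a c b : a <= c <= b -> cont_on f a b ->
  sint f a b = sint f a c + sint f c b.
Proof.
move=> /andP[ac cb] H.
have := @Rintegral_itvB R f (BLeft a) (BRight b) c (cont_on_integrable _ _ _ H).
rewrite !bnd_simp => /(_ ac cb); rewrite Rintegral_itv_obnd_cbnd; last first.
  apply: integrableS (cont_on_integrable _ _ _ H) => //.
  by apply: subset_itvr; rewrite bnd_simp.
by rewrite /sint => <-; rewrite addrC subrK.
Qed.

Lemma sint_cst k a b : a <= b -> sint (fun=> k) a b = k * (b - a).
Proof.
move=> ab; rewrite /sint Rintegral_cst//; congr (_ * _).
have -> : b - a = fine (b - a)%:E by [].
congr fine; apply: etrans (lebesgue_measure_itv `[a, b]%R) _ => /=.
by rewrite lte_fin; case: ltgtP ab => // -> _; rewrite subrr.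
Qed.

Lemma sint_ge k f a b : a <= b -> cont_on f a b ->
  (forall x, a <= x <= b -> k <= f x) -> k * (b - a) <= sint f a b.
Proof.
move=> ab H kf; rewrite /sint.
rewrite -sint_cst//.
apply: le_Rintegral => //.
- by apply: cont_on_integrable => x _; exact: cvg_cst.
- exact: cont_on_integrable.
Qed.

Lemma sint_le k f a b : a <= b -> cont_on f a b ->
  (forall x, a <= x <= b -> f x <= k) -> sint f a b <= k * (b - a).
Proof.
move=> ab H kf; rewrite /sint.
rewrite -sint_cst//.
apply: le_Rintegral => //.
- exact: cont_on_integrable.
- by apply: cont_on_integrable => x _; exact: cvg_cst.
Qed.

Lemma sint_near k M f a b : a <= b -> cont_on f a b ->
  (forall x, a <= x <= b -> `|f x - k| <= M) ->
  `|sint f a b - k * (b - a)| <= M * (b - a).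
Proof.
move=> ab H kf.
have h1 : sint f a b <= (k + M) * (b - a).
  by apply: sint_le => // x /kf; rewrite ler_distl => /andP[]; lra.
have h2 : (k - M) * (b - a) <= sint f a b.
  by apply: sint_ge => // x /kf; rewrite ler_distl => /andP[]; lra.
by rewrite ler_distl; apply/andP; split; lra.
Qed.

Lemma sintB f g a b : cont_on f a b -> cont_on g a b ->
  sint (fun x => f x - g x) a b = sint f a b - sint g a b.
Proof. by move=> hf hg; rewrite /sint RintegralB//; exact: cont_on_integrable. Qed.

End segment_integral.

(** * Goursat's theorem on rectangles, for real differential forms *)

Section Goursat.
Context {R : realType}.
Implicit Types (P Q : R -> R -> R).

(* The circulation of [P dx + Q dy] along the boundary of a rectangle. *)
Definition circ P Q x1 x2 y1 y2 : R :=
  sint (fun x => P x y1 - P x y2) x1 x2 + sint (fun y => Q x2 y - Q x1 y) y1 y2.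

(** The shared coefficient [b] says that [P dx + Q dy] is closed to first order at the point. For
    [P = Im F] and [Q = Re F] the form is the imaginary part of [F dz], and complex
    differentiability of [F] at the point provides the expansion. *)
Definition closed_at P Q (x0 y0 : R) := exists a b d : R, forall e, 0 < e ->
  exists2 dl, 0 < dl & forall x y, `|x - x0| < dl -> `|y - y0| < dl ->
   `|P x y - P x0 y0 - a * (x - x0) - b * (y - y0)| <= e * (`|x - x0| + `|y - y0|) /\
   `|Q x y - Q x0 y0 - b * (x - x0) - d * (y - y0)| <= e * (`|x - x0| + `|y - y0|).

Definition rcont P Q x y := [/\ {for x, continuous (P ^~ y)}, {for y, continuous (P x)},
  {for x, continuous (Q ^~ y)} & {for y, continuous (Q x)}].

Lemma lin_cont (f : R -> R) (x0 a e : R) dl : 0 <= e -> 0 < dl ->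
  (forall x, `|x - x0| < dl -> `|f x - f x0 - a * (x - x0)| <= e * `|x - x0|) ->
  {for x0, continuous f}.
Proof.
move=> e0 dl0 H; apply/cvgrPdist_lt => /= eps eps0.
have C0 : 0 < `|a| + e + 1 by rewrite ltr_wpDl // addr_ge0.
near=> x.
have xd : `|x - x0| < dl.
  by near: x; exists dl => // z /=; rewrite distrC.
have xe : `|x - x0| < eps / (`|a| + e + 1).
  near: x; exists (eps / (`|a| + e + 1)) => /=; first exact: divr_gt0.
  by move=> z /=; rewrite distrC.
rewrite distrC.
have -> : f x - f x0 = (f x - f x0 - a * (x - x0)) + a * (x - x0) by rewrite subrK.
apply: le_lt_trans (ler_normD _ _) _.
rewrite normrM; apply: (@le_lt_trans _ _ ((`|a| + e + 1) * `|x - x0|)).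
  have := H _ xd; have := normr_ge0 (x - x0); nra.
by rewrite mulrC -ltr_pdivlMr.
Unshelve. all: by end_near. Qed.

Lemma closed_at_rcont P Q x0 y0 : closed_at P Q x0 y0 -> rcont P Q x0 y0.
Proof.
move=> [a [b [d H]]]; have [dl dl0 {}H] := H _ ltr01.
split; [apply: (@lin_cont _ _ a 1 dl)|apply: (@lin_cont _ _ b 1 dl)
  |apply: (@lin_cont _ _ b 1 dl)|apply: (@lin_cont _ _ d 1 dl)] => // t td.
- by have := H t y0 td; rewrite !subrr !normr0 !mulr0 !subr0 addr0; move=> /(_ dl0)[].
- by have := H x0 t; rewrite !subrr !normr0 !mulr0 !subr0 add0r; move=> /(_ dl0 td)[].
- by have := H t y0 td; rewrite !subrr !normr0 !mulr0 !subr0 addr0; move=> /(_ dl0)[].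
- by have := H x0 t; rewrite !subrr !normr0 !mulr0 !subr0 add0r; move=> /(_ dl0 td)[].
Qed.

Definition on_rect (S : R -> R -> Prop) x1 x2 y1 y2 :=
  forall x y : R, x1 <= x <= x2 -> y1 <= y <= y2 -> S x y.

Lemma circ_splitx P Q x1 c x2 y1 y2 : x1 <= c <= x2 -> y1 <= y2 ->
  (forall x, x1 <= x <= x2 -> rcont P Q x y1 /\ rcont P Q x y2) ->
  (forall y, y1 <= y <= y2 -> [/\ rcont P Q x1 y, rcont P Q c y & rcont P Q x2 y]) ->
  circ P Q x1 x2 y1 y2 = circ P Q x1 c y1 y2 + circ P Q c x2 y1 y2.
Proof.
move=> xc y12 H1 H2; rewrite /circ (sint_split _ _ c) //; last first.
  by move=> x /H1 [[? ? ? ?] [? ? ? ?]]; exact: cvgB.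
have h1 : cont_on (Q x1) y1 y2 by move=> y /H2 [[]].
have hc : cont_on (Q c) y1 y2 by move=> y /H2 [_ []].
have h2 : cont_on (Q x2) y1 y2 by move=> y /H2 [_ _ []].
rewrite !(sintB (Q _) (Q _))//; clear; lra.
Qed.

Lemma circ_splity P Q x1 x2 y1 c y2 : x1 <= x2 -> y1 <= c <= y2 ->
  (forall x, x1 <= x <= x2 -> [/\ rcont P Q x y1, rcont P Q x c & rcont P Q x y2]) ->
  (forall y, y1 <= y <= y2 -> rcont P Q x1 y /\ rcont P Q x2 y) ->
  circ P Q x1 x2 y1 y2 = circ P Q x1 x2 y1 c + circ P Q x1 x2 c y2.
Proof.
move=> x12 yc H1 H2; rewrite /circ [X in _ + X](sint_split _ _ c) //; last first.
  by move=> x /H2 [[? ? ? ?] [? ? ? ?]]; exact: cvgB.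
have h1 : cont_on (P ^~ y1) x1 x2 by move=> y /H1 [[]].
have hc : cont_on (P ^~ c) x1 x2 by move=> y /H1 [_ []].
have h2 : cont_on (P ^~ y2) x1 x2 by move=> y /H1 [_ _ []].
rewrite !(sintB (P ^~ _) (P ^~ _))//; clear; lra.
Qed.

(** The affine part of the form has zero circulation: opposite sides contribute
    [b (y1 - y2) (x2 - x1)] and [b (x2 - x1) (y2 - y1)]. Only the error terms remain, each at most
    [e] times the half perimeter. *)
Lemma circ_local P Q x0 y0 e x1 x2 y1 y2 a b d : 0 <= e ->
  x1 <= x0 <= x2 -> y1 <= y0 <= y2 ->
  on_rect (rcont P Q) x1 x2 y1 y2 ->
  on_rect (fun x y =>
   `|P x y - P x0 y0 - a * (x - x0) - b * (y - y0)| <= e * (`|x - x0| + `|y - y0|) /\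
   `|Q x y - Q x0 y0 - b * (x - x0) - d * (y - y0)| <= e * (`|x - x0| + `|y - y0|))
   x1 x2 y1 y2 ->
  `|circ P Q x1 x2 y1 y2| <= 2 * e * (x2 - x1 + (y2 - y1)) ^+ 2.
Proof.
move=> e0 hx hy H1 H2.
have x12 : x1 <= x2 by lra.
have y12 : y1 <= y2 by lra.
set w := x2 - x1 + (y2 - y1).
have w0 : 0 <= w by rewrite /w; lra.
have yy1 : y1 <= y1 <= y2 by rewrite lexx.
have yy2 : y1 <= y2 <= y2 by rewrite lexx andbT.
have xx1 : x1 <= x1 <= x2 by rewrite lexx.
have xx2 : x1 <= x2 <= x2 by rewrite lexx andbT.
have dw x y : x1 <= x <= x2 -> y1 <= y <= y2 ->
    `|P x y - P x0 y0 - a * (x - x0) - b * (y - y0)| <= e * w /\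
    `|Q x y - Q x0 y0 - b * (x - x0) - d * (y - y0)| <= e * w.
  move=> xx yy; have [h1 h2] := H2 x y xx yy.
  have h3 : e * (`|x - x0| + `|y - y0|) <= e * w.
    by apply: ler_wpM2l => //; apply: lerD; rewrite ler_norml; lra.
  by split; [apply: le_trans h1 h3|apply: le_trans h2 h3].
have A1 : `|sint (fun x => P x y1 - P x y2) x1 x2 - (b * (y1 - y2)) * (x2 - x1)|
    <= (2 * e * w) * (x2 - x1).
  apply: sint_near => //.
    by move=> x xx; apply: cvgB; [have [] := H1 x y1 xx yy1|have [] := H1 x y2 xx yy2].
  move=> x xx; have [h1 _] := dw x y1 xx yy1; have [h2 _] := dw x y2 xx yy2.
  by move: h1 h2; rewrite !ler_norml; clear; lra.
have A2 : `|sint (fun y => Q x2 y - Q x1 y) y1 y2 - (b * (x2 - x1)) * (y2 - y1)|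
    <= (2 * e * w) * (y2 - y1).
  apply: sint_near => //.
    by move=> y yy; apply: cvgB; [have [] := H1 x2 y xx2 yy|have [] := H1 x1 y xx1 yy].
  move=> y yy; have [_ h1] := dw x1 y xx1 yy; have [_ h2] := dw x2 y xx2 yy.
  by move: h1 h2; rewrite !ler_norml; clear; lra.
rewrite /circ.
have -> : 2 * e * w ^+ 2 = (2 * e * w) * (x2 - x1) + (2 * e * w) * (y2 - y1).
  by rewrite /w; ring.
move: A1 A2; rewrite !ler_norml; clear; lra.
Qed.

(** A rectangle is encoded by its lower left corner and its size, so that the nested rectangles in
    [Goursat] become a sequence of points. *)
Lemma quarter_choice (S : R -> R -> R -> R -> Prop) x y w h :
  (S x y (w / 2) (h / 2) -> S (x + w / 2) y (w / 2) (h / 2) ->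
   S x (y + h / 2) (w / 2) (h / 2) -> S (x + w / 2) (y + h / 2) (w / 2) (h / 2) ->
   S x y w h) -> ~ S x y w h ->
  exists p : R * R, [/\ (p.1 = x \/ p.1 = x + w / 2), (p.2 = y \/ p.2 = y + h / 2) &
    ~ S p.1 p.2 (w / 2) (h / 2)].
Proof.
move=> H nS.
have [h1|?] := pselect (S x y (w / 2) (h / 2)); last by exists (x, y); split => /=; auto.
have [h2|?] := pselect (S (x + w / 2) y (w / 2) (h / 2)); last first.
  by exists (x + w / 2, y); split => /=; auto.
have [h3|?] := pselect (S x (y + h / 2) (w / 2) (h / 2)); last first.
  by exists (x, y + h / 2); split => /=; auto.
have [h4|?] := pselect (S (x + w / 2) (y + h / 2) (w / 2) (h / 2)); last first.
  by exists (x + w / 2, y + h / 2); split => /=; auto.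
by case: nS; apply: H.
Qed.

Lemma circ_quarter P Q x y w h : 0 <= w -> 0 <= h ->
  on_rect (rcont P Q) x (x + w) y (y + h) ->
  circ P Q x (x + w) y (y + h) =
  circ P Q x (x + w / 2) y (y + h / 2) +
  circ P Q (x + w / 2) (x + w / 2 + w / 2) y (y + h / 2) +
  circ P Q x (x + w / 2) (y + h / 2) (y + h / 2 + h / 2) +
  circ P Q (x + w / 2) (x + w / 2 + w / 2) (y + h / 2) (y + h / 2 + h / 2).
Proof.
move=> w0 h0 H.
have -> : x + w / 2 + w / 2 = x + w by lra.
have -> : y + h / 2 + h / 2 = y + h by lra.
have rc s t : x <= s <= x + w -> y <= t <= y + h -> rcont P Q s t by exact: H.
rewrite (@circ_splitx _ _ x (x + w / 2) (x + w)); first last.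
- by move=> t ?; split; apply: rc; lra.
- by move=> s ?; split; apply: rc; lra.
- lra.
- lra.
rewrite (@circ_splity _ _ x (x + w / 2) y (y + h / 2)); first last.
- by move=> t ?; split; apply: rc; lra.
- by move=> s ?; split; apply: rc; lra.
- lra.
- lra.
rewrite (@circ_splity _ _ (x + w / 2) (x + w) y (y + h / 2)); first last.
- by move=> t ?; split; apply: rc; lra.
- by move=> s ?; split; apply: rc; lra.
- lra.
- lra.
clear; lra.
Qed.

(** Nested intervals: [u n] is the left end of an interval from which the left or the right half is
    kept. The supremum of the left ends lies below every right end. *)
Lemma halving_cvg (u : nat -> R) w : 0 <= w ->
  (forall n, u n.+1 = u n \/ u n.+1 = u n + w / 2 ^+ n.+1) ->
  exists l, forall n, u n <= l <= u n + w / 2 ^+ n.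
Proof.
move=> w0 H.
have step n : u n <= u n.+1 /\ u n.+1 + w / 2 ^+ n.+1 <= u n + w / 2 ^+ n.
  have h : w / 2 ^+ n = w / 2 ^+ n.+1 + w / 2 ^+ n.+1.
    by rewrite exprS; field; rewrite expf_neq0.
  have : 0 <= w / 2 ^+ n.+1 by rewrite divr_ge0// exprn_ge0.
  by rewrite h; case: (H n) => ->; split; lra.
have up n k : u n <= u (k + n)%N.
  by elim: k => //= k /le_trans; apply; have [] := step (k + n)%N.
have dn n k : u (k + n)%N + w / 2 ^+ (k + n) <= u n + w / 2 ^+ n.
  by elim: k => //= k; apply: le_trans; have [] := step (k + n)%N.
have pos n : 0 <= w / 2 ^+ n by rewrite divr_ge0// exprn_ge0.
have cross n m : u m <= u n + w / 2 ^+ n.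
  have [mn|/ltnW nm] := leqP m n.
    by have := up m (n - m)%N; rewrite subnK// => /le_trans; apply; rewrite lerDl.
  by have := dn n (m - n)%N; rewrite subnK//; apply: le_trans; rewrite lerDl.
have hs : has_sup (range u).
  by split; [exists (u 0%N), 0%N|exists (u 0%N + w / 2 ^+ 0) => _ [m _ <-]; exact: cross].
exists (sup (range u)) => n; apply/andP; split.
  by apply: sup_upper_bound => //; exists n.
by apply: ge_sup; [exists (u 0%N), 0%N|move=> _ [m _ <-]; exact: cross].
Qed.

Lemma half_pow_small (w e : R) : 0 < e -> exists n, w / 2 ^+ n < e.
Proof.
move=> e0; have [n _ /(_ n (leqnn n)) /= H] : \forall n \near \oo, w / e < n%:R.
  by near=> n; near: n; exact: nbhs_infty_gtr.
exists n; rewrite ltr_pdivrMr ?exprn_gt0// mulrC -ltr_pdivrMr//.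
by apply: lt_trans H _; rewrite -natrX ltr_nat ltn_expl.
Unshelve. all: by end_near. Qed.

(** If the circulation exceeded [2 e] times the squared half perimeter, the same would hold for one
    of the four quarters, since both sides scale by four. Repeating this gives nested rectangles
    shrinking to a point, where [circ_local] is contradicted. *)
Theorem Goursat P Q x1 x2 y1 y2 : x1 <= x2 -> y1 <= y2 ->
  on_rect (closed_at P Q) x1 x2 y1 y2 -> circ P Q x1 x2 y1 y2 = 0.
Proof.
move=> x12 y12 H.
pose w := x2 - x1; pose h := y2 - y1.
have w0 : 0 <= w by rewrite subr_ge0.
have h0 : 0 <= h by rewrite subr_ge0.
suff S e : 0 < e -> `|circ P Q x1 x2 y1 y2| <= 2 * e * (w + h) ^+ 2.
  apply/eqP; rewrite -normr_eq0 eq_le normr_ge0 andbT; apply/ler_addgt0Pr => e e0.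
  (* The added [1] keeps the divisor positive for a rectangle reduced to a point. *)
  have c0 : 0 < 2 * ((w + h) ^+ 2 + 1) by have := sqr_ge0 (w + h); lra.
  have := S (e / (2 * ((w + h) ^+ 2 + 1))) (divr_gt0 e0 c0).
  move=> /le_trans; apply; rewrite add0r.
  have -> : 2 * (e / (2 * ((w + h) ^+ 2 + 1))) * (w + h) ^+ 2 =
     e * ((w + h) ^+ 2 / ((w + h) ^+ 2 + 1)) by field; lra.
  by apply: ler_piMr; [exact: ltW|rewrite ler_pdivrMr; lra].
move=> e0; apply: contrapT => nS.
pose S x y w h := `|circ P Q x (x + w) y (y + h)| <= 2 * e * (w + h) ^+ 2.
pose wn n := w / 2 ^+ n; pose hn n := h / 2 ^+ n.
(* The default [p] is never returned: by [key], a rectangle violating the estimate has a quarter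
   violating it. *)
pose step n (p : R * R) : R * R := xget p [set q | [/\ q.1 = p.1 \/ q.1 = p.1 + wn n.+1,
   q.2 = p.2 \/ q.2 = p.2 + hn n.+1 & ~ S q.1 q.2 (wn n.+1) (hn n.+1)]].
pose c := fix c n := if n is m.+1 then step m (c m) else (x1, y1).
have wnS n : wn n.+1 = wn n / 2 by rewrite /wn exprSr invfM mulrA.
have hnS n : hn n.+1 = hn n / 2 by rewrite /hn exprSr invfM mulrA.
have wnp n : 0 <= wn n by rewrite divr_ge0// exprn_ge0.
have hnp n : 0 <= hn n by rewrite divr_ge0// exprn_ge0.
have inv n : [/\ x1 <= (c n).1, (c n).1 + wn n <= x2, y1 <= (c n).2, (c n).2 + hn n <= y2
    & ~ S (c n).1 (c n).2 (wn n) (hn n)] /\ [/\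
    (c n.+1).1 = (c n).1 \/ (c n.+1).1 = (c n).1 + wn n.+1,
    (c n.+1).2 = (c n).2 \/ (c n.+1).2 = (c n).2 + hn n.+1 &
     ~ S (c n.+1).1 (c n.+1).2 (wn n.+1) (hn n.+1)].
  have key m : [/\ x1 <= (c m).1, (c m).1 + wn m <= x2, y1 <= (c m).2, (c m).2 + hn m <= y2
    & ~ S (c m).1 (c m).2 (wn m) (hn m)] -> [/\
    (c m.+1).1 = (c m).1 \/ (c m.+1).1 = (c m).1 + wn m.+1,
    (c m.+1).2 = (c m).2 \/ (c m.+1).2 = (c m).2 + hn m.+1 &
     ~ S (c m.+1).1 (c m.+1).2 (wn m.+1) (hn m.+1)].
    move=> [a1 a2 a3 a4 a5].
    have [q [q1 q2 q3]] : exists p : R * R, [/\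
       (p.1 = (c m).1 \/ p.1 = (c m).1 + wn m / 2),
       (p.2 = (c m).2 \/ p.2 = (c m).2 + hn m / 2) &
       ~ S p.1 p.2 (wn m / 2) (hn m / 2)].
      apply: (@quarter_choice S) => //; rewrite /S => s1 s2 s3 s4.
      rewrite circ_quarter//; last first.
        move=> x y /andP[hx1 hx2] /andP[hy1 hy2]; apply: closed_at_rcont; apply: H.
          by rewrite (le_trans a1 hx1) (le_trans hx2 a2).
        by rewrite (le_trans a3 hy1) (le_trans hy2 a4).
      have -> : 2 * e * (wn m + hn m) ^+ 2 = 4 * (2 * e * (wn m / 2 + hn m / 2) ^+ 2) by field.
      move: s1 s2 s3 s4; rewrite !ler_norml; clear; lra.
    rewrite [c m.+1]/= /step; apply: (@xgetPex _ (c m) [set q | [/\ q.1 = (c m).1 \/ q.1 = (c m).1 + wn m.+1,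
   q.2 = (c m).2 \/ q.2 = (c m).2 + hn m.+1 & ~ S q.1 q.2 (wn m.+1) (hn m.+1)]]).
    by exists q => /=; rewrite wnS hnS.
  suff I m : [/\ x1 <= (c m).1, (c m).1 + wn m <= x2, y1 <= (c m).2, (c m).2 + hn m <= y2
    & ~ S (c m).1 (c m).2 (wn m) (hn m)] by split => //; exact: key.
  elim: m => [|m IH].
    rewrite /= /wn /hn expr0 !divr1 /S /w /h !subrKC; split => //; rewrite ?lexx//.
  have [k1 k2 k3] := key m IH; have [a1 a2 a3 a4 _] := IH.
  have := wnp m; have := hnp m.
  rewrite wnS in k1; rewrite hnS in k2; rewrite wnS hnS in k3 * => p1 p2.
  by split => //; [case: k1 => ->|case: k1 => ->|case: k2 => ->|case: k2 => ->];
    clear -a1 a2 a3 a4 p1 p2; lra.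
have [n|X hX] := @halving_cvg (fun n => (c n).1) w w0.
  by have [_ []] := inv n.
have [n|Y hY] := @halving_cvg (fun n => (c n).2) h h0.
  by have [_ []] := inv n.
have [[a1 a2 a3 a4 _] _] := inv 0%N.
have hX0 : x1 <= X <= x2.
  by have := hX 0%N; rewrite -/(wn 0%N); move: a1 a2; clear; lra.
have hY0 : y1 <= Y <= y2.
  by have := hY 0%N; rewrite -/(hn 0%N); move: a3 a4; clear; lra.
have [a [b [d HH]]] := H X Y hX0 hY0.
have [dl dl0 {}HH] := HH e e0.
(* A late rectangle lies in the neighbourhood of [(X, Y)] where the expansion has error [e]. *)
have [n hn'] := half_pow_small (w + h) dl dl0.
have {}hn' : wn n + hn n < dl by rewrite /wn /hn -mulrDl.
have [[b1 b2 b3 b4 nSn] _] := inv n; apply: nSn; rewrite /S.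
have -> : wn n + hn n = (c n).1 + wn n - (c n).1 + ((c n).2 + hn n - (c n).2) by clear; lra.
have wp := wnp n; have hp := hnp n; have hXn := hX n; have hYn := hY n.
apply: (@circ_local _ _ X Y e _ _ _ _ a b d) => //; first exact: ltW.
- move=> x y /andP[hx1 hx2] /andP[hy1 hy2]; apply: closed_at_rcont; apply: H.
    by rewrite (le_trans b1 hx1) (le_trans hx2 b2).
  by rewrite (le_trans b3 hy1) (le_trans hy2 b4).
- move: hXn hYn; rewrite -/(wn n) -/(hn n) => hXn hYn.
  by move=> x y hx hy; apply: HH; rewrite ltr_norml; lra.
Qed.
End Goursat.

(** * Modulus, real and imaginary parts *)

Section complex_norm.
Context {R : realType}.
Implicit Types (z w : R[i]).

Lemma cnormE z : cnorm z = Normc.normc z. Proof. by case: z. Qed.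

Lemma cnorm_norm z : `|z| = (cnorm z)%:C%C. Proof. by rewrite normc_def; case: z. Qed.

Lemma cnorm_ge0 z : 0 <= cnorm z. Proof. exact: sqrtr_ge0. Qed.

Lemma cnorm0 : cnorm (0 : R[i]) = 0. Proof. by rewrite cnormE Normc.normc0. Qed.

Lemma cnorm1 : cnorm (1 : R[i]) = 1. Proof. by rewrite cnormE Normc.normc1. Qed.

Lemma cnormM z w : cnorm (z * w) = cnorm z * cnorm w.
Proof. by rewrite !cnormE Normc.normcM. Qed.

Lemma cnormV z : cnorm z^-1 = (cnorm z)^-1.
Proof. by rewrite !cnormE Normc.normcV. Qed.

Lemma cnormX z n : cnorm (z ^+ n) = cnorm z ^+ n.
Proof. by elim: n => [|n IH]; rewrite ?expr0 ?cnorm1// !exprS cnormM IH. Qed.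

Lemma cnormN z : cnorm (- z) = cnorm z.
Proof. by rewrite !cnormE normcN. Qed.

Lemma cnormD z w : cnorm (z + w) <= cnorm z + cnorm w.
Proof. by rewrite !cnormE le_normcD. Qed.

Lemma cnorm_eq0 z : (cnorm z == 0) = (z == 0).
Proof.
rewrite cnormE; apply/eqP/eqP => [/Normc.eq0_normc//|->]; exact: Normc.normc0.
Qed.

Lemma cnorm_gt0 z : (0 < cnorm z) = (z != 0).
Proof. by rewrite lt_neqAle cnorm_ge0 andbT eq_sym cnorm_eq0. Qed.

Lemma cre_le_cnorm z : `|cre z| <= cnorm z.
Proof. by rewrite /cnorm -sqrtr_sqr ler_wsqrtr// lerDl sqr_ge0. Qed.

Lemma cim_le_cnorm z : `|cim z| <= cnorm z.
Proof. by rewrite /cnorm -sqrtr_sqr ler_wsqrtr// lerDr sqr_ge0. Qed.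

Lemma cnorm_le z : cnorm z <= `|cre z| + `|cim z|.
Proof.
have h : 0 <= `|cre z| + `|cim z| by rewrite addr_ge0.
rewrite -(ger0_norm h) -sqrtr_sqr ler_wsqrtr// sqrrD -(real_normK (num_real (cre z))).
rewrite -(real_normK (num_real (cim z))).
have : 0 <= `|cre z| * `|cim z| by rewrite mulr_ge0.
by lra.
Qed.

Lemma creD z w : cre (z + w) = cre z + cre w. Proof. by case: z; case: w. Qed.
Lemma cimD z w : cim (z + w) = cim z + cim w. Proof. by case: z; case: w. Qed.
Lemma creN z : cre (- z) = - cre z. Proof. by case: z. Qed.
Lemma cimN z : cim (- z) = - cim z. Proof. by case: z. Qed.
Lemma creM z w : cre (z * w) = cre z * cre w - cim z * cim w. Proof. by case: z; case: w. Qed.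
Lemma cimM z w : cim (z * w) = cre z * cim w + cim z * cre w. Proof. by case: z; case: w. Qed.
Definition compE := (creD, cimD, creN, cimN, creM, cimM).

Lemma complex_eq z w : cre z = cre w -> cim z = cim w -> z = w.
Proof. by case: z; case: w => ? ? ? ? /= -> ->. Qed.

Lemma complex_eta z : Complex (cre z) (cim z) = z. Proof. by case: z. Qed.
End complex_norm.

(** * Complex differentiability *)

Section complex_differentiability.
Context {R : realType}.
Implicit Types (F G : R[i] -> R[i]) (z : R[i]).

(** A positive element of [R[i]] is real, so the radii in the two definitions correspond. The
    algebraic rules for derivatives are then inherited. *)
Lemma cdiffP F z : cdifferentiable F z <-> derivable (F : R[i]^o -> R[i]^o) z 1.
Proof.
split=> [[l hl]|/cvg_ex [l /cvgrPdist_lt H]].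
- apply/cvg_ex; exists l; apply/cvgrPdist_lt => /= e e0.
  have ee : e = (cre e)%:C%C by move: e0; rewrite ltcE /=; case: e => a b /= /andP[/eqP ->].
  have [d d0 hd] := hl (cre e) ltac:(by move: e0; rewrite ltcE => /andP[]).
  exists d%:C%C; first by rewrite /= ltcR.
  move=> h /=; rewrite sub0r normrN cnorm_norm ltcR => hd' h0.
  rewrite distrC cnorm_norm ee ltcR.
  by rewrite [h *: 1]mulr1 [h + z]addrC [h^-1 *: _]mulrC; exact: hd.
- exists l => e e0; have := H e%:C%C; rewrite ltcR => /(_ e0)[/= d d0 hd].
  have dd : d = (cre d)%:C%C by move: d0; rewrite ltcE /=; case: d {hd} => a b /= /andP[/eqP ->].
  exists (cre d); first by move: d0; rewrite ltcE => /andP[].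
  move=> h h0 hd'; have := hd h; rewrite /= sub0r normrN cnorm_norm dd ltcR => /(_ hd' h0).
  by rewrite distrC cnorm_norm ltcR [h *: 1]mulr1 [h + z]addrC [h^-1 *: _]mulrC.
Qed.

Lemma cdiff_cst c z : cdifferentiable (fun=> c) z.
Proof. by apply/cdiffP; exact: derivable_cst. Qed.

Lemma cdiff_id z : cdifferentiable id z.
Proof. by apply/cdiffP; exact: derivable_id. Qed.

Lemma cdiffD F G z : cdifferentiable F z -> cdifferentiable G z ->
  cdifferentiable (fun w => F w + G w) z.
Proof. by move=> /cdiffP hF /cdiffP hG; apply/cdiffP; exact: (derivableD hF hG). Qed.

Lemma cdiffN F z : cdifferentiable F z -> cdifferentiable (fun w => - F w) z.
Proof. by move=> /cdiffP hF; apply/cdiffP; exact: (derivableN hF). Qed.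

Lemma cdiffB F G z : cdifferentiable F z -> cdifferentiable G z ->
  cdifferentiable (fun w => F w - G w) z.
Proof. by move=> hF hG; apply: cdiffD hF (cdiffN _ _ hG). Qed.

Lemma cdiffM F G z : cdifferentiable F z -> cdifferentiable G z ->
  cdifferentiable (fun w => F w * G w) z.
Proof. by move=> /cdiffP hF /cdiffP hG; apply/cdiffP; exact: (derivableM hF hG). Qed.

Lemma cdiffV F z : F z != 0 -> cdifferentiable F z -> cdifferentiable (fun w => (F w)^-1) z.
Proof. by move=> F0 /cdiffP hF; apply/cdiffP; exact: (derivableV F0 hF). Qed.

Lemma cdiffX F n z : cdifferentiable F z -> cdifferentiable (fun w => F w ^+ n) z.
Proof.
move=> hF; elim: n => [|n IH]; first exact: cdiff_cst.
have -> : (fun w => F w ^+ n.+1) = (fun w => F w * F w ^+ n).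
  by apply/funext => w; rewrite exprS.
exact: cdiffM.
Qed.

Lemma cdiff_near F G z d : 0 < d -> (forall w, cnorm (w - z) < d -> F w = G w) ->
  cdifferentiable F z -> cdifferentiable G z.
Proof.
move=> d0 FG [l hl]; exists l => e /hl [d' d'0 hd']; exists (Num.min d d').
  by rewrite lt_min d0.
move=> h h0; rewrite lt_min => /andP[hd hd2].
by rewrite -!FG ?subrr ?cnorm0//; [exact: hd'|rewrite addrC addKr].
Qed.

(** The form is the imaginary part of [F dz]. The Cauchy-Riemann equations show in the coefficients
    [cim l], [cre l], [- cim l], where [l] is the complex derivative. *)
Lemma cdiff_closed_at F z : cdifferentiable F z ->
  closed_at (fun x y => cim (F (Complex x y))) (fun x y => cre (F (Complex x y))) (cre z) (cim z).
Proof.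
move=> [l hl]; exists (cim l), (cre l), (- cim l) => e e0.
have [d d0 hd] := hl e e0; exists (d / 2); first lra.
move=> x y hx hy; rewrite !complex_eta.
pose h : R[i] := Complex (x - cre z) (y - cim z).
have hn : cnorm h <= `|x - cre z| + `|y - cim z| by exact: (cnorm_le h).
have zh : z + h = Complex x y by apply: complex_eq; rewrite ?compE /h /= addrC subrK.
suff H : cnorm (F (Complex x y) - F z - l * h) <= e * cnorm h.
  have {}H := le_trans H (ler_wpM2l (ltW e0) hn).
  have := le_trans (cre_le_cnorm _) H; have := le_trans (cim_le_cnorm _) H.
  rewrite !compE /= => h1 h2; split.
    by move: h1; congr (is_true (`|_| <= _)); ring.
  by move: h2; congr (is_true (`|_| <= _)); ring.
have [h0|h0] := eqVneq h 0.
  by rewrite -zh h0 addr0 subrr mulr0 subrr cnorm0 mulr0.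
have -> : F (Complex x y) - F z - l * h = ((F (z + h) - F z) / h - l) * h.
  by rewrite zh mulrBl divfK.
rewrite cnormM ler_wpM2r ?cnorm_ge0//; apply/ltW/hd => //.
by apply: le_lt_trans hn _; lra.
Qed.

Lemma cdiff_continuous F z : cdifferentiable F z -> forall e : R, 0 < e ->
  exists2 d, 0 < d & forall w, cnorm (w - z) < d -> cnorm (F w - F z) < e.
Proof.
move=> [l hl] e e0; have [d d0 hd] := hl 1 ltr01.
have c0 : 0 < cnorm l + 1 by rewrite ltr_wpDl // cnorm_ge0.
exists (Num.min d (e / (cnorm l + 1))); first by rewrite lt_min d0 divr_gt0.
move=> w; rewrite lt_min ltr_pdivlMr// => /andP[h1 h2].
have [->|/eqP wz] := pselect (w = z); first by rewrite subrr cnorm0.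
have h0 : w - z != 0 by rewrite subr_eq0.
apply: le_lt_trans h2; have := hd _ h0 h1; rewrite subrKC => h3.
have -> : F w - F z = (F w - F z) / (w - z) * (w - z) by rewrite divfK.
rewrite cnormM mulrC ler_wpM2l ?cnorm_ge0//.
have -> : (F w - F z) / (w - z) = l + ((F w - F z) / (w - z) - l) by rewrite subrKC.
by apply: le_trans (cnormD _ _) _; rewrite lerD2l ltW.
Qed.
End complex_differentiability.

(** * Circulation around a bounded isolated singularity *)

Section punctured.
Context {R : realType}.

(** Goursat's theorem on four rectangles surrounding the exceptional point: two slabs of full height
    at the sides, and the pieces below and above between them. *)
Lemma circ_shrink (P Q : R -> R -> R) x1 xl x0 xr x2 y1 yl y0 yr y2 :
  x1 <= xl -> xl < x0 -> x0 < xr -> xr <= x2 -> y1 <= yl -> yl < y0 -> y0 < yr -> yr <= y2 ->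
  (forall x y, x1 <= x <= x2 -> y1 <= y <= y2 -> x <> x0 \/ y <> y0 -> closed_at P Q x y) ->
  circ P Q x1 x2 y1 y2 = circ P Q xl xr yl yr.
Proof.
move=> a1 a2 a3 a4 b1 b2 b3 b4 H.
have xlr : xl <= xr by rewrite ltW// (lt_trans a2).
have ylr : yl <= yr by rewrite ltW// (lt_trans b2).
have xl2 : xl <= x2 by exact: le_trans a4.
have yl2 : yl <= y2 by exact: le_trans b4.
have x1r : x1 <= xr by exact: le_trans xlr.
have y1r : y1 <= yr by exact: le_trans ylr.
have rc1 s t : x1 <= s <= x2 -> y1 <= t <= y2 -> s != x0 -> rcont P Q s t.
  by move=> hs ht /eqP hst; apply: closed_at_rcont; apply: H => //; left.
have rc2 s t : x1 <= s <= x2 -> y1 <= t <= y2 -> t != y0 -> rcont P Q s t.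
  by move=> hs ht /eqP hst; apply: closed_at_rcont; apply: H => //; right.
have n1 : x1 != x0 by rewrite lt_eqF// (le_lt_trans a1).
have n2 : x2 != x0 by rewrite gt_eqF// (lt_le_trans a3).
have n3 : y1 != y0 by rewrite lt_eqF// (le_lt_trans b1).
have n4 : y2 != y0 by rewrite gt_eqF// (lt_le_trans b3).
have nl : xl != x0 by rewrite lt_eqF.
have nr : xr != x0 by rewrite gt_eqF.
have nb : yl != y0 by rewrite lt_eqF.
have nt : yr != y0 by rewrite gt_eqF.
have x12 : x1 <= x2 by exact: le_trans xl2.
have y12 : y1 <= y2 by exact: le_trans yl2.
have wx s : xl <= s <= xr -> x1 <= s <= x2.
  by move=> /andP[h1 h2]; rewrite (le_trans a1 h1) (le_trans h2 a4).
have wx' s : xl <= s <= x2 -> x1 <= s <= x2 by move=> /andP[h1 ->]; rewrite (le_trans a1 h1).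
have wy' s : yl <= s <= y2 -> y1 <= s <= y2 by move=> /andP[h1 ->]; rewrite (le_trans b1 h1).
rewrite (@circ_splitx _ _ _ x1 xl x2); first last.
- by move=> t ht; split; apply: rc1; rewrite ?lexx ?a1 ?x12.
- by move=> t ht; split; apply: rc2; rewrite ?lexx ?y12.
- exact: y12.
- by rewrite a1.
rewrite (@circ_splitx _ _ _ xl xr x2); first last.
- by move=> t ht; split; apply: rc1; rewrite ?lexx ?a1 ?x1r ?x12.
- by move=> t ht; split; apply: rc2; rewrite ?lexx ?y12 ?wx'.
- exact: y12.
- by rewrite xlr.
rewrite (@circ_splity _ _ _ xl xr y1 yl y2); first last.
- by move=> t ht; split; apply: rc1; rewrite ?a1 ?x1r.
- by move=> t ht; split; apply: rc2; rewrite ?wx// ?lexx ?b1 ?y12.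
- by rewrite b1.
- exact: xlr.
rewrite (@circ_splity _ _ _ xl xr yl yr y2); first last.
- by move=> t ht; split; apply: rc1; rewrite ?a1 ?x1r ?wy'.
- by move=> t ht; split; apply: rc2; rewrite ?wx// ?lexx ?b1 ?y1r ?y12.
- by rewrite ylr.
- exact: xlr.
rewrite (@Goursat _ _ _ x1 xl)//; first last.
  move=> s t /andP[h1 h2] ht; apply: H => //; first by rewrite h1 (le_trans h2).
  by left; apply/eqP; rewrite lt_eqF// (le_lt_trans h2).
rewrite (@Goursat _ _ _ xr x2)//; first last.
  move=> s t /andP[h1 h2] ht; apply: H => //; first by rewrite h2 (le_trans x1r).
  by left; apply/eqP; rewrite gt_eqF// (lt_le_trans a3).
rewrite (@Goursat _ _ _ _ _ y1 yl)//; first last.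
  move=> s t /wx hs /andP[h1 h2]; apply: H => //; first by rewrite h1 (le_trans h2).
  by right; apply/eqP; rewrite lt_eqF// (le_lt_trans h2).
rewrite (@Goursat _ _ _ _ _ yr y2)//; first last.
  move=> s t /wx hs /andP[h1 h2]; apply: H => //; first by rewrite h2 (le_trans y1r).
  by right; apply/eqP; rewrite gt_eqF// (lt_le_trans b3).
by rewrite !add0r !addr0.
Qed.

(** After shrinking to a square of side [2 d] around the point, the four sides contribute at most
    [M] times their total length [8 d], which tends to zero. *)
Lemma circ_puncture (P Q : R -> R -> R) x1 x2 y1 y2 x0 y0 M d0 :
  x1 < x0 < x2 -> y1 < y0 < y2 -> 0 < d0 -> 0 <= M ->
  (forall x y, x1 <= x <= x2 -> y1 <= y <= y2 -> x <> x0 \/ y <> y0 -> closed_at P Q x y) ->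
  (forall x y, `|x - x0| <= d0 -> `|y - y0| <= d0 -> x <> x0 \/ y <> y0 ->
     `|P x y| <= M /\ `|Q x y| <= M) ->
  circ P Q x1 x2 y1 y2 = 0.
Proof.
move=> hx hy dp M0 H HM.
pose d1 := Num.min d0 (Num.min (Num.min (x0 - x1) (x2 - x0)) (Num.min (y0 - y1) (y2 - y0))).
have d1p : 0 < d1 by rewrite !lt_min dp; lra.
have le_d1 d : d <= d1 -> [/\ d <= d0, d <= x0 - x1, d <= x2 - x0, d <= y0 - y1 & d <= y2 - y0].
  by rewrite !le_min => /andP[? /andP[/andP[? ?] /andP[? ?]]].
suff S d : 0 < d <= d1 -> `|circ P Q x1 x2 y1 y2| <= 8 * M * d.
  apply/eqP; rewrite -normr_eq0 eq_le normr_ge0 andbT; apply/ler_addgt0Pr => e e0.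
  rewrite add0r; pose d := Num.min d1 (e / (8 * M + 1)).
  have c0 : 0 < 8 * M + 1 by lra.
  have hd : 0 < d <= d1 by rewrite lt_min d1p divr_gt0//= ge_min lexx.
  apply: le_trans (S d hd) _.
  have : d <= e / (8 * M + 1) by rewrite ge_min lexx orbT.
  by rewrite ler_pdivlMr//; move: hd => /andP[]; nra.
move=> /andP[dpos /le_d1[h0 h1 h2 h3 h4]].
rewrite (circ_shrink P Q x1 (x0 - d) x0 (x0 + d) x2 y1 (y0 - d) y0 (y0 + d) y2) ?gtrBl ?ltrDl//;
  [|by move: h1; clear; lra|by move: h2; clear; lra|by move: h3; clear; lra|by move: h4; clear; lra].
have side c t : c - d <= t <= c + d -> `|t - c| <= d0.
  by move=> /andP[t1 t2]; rewrite ler_norml; move: h0 t1 t2; clear; lra.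
have end1 c : `|c - d - c| <= d0 /\ c - d <> c.
  by rewrite addrAC subrr sub0r normrN gtr0_norm//; split => //; move: dpos; clear; lra.
have end2 c : `|c + d - c| <= d0 /\ c + d <> c.
  by rewrite addrAC subrr add0r gtr0_norm//; split => //; move: dpos; clear; lra.
have [xl nl] := end1 x0; have [xr nr] := end2 x0; have [yl nb] := end1 y0; have [yr nt] := end2 y0.
have dd c : c - d <= c + d by move: dpos; clear; lra.
have clo x y : `|x - x0| <= d -> `|y - y0| <= d -> x <> x0 \/ y <> y0 -> rcont P Q x y.
  rewrite !ler_norml => /andP[e1 e2] /andP[e3 e4] ne; apply: closed_at_rcont; apply: H ne.
    by move: h1 h2 e1 e2; clear; lra.
  by move: h3 h4 e3 e4; clear; lra.
have side' c t : c - d <= t <= c + d -> `|t - c| <= d.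
  by move=> /andP[t1 t2]; rewrite ler_norml; move: t1 t2; clear; lra.
have e1 c : `|c - d - c| <= d by rewrite addrAC subrr sub0r normrN gtr0_norm.
have e2 c : `|c + d - c| <= d by rewrite addrAC subrr add0r gtr0_norm.
have B1 : `|sint (fun x => P x (y0 - d) - P x (y0 + d)) (x0 - d) (x0 + d)
    - 0 * (x0 + d - (x0 - d))| <= (2 * M) * (x0 + d - (x0 - d)).
  apply: sint_near => // x hx'.
    apply: cvgB.
      by have [] := clo x (y0 - d) (side' _ _ hx') (e1 _) (or_intror nb).
    by have [] := clo x (y0 + d) (side' _ _ hx') (e2 _) (or_intror nt).
  rewrite subr0; have xd := side _ _ hx'.
  have [b1 _] := HM x (y0 - d) xd yl (or_intror nb).
  have [b2 _] := HM x (y0 + d) xd yr (or_intror nt).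
  by apply: le_trans (ler_normB _ _) _; move: b1 b2; clear; lra.
have B2 : `|sint (fun y => Q (x0 + d) y - Q (x0 - d) y) (y0 - d) (y0 + d)
    - 0 * (y0 + d - (y0 - d))| <= (2 * M) * (y0 + d - (y0 - d)).
  apply: sint_near => // y hy'.
    apply: cvgB.
      by have [] := clo (x0 + d) y (e2 _) (side' _ _ hy') (or_introl nr).
    by have [] := clo (x0 - d) y (e1 _) (side' _ _ hy') (or_introl nl).
  rewrite subr0; have yd := side _ _ hy'.
  have [_ b1] := HM (x0 + d) y xr yd (or_introl nr).
  have [_ b2] := HM (x0 - d) y xl yd (or_introl nl).
  by apply: le_trans (ler_normB _ _) _; move: b1 b2; clear; lra.
by move: B1 B2; rewrite /circ !mul0r !subr0 !ler_norml; clear; lra.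
Qed.

End punctured.

(** * A substitute for Cauchy's integral formula *)

Section unique_continuation.
Context {R : realType}.
Implicit Types (k : R[i] -> R[i]) (z w h : R[i]).

(** Multiplying [(kw - 1) / h] by [|h|^2 = h conj h] gives [kw conj h - conj h]. The first term has
    modulus at most [eps D], and [- conj h] has real part [- cre h] and imaginary part [cim h]. *)
Lemma cauchy_kernel_bounds (kw h : R[i]) eps D : h != 0 -> cnorm kw <= eps -> cnorm h <= D ->
  `|cim ((kw - 1) / h) * cnorm h ^+ 2 - cim h| <= eps * D /\
  `|cre ((kw - 1) / h) * cnorm h ^+ 2 + cre h| <= eps * D.
Proof.
move=> h0 hk hD.
pose hc : R[i] := Complex (cre h) (- cim h).
have nhc : cnorm hc = cnorm h by rewrite /cnorm /= sqrrN.
have N : cnorm h ^+ 2 = cre h ^+ 2 + cim h ^+ 2 by rewrite sqr_sqrtr// addr_ge0// sqr_ge0.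
have hhc : h * hc = Complex (cnorm h ^+ 2) 0.
  by apply: complex_eq; rewrite compE /= ?N; ring.
have E : (kw - 1) / h * Complex (cnorm h ^+ 2) 0 = kw * hc - hc.
  by rewrite -hhc mulrA divfK// mulrBl mul1r.
have B : cnorm (kw * hc) <= eps * D.
  by rewrite cnormM nhc ler_pM ?cnorm_ge0.
have B1 := le_trans (cre_le_cnorm _) B; have B2 := le_trans (cim_le_cnorm _) B.
have E1 : cim ((kw - 1) / h) * cnorm h ^+ 2 - cim h = cim (kw * hc).
  have /(congr1 (@cim R)) := E; rewrite [LHS]cimM /= mulr0 add0r => ->.
  by rewrite cimD cimN /=; ring.
have E2 : cre ((kw - 1) / h) * cnorm h ^+ 2 + cre h = cre (kw * hc).
  have /(congr1 (@cre R)) := E; rewrite [LHS]creM /= mulr0 subr0 => ->.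
  by rewrite creD creN /=; ring.
by rewrite E1 E2.
Qed.

(** The quotient [(k - 1) / (w - z0)] stays bounded at [z0] because [k z0 = 1], so its circulation
    vanishes. On the boundary [k] is small and the quotient is close to [-1 / (w - z0)], for which
    each of the four sides contributes strictly negatively; this sign replaces the value of the
    winding number. *)
Lemma cauchy_contradiction k z0 x1 x2 y1 y2 r D eps : 0 < r -> 0 < D ->
  x1 + r <= cre z0 <= x2 - r -> y1 + r <= cim z0 <= y2 - r ->
  (forall x y, x1 <= x <= x2 -> y1 <= y <= y2 ->
     cdifferentiable k (Complex x y) /\ cnorm (Complex x y - z0) <= D) ->
  (forall x y, x1 <= x <= x2 -> y1 <= y <= y2 ->
     [\/ x = x1, x = x2, y = y1 | y = y2] -> cnorm (k (Complex x y)) <= eps) ->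
  k z0 = 1 -> eps * D < r -> False.
Proof.
move=> r0 D0 hx hy Hk Hb k1 eD.
pose q w := (k w - 1) / (w - z0).
pose P x y := cim (q (Complex x y)); pose Q x y := cre (q (Complex x y)).
have kz0 : cdifferentiable k z0.
  by have [] := Hk (cre z0) (cim z0); [lra..|rewrite complex_eta].
have cl x y : x1 <= x <= x2 -> y1 <= y <= y2 -> x <> cre z0 \/ y <> cim z0 -> closed_at P Q x y.
  move=> xx yy ne; apply: (@cdiff_closed_at _ q (Complex x y)).
  have [kd _] := Hk x y xx yy.
  apply: cdiffM; first by apply: cdiffB => //; exact: cdiff_cst.
  apply: cdiffV; last by apply: cdiffB; [exact: cdiff_id|exact: cdiff_cst].
  by rewrite subr_eq0; apply/eqP => E; case: ne; apply; rewrite -E.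
have [l hl] := kz0; have [d d0 hd] := hl 1 ltr01.
have d30 : 0 < d / 3 by lra.
have M0 : 0 <= cnorm l + 1 by rewrite addr_ge0// cnorm_ge0.
(* Near [z0] the quotient is within distance 1 of the derivative [l], which gives the bound needed
   for the puncture. *)
have C0 : circ P Q x1 x2 y1 y2 = 0.
  apply: (@circ_puncture _ _ _ _ _ _ _ (cre z0) (cim z0) (cnorm l + 1) (d / 3)) => //; [lra|lra|].
  move=> x y hx' hy' ne.
  suff B : cnorm (q (Complex x y)) <= cnorm l + 1.
    by split; apply: le_trans B; [exact: cim_le_cnorm|exact: cre_le_cnorm].
  have h0 : Complex x y - z0 != 0.
    by rewrite subr_eq0; apply/eqP => E; case: ne; apply; rewrite -E.
  have hn : cnorm (Complex x y - z0) < d.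
    by apply: le_lt_trans (cnorm_le _) _; rewrite !compE /=; lra.
  have := hd _ h0 hn; rewrite subrKC k1 -/(q _) => lt1.
  have -> : q (Complex x y) = l + (q (Complex x y) - l) by rewrite subrKC.
  by apply: le_trans (cnormD _ _) _; rewrite lerD2l ltW.
(* Every side is at distance at least [r] from [z0], so a side integrand times [|w - z0|^2] is at
   most [- (r - eps D)]; and [|w - z0|] is at most [D]. *)
pose c := (r - eps * D) / D ^+ 2.
have c0 : 0 < c by rewrite divr_gt0 ?exprn_gt0// subr_gt0.
have rc x y : x1 <= x <= x2 -> y1 <= y <= y2 -> x <> cre z0 \/ y <> cim z0 -> rcont P Q x y.
  by move=> hx' hy' ne; apply: closed_at_rcont; exact: cl.
have quot X N : 0 < N <= D ^+ 2 -> X * N <= - (r - eps * D) -> X <= - c.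
  move=> /andP[N0 ND] XN; rewrite -(ler_pM2r N0); apply: le_trans XN _.
  rewrite mulNr lerN2 /c mulrAC ler_pdivrMr ?exprn_gt0//.
  by rewrite ler_wpM2l// subr_ge0 ltW.
have bd x y : x1 <= x <= x2 -> y1 <= y <= y2 -> [\/ x = x1, x = x2, y = y1 | y = y2] ->
  [/\ x <> cre z0 \/ y <> cim z0, 0 < cnorm (Complex x y - z0) ^+ 2 <= D ^+ 2,
   `|P x y * cnorm (Complex x y - z0) ^+ 2 - (y - cim z0)| <= eps * D &
   `|Q x y * cnorm (Complex x y - z0) ^+ 2 + (x - cre z0)| <= eps * D].
  move=> xx yy b.
  have ne : x <> cre z0 \/ y <> cim z0.
    by case: b => E; [left|left|right|right] => E'; clear -E E' hx hy r0; lra.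
  have h0 : Complex x y - z0 != 0.
    by rewrite subr_eq0; apply/eqP => E; case: ne; apply; rewrite -E.
  have [_ hD] := Hk x y xx yy.
  have [B1 B2] := cauchy_kernel_bounds _ _ _ _ h0 (Hb x y xx yy b) hD.
  split=> //.
  - rewrite exprn_gt0 ?cnorm_gt0//=; apply: lerXn2r => //; rewrite nnegrE ?cnorm_ge0//.
    exact: ltW.
  - by move: B1; rewrite cimD cimN.
  - by move: B2; rewrite creD creN.
have yy1 : y1 <= y1 <= y2 by clear -hy r0; lra.
have yy2 : y1 <= y2 <= y2 by clear -hy r0; lra.
have xx1 : x1 <= x1 <= x2 by clear -hx r0; lra.
have xx2 : x1 <= x2 <= x2 by clear -hx r0; lra.
have S1 : sint (fun x => P x y1 - P x y2) x1 x2 <= (- c - c) * (x2 - x1).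
  apply: sint_le; first by clear -hx r0; lra.
    move=> x xx; apply: cvgB.
      by have [ne _ _ _] := bd x y1 xx yy1 (Or43 _ _ _ erefl); have [] := rc x y1 xx yy1 ne.
    by have [ne _ _ _] := bd x y2 xx yy2 (Or44 _ _ _ erefl); have [] := rc x y2 xx yy2 ne.
  move=> x xx; apply: lerD.
    have [_ N1 B1 _] := bd x y1 xx yy1 (Or43 _ _ _ erefl).
    by apply: quot N1 _; move: B1; rewrite ler_norml; clear -hy; lra.
  have [_ N1 B1 _] := bd x y2 xx yy2 (Or44 _ _ _ erefl).
  by apply: quot N1 _; move: B1; rewrite ler_norml mulNr; clear -hy; lra.
have S2 : sint (fun y => Q x2 y - Q x1 y) y1 y2 <= (- c - c) * (y2 - y1).
  apply: sint_le; first by clear -hy r0; lra.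
    move=> y yy; apply: cvgB.
      by have [ne _ _ _] := bd x2 y xx2 yy (Or42 _ _ _ erefl); have [] := rc x2 y xx2 yy ne.
    by have [ne _ _ _] := bd x1 y xx1 yy (Or41 _ _ _ erefl); have [] := rc x1 y xx1 yy ne.
  move=> y yy; apply: lerD.
    have [_ N1 _ B1] := bd x2 y xx2 yy (Or42 _ _ _ erefl).
    by apply: quot N1 _; move: B1; rewrite ler_norml; clear -hx; lra.
  have [_ N1 _ B1] := bd x1 y xx1 yy (Or41 _ _ _ erefl).
  by apply: quot N1 _; move: B1; rewrite ler_norml mulNr; clear -hx; lra.
have W : 0 < c * (x2 - x1) by rewrite mulr_gt0//; clear -hx r0; lra.
have W' : 0 < c * (y2 - y1) by rewrite mulr_gt0//; clear -hy r0; lra.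
by move: C0; rewrite /circ; clear -S1 S2 W W'; lra.
Qed.

End unique_continuation.

(** * The identity theorem on connected open sets *)

Section identity_theorem.
Context {R : realType}.
Implicit Types (f k : R[i] -> R[i]) (z w h a : R[i]) (U : set R[i]).

Lemma cnormB_dist z w : `|cnorm z - cnorm w| <= cnorm (z - w).
Proof.
have h1 : cnorm z <= cnorm (z - w) + cnorm w by rewrite -{1}(subrK w z) cnormD.
have h2 : cnorm w <= cnorm (z - w) + cnorm z.
  by rewrite -(cnormN (z - w)) opprB -{1}(subrK z w) cnormD.
by rewrite ler_norml; lra.
Qed.

Lemma cnorm_curve_continuous f (c : R -> R[i]) x :
  (forall s t, cnorm (c s - c t) <= `|s - t|) -> cdifferentiable f (c x) ->
  {for x, continuous (fun t => cnorm (f (c t)))}.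
Proof.
move=> hc /cdiff_continuous hf; apply/cvgrPdist_lt => /= e /hf[d d0 hd].
near=> t; rewrite distrC; apply: le_lt_trans (cnormB_dist _ _) _; apply: hd.
apply: le_lt_trans (hc _ _) _; rewrite distrC.
by near: t; exists d.
Unshelve. all: by end_near. Qed.

Lemma bounded_on_curve f (c : R -> R[i]) x1 x2 : x1 <= x2 ->
  (forall s t, cnorm (c s - c t) <= `|s - t|) ->
  (forall x, x1 <= x <= x2 -> cdifferentiable f (c x)) ->
  exists M, forall x, x1 <= x <= x2 -> cnorm (f (c x)) <= M.
Proof.
move=> x12 hc hf.
have [|x _ hx] := @EVT_max R (fun t => cnorm (f (c t))) x1 x2 x12.
  apply: cont_on_within => x hx; apply: cnorm_curve_continuous => //.
  exact: hf.
by exists (cnorm (f (c x))) => t ht; apply: hx; rewrite in_itv.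
Qed.

Lemma geometric_small (C t e : R) : 0 <= t < 1 -> 0 < e -> exists n, C * t ^+ n < e.
Proof.
move=> /andP[t0 t1] e0; have C0 : 0 < `|C| + 1 by rewrite ltr_wpDl.
have : t ^+ n @[n --> \oo] --> 0 by apply: cvg_expr; rewrite ger0_norm.
move=> /cvgrPdist_lt /(_ (e / (`|C| + 1)) (divr_gt0 e0 C0)) [n _ /(_ n (leqnn n))] /=.
rewrite sub0r normrN ger0_norm ?exprn_ge0// ltr_pdivlMr// => H; exists n.
apply: le_lt_trans H; rewrite mulrC; apply: ler_wpM2l; first exact: exprn_ge0.
by have := ler_norm C; lra.
Qed.

(** If [f z0] were nonzero, [f w / f z0] times a high power of [(z0 - a) / (w - a)] would be
    differentiable on the square, since [f] vanishes around [a]; it would equal 1 at [z0] and be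
    arbitrarily small on the boundary, where [|w - a|] is at least [rho > |z0 - a|]. This
    contradicts [cauchy_contradiction]. *)
Lemma vanish_on_square f a rho eta z0 : 0 < eta -> cnorm (z0 - a) < rho ->
  (forall w, `|cre (w - a)| <= rho -> `|cim (w - a)| <= rho -> cdifferentiable f w) ->
  (forall w, cnorm (w - a) < eta -> f w = 0) -> f z0 = 0.
Proof.
move=> eta0 z0a df f0; apply: contrapT => /eqP fz0.
have za : z0 - a != 0.
  by apply/eqP => E; move/eqP: fz0; apply; apply: f0; rewrite E cnorm0.
pose x1 := cre a - rho; pose x2 := cre a + rho.
pose y1 := cim a - rho; pose y2 := cim a + rho.
have r0 : 0 < rho by apply: le_lt_trans z0a; exact: cnorm_ge0.
have dfr x y : x1 <= x <= x2 -> y1 <= y <= y2 -> cdifferentiable f (Complex x y).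
  move=> hx hy; apply: df; rewrite !compE /= ler_norml; move: hx hy.
    by rewrite /x1 /x2; clear; lra.
  by rewrite /y1 /y2; clear; lra.
have x12 : x1 <= x2 by rewrite /x1 /x2; clear -r0; lra.
have y12 : y1 <= y2 by rewrite /y1 /y2; clear -r0; lra.
have ch y s t : cnorm (Complex s y - Complex t y : R[i]) <= `|s - t|.
  by apply: le_trans (cnorm_le _) _; rewrite !compE /= subrr normr0 addr0.
have cv x s t : cnorm (Complex x s - Complex x t : R[i]) <= `|s - t|.
  by apply: le_trans (cnorm_le _) _; rewrite !compE /= subrr normr0 add0r.
have [M1 hM1] := @bounded_on_curve f (fun x => Complex x y1) _ _ x12 (ch _)
  (fun x hx => dfr x y1 hx ltac:(by rewrite lexx)).
have [M2 hM2] := @bounded_on_curve f (fun x => Complex x y2) _ _ x12 (ch _)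
  (fun x hx => dfr x y2 hx ltac:(by rewrite lexx andbT)).
have [M3 hM3] := @bounded_on_curve f (fun y => Complex x1 y) _ _ y12 (cv _)
  (fun y hy => dfr x1 y ltac:(by rewrite lexx) hy).
have [M4 hM4] := @bounded_on_curve f (fun y => Complex x2 y) _ _ y12 (cv _)
  (fun y hy => dfr x2 y ltac:(by rewrite lexx andbT) hy).
pose M := `|M1| + `|M2| + `|M3| + `|M4|.
have hM x y : x1 <= x <= x2 -> y1 <= y <= y2 -> [\/ x = x1, x = x2, y = y1 | y = y2] ->
    cnorm (f (Complex x y)) <= M.
  have := (ler_norm M1, ler_norm M2, ler_norm M3, ler_norm M4).
  have := (normr_ge0 M1, normr_ge0 M2, normr_ge0 M3, normr_ge0 M4).
  move=> [[[g1 g2] g3] g4] [[[l1 l2] l3] l4] hx hy [E|E|E|E]; rewrite E /M.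
  - by have := hM3 y hy; clear -g1 g2 g3 g4 l3; lra.
  - by have := hM4 y hy; clear -g1 g2 g3 g4 l4; lra.
  - by have := hM1 x hx; clear -g1 g2 g3 g4 l1; lra.
  - by have := hM2 x hx; clear -g1 g2 g3 g4 l2; lra.
pose t := cnorm (z0 - a) / rho.
have t01 : 0 <= t < 1.
  by rewrite divr_ge0 ?cnorm_ge0 ?(ltW r0)//= ltr_pdivrMr// mul1r.
pose r := rho - cnorm (z0 - a).
have rp : 0 < r by rewrite subr_gt0.
have [n hn] := @geometric_small (M / cnorm (f z0) * (4 * rho)) t r t01 rp.
pose k w := f w / f z0 * ((z0 - a) / (w - a)) ^+ n.
have Mpos : 0 <= M by rewrite /M !addr_ge0.
have fz : 0 < cnorm (f z0) by rewrite cnorm_gt0.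
have zr := cre_le_cnorm (z0 - a); have zi := cim_le_cnorm (z0 - a).
apply: (@cauchy_contradiction _ k z0 x1 x2 y1 y2 r (4 * rho) (M / cnorm (f z0) * t ^+ n)) => //.
- by rewrite mulr_gt0.
- by move: zr; rewrite creD creN /x1 /x2 /r ler_norml; clear; lra.
- by move: zi; rewrite cimD cimN /y1 /y2 /r ler_norml; clear; lra.
- move=> x y hx hy; split; last first.
    apply: le_trans (cnorm_le _) _; rewrite !compE /=.
    have -> : 4 * rho = 2 * rho + 2 * rho by ring.
    move: zr zi z0a; rewrite !compE !ler_norml => zr zi z0a.
    by apply: lerD; rewrite ler_norml; move: hx hy zr zi z0a;
      rewrite /x1 /x2 /y1 /y2; clear; lra.
  (* At [a] the power is singular, but [f] vanishes on a whole disc around it and so does [k]. *)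
  have [E|wa] := eqVneq (Complex x y) a.
    apply: (@cdiff_near _ (fun=> 0) _ _ eta) => //; last exact: cdiff_cst.
    by rewrite E => w hw; rewrite /k f0// !mul0r.
  apply: cdiffM; first by apply: cdiffM; [exact: dfr|exact: cdiff_cst].
  apply: cdiffX; apply: cdiffM; first exact: cdiff_cst.
  apply: cdiffV; first by rewrite subr_eq0.
  by apply: cdiffB; [exact: cdiff_id|exact: cdiff_cst].
- move=> x y hx hy b; rewrite /k cnormM cnormX !cnormM !cnormV.
  apply: ler_pM; rewrite ?mulr_ge0 ?invr_ge0 ?exprn_ge0 ?mulr_ge0 ?invr_ge0 ?cnorm_ge0//.
    by rewrite ler_wpM2r ?invr_ge0 ?cnorm_ge0//; exact: hM.
  apply: lerXn2r; rewrite ?nnegrE ?divr_ge0 ?mulr_ge0 ?invr_ge0 ?cnorm_ge0 ?(ltW r0)//.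
  rewrite ler_wpM2l ?cnorm_ge0//.
  have le : rho <= cnorm (Complex x y - a).
    have := cre_le_cnorm (Complex x y - a); have := cim_le_cnorm (Complex x y - a).
    rewrite !compE /= !ler_norml; case: b => ->; rewrite /x1 /x2 /y1 /y2; clear; lra.
  by rewrite lef_pV2// posrE// (lt_le_trans r0 le).
- by rewrite /k divff// mul1r divff// expr1n.
- by apply: le_lt_trans hn; rewrite le_eqVlt; apply/orP; left; apply/eqP; ring.
Qed.

(** The radius [r / 8] does not depend on [eta], which is what makes the vanishing set closed. The
    square of half side [r / 3] around [w0] contains the disc of radius [r / 8] around [z], and its
    points are within [2 r / 3 + r / 8 < r] of [z]. *)
Lemma vanish_near f z r w0 eta : 0 < eta -> 0 < r -> cnorm (w0 - z) < r / 8 ->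
  (forall w, cnorm (w - z) < r -> cdifferentiable f w) ->
  (forall w, cnorm (w - w0) < eta -> f w = 0) ->
  forall w, cnorm (w - z) < r / 8 -> f w = 0.
Proof.
move=> eta0 r0 hw0 df f0 w hw; apply: (@vanish_on_square f w0 (r / 3) eta) => //.
  have -> : w - w0 = (w - z) - (w0 - z) by rewrite opprB addrA subrK.
  by apply: le_lt_trans (cnormD _ _) _; rewrite cnormN; clear -hw hw0 r0; lra.
move=> v h1 h2; apply: df; have -> : v - z = (v - w0) + (w0 - z) by rewrite addrA subrK.
apply: le_lt_trans (cnormD _ _) _; have := cnorm_le (v - w0); clear -h1 h2 hw0 r0; lra.
Qed.

(** The last hypothesis is relative closedness: each point of [U] has a radius within which any
    point of [Z] forces the centre into [Z]. The complement of [Z] in [U] is then open. *)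
Lemma connected_open_closed U (Z : set R[i]) : copen U -> cconnected U -> Z `<=` U ->
  Z !=set0 -> copen Z ->
  (forall z, U z -> exists2 r : R, 0 < r & forall w, cnorm (w - z) < r -> Z w -> Z z) ->
  U `<=` Z.
Proof.
move=> oU cU ZU [z0 Zz0] oZ clZ.
have oB : copen (U `\` Z).
  move=> z [Uz nZz]; have [r1 r10 h1] := oU z Uz; have [r2 r20 h2] := clZ z Uz.
  exists (Num.min r1 r2); first by rewrite lt_min r10.
  move=> w; rewrite lt_min => /andP[w1 w2]; split; first exact: h1.
  by move=> Zw; apply: nZz; exact: h2 w2 Zw.
have [|||] := cU Z (U `\` Z) oZ oB.
- apply/seteqP; split=> [z Uz|z [/ZU|[]]//].
  by have [Zz|nZz] := pselect (Z z); [left|right].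
- by apply/seteqP; split => // z [Zz []].
- by move=> E; move: Zz0; rewrite E.
- move=> E z Uz; apply: contrapT => nZ; suff : (U `\` Z) z by rewrite E.
  by [].
Qed.

(** On the segment from [p] to a point of [B], the supremum [s] of the parameters lying in [A] can
    be neither in [A], as larger parameters would follow, nor in [B], as smaller ones would. *)
Lemma starshaped_connected U p : U p ->
  (forall z, U z -> forall t : R, 0 <= t <= 1 -> U (p + Complex t 0 * (z - p))) ->
  cconnected U.
Proof.
move=> Up star.
have main (A B : set R[i]) : copen A -> copen B -> U = A `|` B -> A `&` B = set0 -> A p -> B = set0.
  move=> oA oB UAB AB Ap; apply/seteqP; split => // b Bb.
  pose g t : R[i] := p + Complex t 0 * (b - p).
  have g0 : g 0 = p by rewrite /g mul0r addr0.
  have g1 : g 1 = b by rewrite /g mul1r addrC subrK.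
  have gl s t : cnorm (g s - g t) = `|s - t| * cnorm (b - p).
    have -> : g s - g t = Complex (s - t) 0 * (b - p).
      by rewrite /g opprD addrACA subrr add0r -mulrBl; congr (_ * _); apply: complex_eq; rewrite !compE /= ?subr0.
    by rewrite cnormM; congr (_ * _); rewrite /cnorm /= expr0n /= addr0 sqrtr_sqr.
  have disj z : A z -> B z -> False by move=> Az Bz; suff : (A `&` B) z by rewrite AB.
  have Ub : U b by rewrite UAB; right.
  have C0 : 0 < cnorm (b - p) + 1 by rewrite ltr_wpDl ?cnorm_ge0.
  pose T := [set t : R | 0 <= t <= 1 /\ A (g t)].
  have T0 : T 0 by split; rewrite ?lexx ?ler01 ?g0.
  have Tsup : has_sup T by split; [exists 0|exists 1 => t [/andP[]]].
  pose s := sup T.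
  have s01 : 0 <= s <= 1.
    rewrite (sup_upper_bound Tsup T0)/=; apply: ge_sup => [|t [/andP[]]//].
    by exists 0.
  have near e : 0 < e -> exists2 d, 0 < d & forall t, `|t - s| < d -> cnorm (g t - g s) < e.
    move=> e0; exists (e / (cnorm (b - p) + 1)); first exact: divr_gt0.
    move=> t; rewrite ltr_pdivlMr// gl; apply: le_lt_trans.
    by rewrite ler_wpM2l//; clear; lra.
  have : U (g s) by exact: star.
  rewrite UAB => -[As|Bs].
    have [e e0 he] := oA _ As; have [d d0 hd] := near _ e0.
    have s1 : s < 1.
      rewrite lt_neqAle; move: (s01) => /andP[_ ->]; rewrite andbT; apply/eqP => E.
      by apply: (disj b) => //; rewrite -g1 -E.
    pose t := Num.min 1 (s + d / 2).
    have st : s < t by rewrite lt_min s1 /=; clear -d0; lra.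
    have Tt : T t.
      split.
        by rewrite ge_min lexx andbT; move: s01 st; clear; lra.
      apply: he; apply: hd; rewrite gtr0_norm ?subr_gt0//.
      have : t <= s + d / 2 by rewrite ge_min lexx orbT.
      by clear -d0; lra.
    by have := sup_upper_bound Tsup Tt; rewrite -/s leNgt st.
  have [e e0 he] := oB _ Bs; have [d d0 hd] := near _ e0.
  have [t Tt] := sup_adherent d0 Tsup; rewrite -/s => st.
  have ts : t <= s by exact: sup_upper_bound.
  have [_ At] := Tt; apply: (disj (g t)) => //; apply: he; apply: hd.
  by rewrite ler0_norm ?subr_le0//; clear -st; lra.
move=> A B oA oB UAB AB; have : U p by []; rewrite UAB => -[Ap|Bp].
  by right; apply: (main A B).
by left; apply: (main B A) => //; [rewrite setUC|rewrite setIC].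
Qed.

Lemma convex_halfplane (al be c : R) z p t : 0 <= t <= 1 ->
  c < al * cre z + be * cim z -> c < al * cre p + be * cim p ->
  c < al * cre (p + Complex t 0 * (z - p)) + be * cim (p + Complex t 0 * (z - p)).
Proof.
move=> /andP[t0 t1] hz hp; rewrite !compE /= !mul0r subr0 addr0.
have -> : al * (cre p + t * (cre z - cre p)) + be * (cim p + t * (cim z - cim p)) =
  (1 - t) * (al * cre p + be * cim p) + t * (al * cre z + be * cim z) by ring.
move: hz hp; set a := _ + be * _; set b := _ + be * cim p => hz hp.
have h1 : 0 <= t * (a - c) by rewrite mulr_ge0// subr_ge0 ltW.
have [t_lt|t_ge] := ltP t 1.
  by have : 0 < (1 - t) * (b - c); [rewrite mulr_gt0// subr_gt0|clear -h1; lra].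
have -> : t = 1 by apply/eqP; rewrite eq_le t1.
by rewrite subrr mul0r add0r mul1r.
Qed.
End identity_theorem.

(** * Elementary bounds for sine, cosine and exponential *)

Section real_bounds.
Context {R : realType}.
Implicit Types x y : R.

Lemma derive_growth (f df : R -> R) K y : (forall x, is_derive x 1 f (df x)) ->
  (forall x, `|x| <= `|y| -> `|df x| <= K) -> `|f y - f 0| <= K * `|y|.
Proof.
move=> fd hK.
have cf a b : {within `[a, b], continuous f}.
  apply: continuous_subspaceT => x; apply: differentiable_continuous.
  by apply/derivable1_diffP; have [] := fd x.
have [y0|/ltW y0] := leP 0 y.
  have [c] := @MVT_segment R f df 0 y y0 (fun x _ => fd x) (cf _ _).
  rewrite in_itv/= => /andP[c0 cy] ->; rewrite subr0 normrM.
  by rewrite ler_wpM2r// hK// !ger0_norm.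
have [c] := @MVT_segment R f df y 0 y0 (fun x _ => fd x) (cf _ _).
rewrite in_itv/= => /andP[yc c0] E; rewrite distrC E sub0r normrM normrN.
by rewrite ler_wpM2r// hK// !ler0_norm// lerN2.
Qed.

Lemma abs_sin_le y : `|sin y| <= `|y|.
Proof.
have := @derive_growth sin cos 1 y (fun x => is_derive_sin x) (fun x _ => cos_max x).
by rewrite sin0 subr0 mul1r.
Qed.

Lemma abs_cos_sub1_le y : `|cos y - 1| <= y ^+ 2.
Proof.
have := @derive_growth cos (fun x => - sin x) `|y| y (fun x => is_derive_cos x).
rewrite cos0 -normrM -expr2 ger0_norm ?sqr_ge0//; apply => x xy.
by rewrite normrN; apply: le_trans (abs_sin_le x) xy.
Qed.

Lemma abs_sin_sub_le y : `|sin y - y| <= y ^+ 2.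
Proof.
have D x : is_derive x 1 (fun t => sin t - t) (cos x - 1).
  by apply: is_deriveB.
have := @derive_growth _ _ `|y| y D; rewrite sin0 !subr0 -normrM -expr2 ger0_norm ?sqr_ge0//.
apply=> x xy; apply: le_trans xy.
have := @derive_growth cos (fun x => - sin x) 1 x (fun x => is_derive_cos x).
by rewrite cos0 mul1r; apply=> t _; rewrite normrN; exact: sin_max.
Qed.

Lemma expR_sub1_le x : expR x - 1 <= x * expR x.
Proof.
have := expR_ge1Dx (- x); rewrite expRN => h.
have e0 := expR_gt0 x.
have : (1 + - x) * expR x <= 1 by rewrite -ler_pdivlMr// div1r.
by lra.
Qed.

Lemma abs_expR_sub1_le x : `|expR x - 1| <= `|x| * expR `|x|.
Proof.
have h := expR_sub1_le x; have h1 := expR_ge1Dx x.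
have [x0|/ltW x0] := leP 0 x.
  by rewrite (ger0_norm x0) ger0_norm//; lra.
rewrite (ler0_norm x0) ler_norml.
have e1 : 1 <= expR (- x) by rewrite -expR0 ler_expR; lra.
have e0 := expR_gt0 x.
by apply/andP; split; nra.
Qed.

Lemma abs_expR_sub1B_le x : `|expR x - 1 - x| <= x ^+ 2 * expR `|x|.
Proof.
have h := expR_sub1_le x; have h1 := expR_ge1Dx x.
rewrite ger0_norm; last lra.
have [x0|/ltW x0] := leP 0 x; first by rewrite (ger0_norm x0); nra.
have e1 : 1 <= expR `|x| by rewrite -expR0 ler_expR.
have : expR x - 1 - x <= x ^+ 2 by nra.
have := sqr_ge0 x; nra.
Qed.

(** Square the inequality [x / 2 <= exp (x / 2)]. It lets a small exponential factor absorb a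
    squared logarithm. *)
Lemma sqr_le_expR x : 0 <= x -> x ^+ 2 <= 4 * expR x.
Proof.
move=> x0; have h := expR_ge1Dx (x / 2).
have -> : expR x = expR (x / 2) ^+ 2 by rewrite -expRM_natl; congr expR; field.
have : (x / 2) ^+ 2 <= expR (x / 2) ^+ 2 by apply: lerXn2r; rewrite ?nnegrE ?expR_ge0//; lra.
by rewrite expr_div_n; lra.
Qed.
End real_bounds.

(** * The complex exponential along a real parameter *)

Section complex_exponential.
Context {R : realType}.
Implicit Types (z h : R[i]) (t : R).

(* [cexpt z t] is [e^(z t)]. *)
Definition cexpt z t : R[i] :=
  Complex (expR (cre z * t) * cos (cim z * t)) (expR (cre z * t) * sin (cim z * t)).

Lemma cexptD z h t : cexpt (z + h) t = cexpt z t * cexpt h t.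
Proof.
apply: complex_eq; rewrite !compE /= !compE !mulrDl expRD ?cosD ?sinD; ring.
Qed.

Lemma cnorm_cexpt z t : cnorm (cexpt z t) = expR (cre z * t).
Proof.
rewrite /cnorm /= !exprMn -mulrDr cos2Dsin2 mulr1 sqrtr_sqr ger0_norm// expR_ge0.
Qed.

(** With [n = |h| |t|], the real and imaginary parts of the remainder split into four pieces, each
    at most [n^2 exp n]; the constant 5 covers them. *)
Lemma cexpt_taylor h t :
  cnorm (cexpt h t - 1 - h * Complex t 0) <= 5 * (cnorm h * t) ^+ 2 * expR (cnorm h * `|t|).
Proof.
set x := cre h * t; set y := cim h * t; set n := cnorm h * `|t|.
have xn : `|x| <= n by rewrite normrM ler_wpM2r// cre_le_cnorm.
have yn : `|y| <= n by rewrite normrM ler_wpM2r// cim_le_cnorm.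
have n0 : 0 <= n by apply: le_trans xn.
have n2 : (cnorm h * t) ^+ 2 = n ^+ 2 by rewrite /n !exprMn real_normK ?num_real.
have E1 : cre (cexpt h t - 1 - h * Complex t 0) = expR x * (cos y - 1) + (expR x - 1 - x).
  by rewrite !compE /= -/x -/y /x; ring.
have E2 : cim (cexpt h t - 1 - h * Complex t 0) = expR x * (sin y - y) + (expR x - 1) * y.
  by rewrite !compE /= -/x -/y /y; ring.
have ex : expR x <= expR n by rewrite ler_expR; apply: le_trans (ler_norm _) xn.
have eax : expR `|x| <= expR n by rewrite ler_expR.
have x2 : x ^+ 2 <= n ^+ 2 by rewrite -(real_normK (num_real x)) lerXn2r// nnegrE.
have y2 : y ^+ 2 <= n ^+ 2 by rewrite -(real_normK (num_real y)) lerXn2r// nnegrE.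
have B1 : `|expR x * (cos y - 1)| <= n ^+ 2 * expR n.
  rewrite normrM ger0_norm ?expR_ge0// mulrC ler_pM ?expR_ge0//.
  exact: le_trans (abs_cos_sub1_le y) y2.
have B2 : `|expR x - 1 - x| <= n ^+ 2 * expR n.
  apply: le_trans (abs_expR_sub1B_le x) _; rewrite ler_pM ?expR_ge0 ?sqr_ge0//.
have B3 : `|expR x * (sin y - y)| <= n ^+ 2 * expR n.
  rewrite normrM ger0_norm ?expR_ge0// mulrC ler_pM ?expR_ge0//.
  exact: le_trans (abs_sin_sub_le y) y2.
have B4 : `|(expR x - 1) * y| <= n ^+ 2 * expR n.
  rewrite normrM; have -> : n ^+ 2 * expR n = n * expR n * n by ring.
  rewrite ler_pM//; apply: le_trans (abs_expR_sub1_le x) _.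
  by rewrite ler_pM// expR_ge0.
apply: le_trans (cnorm_le _) _; rewrite E1 E2 n2.
have := ler_normD (expR x * (cos y - 1)) (expR x - 1 - x).
have := ler_normD (expR x * (sin y - y)) ((expR x - 1) * y).
have : 0 <= n ^+ 2 * expR n by rewrite mulr_ge0 ?sqr_ge0 ?expR_ge0.
by move: B1 B2 B3 B4; clear; lra.
Qed.

End complex_exponential.

(** * Complex-valued integrals and their dependence on a parameter *)

Section complex_integral.
Context {d : measure_display} {T : measurableType d} {R : realType}.
Variable (mu : {measure set T -> \bar R}).
Implicit Types (D : set T) (f : T -> R[i]) (b l g : T -> R) (z : R[i]).

Definition rintegrable D (b : T -> R) := mu.-integrable D (EFin \o b).

Lemma rintegrable_le D b g : measurable D -> measurable_fun D b ->
  (forall t, D t -> `|b t| <= g t) -> rintegrable D g -> rintegrable D b.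
Proof.
move=> mD mb bg; apply: le_integrable => //.
  by apply/measurable_EFinP.
move=> t Dt; rewrite /= lee_fin; apply: le_trans (bg t Dt) _; exact: ler_norm.
Qed.

Lemma rintegrableD D b g : measurable D -> rintegrable D b -> rintegrable D g ->
  rintegrable D (fun t => b t + g t).
Proof. by move=> mD hb hg; exact: (integrableD mD hb hg). Qed.

Lemma rintegrableB D b g : measurable D -> rintegrable D b -> rintegrable D g ->
  rintegrable D (fun t => b t - g t).
Proof. by move=> mD hb hg; exact: (integrableB mD hb hg). Qed.

Lemma rintegrableZ D c b : measurable D -> rintegrable D b -> rintegrable D (fun t => c * b t).
Proof. by move=> mD hb; exact: (integrableZl mD c hb). Qed.

Lemma rintegrable_eq D b g : measurable D -> {in D, b =1 g} -> rintegrable D b -> rintegrable D g.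
Proof. by move=> mD bg; apply: eq_integrable => // t tD /=; rewrite bg. Qed.

Definition cintegrable D f :=
  rintegrable D (fun t => cre (f t)) /\ rintegrable D (fun t => cim (f t)).

Definition cint D f : R[i] :=
  Complex (\int[mu]_(t in D) cre (f t))%R (\int[mu]_(t in D) cim (f t))%R.

Lemma eq_cint D f (g : T -> R[i]) : (forall t, D t -> f t = g t) -> cint D f = cint D g.
Proof. by move=> fg; congr Complex; apply: eq_Rintegral => t; rewrite inE => /fg ->. Qed.

Lemma cintegrable_le D f (g : T -> R) : measurable D ->
  measurable_fun D (fun t => cre (f t)) -> measurable_fun D (fun t => cim (f t)) ->
  (forall t, D t -> cnorm (f t) <= g t) -> rintegrable D g -> cintegrable D f.
Proof.
move=> mD m1 m2 fg ig; split; apply: (@rintegrable_le _ _ g) => // t Dt.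
  exact: le_trans (cre_le_cnorm _) (fg t Dt).
exact: le_trans (cim_le_cnorm _) (fg t Dt).
Qed.

Lemma cintegrableD D f (g : T -> R[i]) : measurable D -> cintegrable D f -> cintegrable D g ->
  cintegrable D (fun t => f t + g t).
Proof.
move=> mD [f1 f2] [g1 g2]; split.
  by apply: rintegrable_eq mD _ (rintegrableD _ _ _ mD f1 g1) => t _; rewrite creD.
by apply: rintegrable_eq mD _ (rintegrableD _ _ _ mD f2 g2) => t _; rewrite cimD.
Qed.

Lemma cintegrableM D c f : measurable D -> cintegrable D f ->
  cintegrable D (fun t => c * f t).
Proof.
move=> mD [f1 f2]; split.
  apply: rintegrable_eq mD _ (rintegrableB _ _ _ mD (rintegrableZ _ (cre c) _ mD f1)
    (rintegrableZ _ (cim c) _ mD f2)) => t _; by rewrite creM.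
apply: rintegrable_eq mD _ (rintegrableD _ _ _ mD (rintegrableZ _ (cre c) _ mD f2)
    (rintegrableZ _ (cim c) _ mD f1)) => t _; by rewrite cimM.
Qed.

Lemma cintD D f (g : T -> R[i]) : measurable D -> cintegrable D f -> cintegrable D g ->
  cint D (fun t => f t + g t) = cint D f + cint D g.
Proof.
move=> mD [f1 f2] [g1 g2]; apply: complex_eq; rewrite ?compE /=.
  rewrite -RintegralD//; apply: eq_Rintegral => t _; exact: creD.
rewrite -RintegralD//; apply: eq_Rintegral => t _; exact: cimD.
Qed.

Lemma cintM D c f : measurable D -> cintegrable D f ->
  cint D (fun t => c * f t) = c * cint D f.
Proof.
move=> mD [f1 f2]; apply: complex_eq; rewrite ?compE /=.
  rewrite -!RintegralZl// -RintegralB//; first by apply: eq_Rintegral => t _; exact: creM.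
    exact: rintegrableZ.
  exact: rintegrableZ.
rewrite -!RintegralZl// -RintegralD//; first by apply: eq_Rintegral => t _; exact: cimM.
  exact: rintegrableZ.
exact: rintegrableZ.
Qed.

(** The factor 2 comes from bounding real and imaginary parts separately; for the derivative
    estimate only the order of magnitude matters. *)
Lemma cint_bound D f (g : T -> R) : measurable D -> cintegrable D f -> rintegrable D g ->
  (forall t, D t -> cnorm (f t) <= g t) -> cnorm (cint D f) <= 2 * (\int[mu]_(t in D) g t)%R.
Proof.
move=> mD [f1 f2] ig fg; apply: le_trans (cnorm_le _) _ => /=.
rewrite mulrDl mul1r; apply: lerD.
  apply: le_trans (le_normr_Rintegral mD f1) _.
  apply: le_Rintegral => //; first exact: (integrable_abse f1).
  by move=> t Dt; apply: le_trans (cre_le_cnorm _) (fg t Dt).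
apply: le_trans (le_normr_Rintegral mD f2) _.
apply: le_Rintegral => //; first exact: (integrable_abse f2).
by move=> t Dt; apply: le_trans (cim_le_cnorm _) (fg t Dt).
Qed.

Lemma measurable_cexpt D b l z : measurable_fun D b -> measurable_fun D l ->
  measurable_fun D (fun t => cre (Complex (b t) 0 * cexpt z (l t))) /\
  measurable_fun D (fun t => cim (Complex (b t) 0 * cexpt z (l t))).
Proof.
move=> mb ml.
have me : measurable_fun D (fun t => expR (cre z * l t)).
  by apply: measurableT_comp => //; apply: measurable_funM => //; exact: measurable_cst.
have my : measurable_fun D (fun t => cim z * l t).
  by apply: measurable_funM => //; exact: measurable_cst.
have mc : measurable_fun D (fun t => cos (cim z * l t)).
  apply: measurableT_comp my; apply: continuous_measurable_fun; exact: continuous_cos.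
have ms : measurable_fun D (fun t => sin (cim z * l t)).
  apply: measurableT_comp my; apply: continuous_measurable_fun; exact: continuous_sin.
split.
  apply: eq_measurable_fun (measurable_funM mb (measurable_funM me mc)) => t _.
  by rewrite creM [cre (Complex _ _)]/= [cim (Complex _ 0)]/= mul0r subr0.
apply: eq_measurable_fun (measurable_funM mb (measurable_funM me ms)) => t _.
by rewrite cimM [cre (Complex _ _)]/= [cim (Complex _ 0)]/= mul0r addr0.
Qed.

Lemma cnorm_bcexpt (b : R) z t : cnorm (Complex b 0 * cexpt z t) = `|b| * expR (cre z * t).
Proof. by rewrite cnormM cnorm_cexpt /cnorm /= expr0n /= addr0 sqrtr_sqr. Qed.

Lemma cexpt_integrable D b l z : measurable D -> measurable_fun D b -> measurable_fun D l ->
  rintegrable D (fun t => `|b t| * expR (cre z * l t)) ->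
  cintegrable D (fun t => Complex (b t) 0 * cexpt z (l t)).
Proof.
move=> mD mb ml ib; have [m1 m2] := measurable_cexpt _ _ _ z mb ml.
by apply: cintegrable_le mD m1 m2 _ ib => t _; rewrite cnorm_bcexpt.
Qed.

(** Integrability at the two exponents [cre z - r] and [cre z + r] dominates the integrand together
    with an extra factor [exp (r |l|)]. That factor absorbs the [l] in the derivative and the [l^2]
    in the Taylor remainder. *)
Lemma cexpt_int_differentiable D b l z r : measurable D -> measurable_fun D b ->
  measurable_fun D l -> 0 < r ->
  (forall x, `|x - cre z| <= r -> rintegrable D (fun t => `|b t| * expR (x * l t))) ->
  cdifferentiable (fun w => cint D (fun t => Complex (b t) 0 * cexpt w (l t))) z.
Proof.
move=> mD mb ml r0 ib.
(* Whatever the sign of [l t], one of the two summands is the integrand times [exp (r |l t|)]. *)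
pose g t := `|b t| * expR ((cre z + r) * l t) + `|b t| * expR ((cre z - r) * l t).
have ig : rintegrable D g.
  apply: rintegrableD => //; apply: ib.
    by rewrite addrAC subrr add0r ger0_norm// ltW.
  by rewrite addrAC subrr add0r normrN ger0_norm// ltW.
have gE t : `|b t| * expR (cre z * l t) * expR (r * `|l t|) <= g t.
  rewrite -mulrA -expRD /g -mulrDr ler_wpM2l//.
  have [l0|l0] := leP 0 (l t).
    by rewrite ger0_norm// -mulrDl lerDl expR_ge0.
  rewrite ltr0_norm// mulrN -mulrBl lerDr expR_ge0//.
pose l' := cint D (fun t => Complex (b t * l t) 0 * cexpt z (l t)).
have er t : 1 <= expR (r * `|l t|) by rewrite -expR0 ler_expR mulr_ge0// ltW.
have lr t : `|l t| <= expR (r * `|l t|) / r.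
  by rewrite ler_pdivlMr// mulrC; apply: le_trans (expR_ge1Dx _); rewrite lerDr.
have i1 : cintegrable D (fun t => Complex (b t * l t) 0 * cexpt z (l t)).
  have mbl : measurable_fun D (fun t => b t * l t) by exact: measurable_funM.
  have [m1 m2] := measurable_cexpt _ _ _ z mbl ml.
  apply: (cintegrable_le _ _ (fun t => r^-1 * g t) mD m1 m2) => [t Dt|]; last exact: rintegrableZ.
  rewrite cnorm_bcexpt normrM; apply: le_trans (ler_wpM2l _ (gE t)); last by rewrite invr_ge0 ltW.
  have -> : r^-1 * (`|b t| * expR (cre z * l t) * expR (r * `|l t|)) =
    `|b t| * (expR (r * `|l t|) / r) * expR (cre z * l t) by ring.
  by rewrite ler_wpM2r ?expR_ge0// ler_wpM2l.
have i0 w : cnorm (w - z) <= r -> cintegrable D (fun t => Complex (b t) 0 * cexpt w (l t)).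
  move=> hw; apply: cexpt_integrable => //; apply: ib.
  by apply: le_trans hw; rewrite -creN -creD; exact: cre_le_cnorm.
pose K := 2 * (\int[mu]_(t in D) (5 * (16 / r ^+ 2) * g t))%R.
have K0 : 0 <= K.
  rewrite mulr_ge0// Rintegral_ge0// => t _.
  rewrite !mulr_ge0// ?invr_ge0 ?sqr_ge0//; apply: le_trans (gE t).
  by rewrite !mulr_ge0// expR_ge0.
have K1 : 0 < K + 1 by clear -K0; lra.
(* Keeping [|h|] below [r / 2] uses half of the exponential room for the Taylor factor. [K] bounds
   the remainder integral divided by [|h|^2]. *)
exists l' => e e0; exists (Num.min (r / 2) (e / (K + 1))).
  by rewrite lt_min divr_gt0//= divr_gt0.
move=> h h0; rewrite lt_min => /andP[hr he].
have nh : 0 < cnorm h by rewrite cnorm_gt0.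
pose Rm t := Complex (b t) 0 * cexpt z (l t) * (cexpt h (l t) - 1 - h * Complex (l t) 0).
have ER : cint D (fun t => Complex (b t) 0 * cexpt (z + h) (l t)) =
   cint D (fun t => Complex (b t) 0 * cexpt z (l t)) + h * l' + cint D Rm /\ cintegrable D Rm.
  have iz : cintegrable D (fun t => Complex (b t) 0 * cexpt z (l t)).
    by apply: i0; rewrite subrr cnorm0 ltW.
  have izh : cintegrable D (fun t => Complex (b t) 0 * cexpt (z + h) (l t)).
    by apply: i0; rewrite addrAC subrr add0r; clear -hr r0; lra.
  have ihl : cintegrable D (fun t => h * (Complex (b t * l t) 0 * cexpt z (l t))).
    exact: cintegrableM.
  have RmE : Rm = (fun t => Complex (b t) 0 * cexpt (z + h) (l t) +
     ((-1) * (Complex (b t) 0 * cexpt z (l t)) + (-1) * (h * (Complex (b t * l t) 0 * cexpt z (l t))))).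
    apply/funext => t; rewrite /Rm cexptD.
    have -> : Complex (b t * l t) 0 = Complex (b t) 0 * Complex (l t) 0 :> R[i].
      by apply: complex_eq; rewrite !compE /=; ring.
    by ring.
  have iRm : cintegrable D Rm.
    rewrite RmE; apply: cintegrableD => //; apply: cintegrableD => //; exact: cintegrableM.
  split=> //; rewrite RmE.
  rewrite cintD//; last by apply: cintegrableD => //; exact: cintegrableM.
  rewrite cintD//; [|exact: cintegrableM|exact: cintegrableM].
  by rewrite !(cintM _ (-1))// (cintM _ h)// /l'; ring.
have [-> iRm] := ER.
have -> : (cint D (fun t => Complex (b t) 0 * cexpt z (l t)) + h * l' + cint D Rm -
   cint D (fun t => Complex (b t) 0 * cexpt z (l t))) / h - l' = cint D Rm / h by field.
rewrite cnormM cnormV ltr_pdivrMr//.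
have B : cnorm (cint D Rm) <= cnorm h ^+ 2 * K.
  have -> : cnorm h ^+ 2 * K = 2 * (\int[mu]_(t in D) (cnorm h ^+ 2 * (5 * (16 / r ^+ 2) * g t)))%R.
    rewrite RintegralZl//; last exact: rintegrableZ.
    by rewrite /K; ring.
  apply: cint_bound => //; first by do 2! apply: rintegrableZ => //.
  move=> t Dt; rewrite /Rm cnormM cnorm_bcexpt.
  apply: le_trans (ler_wpM2l _ (cexpt_taylor h (l t))) _; first by rewrite mulr_ge0// expR_ge0.
  have g1 := gE t.
  have e1 : expR (cnorm h * `|l t|) <= expR (r / 2 * `|l t|).
    by rewrite ler_expR ler_wpM2r// ltW.
  have e2 : (l t) ^+ 2 <= 16 / r ^+ 2 * expR (r / 2 * `|l t|).
    have x0 : 0 <= r / 2 * `|l t| by rewrite mulr_ge0// divr_ge0// ltW.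
    have := sqr_le_expR _ x0; rewrite exprMn real_normK ?num_real// => le4.
    have r2 : 0 < r ^+ 2 by rewrite exprn_gt0.
    rewrite mulrAC ler_pdivlMr//; move: le4; rewrite expr_div_n; clear; lra.
  (* One half of the room pays for [exp (|h| |l|)], the other for [l^2], which is at most [16 / r^2]
     times it by [sqr_le_expR] at [r |l| / 2]. *)
  have e3 : expR (r * `|l t|) = expR (r / 2 * `|l t|) * expR (r / 2 * `|l t|).
    by rewrite -expRD; congr expR; field.
  set X := `|b t| * expR (cre z * l t) in g1 *.
  have X0 : 0 <= X by rewrite mulr_ge0// expR_ge0.
  set E1 := expR (cnorm h * `|l t|) in e1 *; set E2 := expR (r / 2 * `|l t|) in e1 e2 e3.
  have E20 : 0 <= E2 by exact: expR_ge0.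
  have E10 : 0 <= E1 by exact: expR_ge0.
  have m1 : l t ^+ 2 * E1 <= 16 / r ^+ 2 * expR (r * `|l t|).
    by rewrite e3 mulrA ler_pM// sqr_ge0.
  have -> : X * (5 * (cnorm h * l t) ^+ 2 * E1) = (5 * cnorm h ^+ 2 * X) * (l t ^+ 2 * E1) by ring.
  apply: le_trans (ler_wpM2l _ m1) _.
    by rewrite !mulr_ge0// ?cnorm_ge0 ?sqr_ge0.
  have -> : 5 * cnorm h ^+ 2 * X * (16 / r ^+ 2 * expR (r * `|l t|)) =
    (cnorm h ^+ 2 * (5 * (16 / r ^+ 2))) * (X * expR (r * `|l t|)) by ring.
  rewrite [leRHS]mulrA; apply: ler_wpM2l => //.
  by rewrite !mulr_ge0// ?cnorm_ge0 ?sqr_ge0// ?invr_ge0 ?sqr_ge0.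
apply: le_lt_trans B _.
have : cnorm h * (K + 1) < e by rewrite -ltr_pdivlMr.
rewrite expr2 -mulrA [e * _]mulrC (ltr_pM2l nh).
by apply: le_lt_trans; rewrite ler_pM2l//; clear; lra.
Qed.

End complex_integral.

(** * The fundamental theorem of calculus up to an open end point *)

Section fundamental_theorem.
Context {R : realType}.
Implicit Types (F f : R -> R) (a e l : R).
Notation mu := (@lebesgue_measure R).

Lemma FTC_segment F f e a : e < a ->
  (forall t, e <= t <= a -> is_derive t 1 F (f t)) ->
  (forall t, e <= t <= a -> {for t, continuous f}) ->
  (\int[mu]_(t in `[e, a]) (f t)%:E = (F a - F e)%:E)%E.
Proof.
move=> ea dF cf.
have cF t : e <= t <= a -> {for t, continuous F}.
  move=> /dF [dFt _]; apply: differentiable_continuous.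
  exact/derivable1_diffP.
rewrite (@continuous_FTC2 _ f F)//.
- by apply: cont_on_within.
- split.
  + by move=> t; rewrite in_itv/= => /andP[et ta]; have [|] := dF t; rewrite ?(ltW et) ?(ltW ta).
  + apply: cvg_at_right_filter; apply: cF; rewrite lexx ltW//.
  + apply: cvg_at_left_filter; apply: cF; rewrite lexx ltW//.
- move=> t; rewrite in_itv/= => /andP[et ta]; rewrite derive1E.
  by apply: derive_val; apply: dF; rewrite !ltW.
Qed.

Lemma sint_FTC F f e a : e < a ->
  (forall t, e <= t <= a -> is_derive t 1 F (f t)) ->
  (forall t, e <= t <= a -> {for t, continuous f}) ->
  sint f e a = F a - F e.
Proof. by move=> ea dF cf; rewrite /sint /Rintegral (FTC_segment _ _ _ _ ea dF cf). Qed.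

(** For integrands that may change sign, integrability is a hypothesis: the integral over []0, x]]
    then tends to zero with [x], and the rest is [F a - F x]. *)
Lemma FTC_at0 F f a l : 0 < a ->
  (forall t, 0 < t <= a -> is_derive t 1 F (f t)) ->
  (forall t, 0 < t <= a -> {for t, continuous f}) ->
  F t @[t --> 0^'+] --> l ->
  mu.-integrable `]0, a] (EFin \o f) ->
  (\int[mu]_(t in `]0, a]) f t)%R = F a - l.
Proof.
move=> a0 dF cf Fl /integrableP[mf intf].
have fi0 : mu.-integrable `[0, a] (EFin \o f).
  apply/integrableP; split.
    by apply/measurable_EFinP/measurable_fun_itv_obnd_cbndP/measurable_EFinP.
  by rewrite -integral_itv_obnd_cbnd//; exact: measurableT_comp.
rewrite Rintegral_itv_obnd_cbnd; last by apply/integrableP; split.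
have p0 := @parameterized_integral_cvg_left R 0 a f a0 fi0.
have : (parameterized_integral mu 0 x f + (F a - F x)) @[x --> 0^'+] --> 0 + (F a - l).
  apply: cvgD; last by apply: cvgB => //; exact: cvg_cst.
  exact: cvg_at_right_filter.
rewrite add0r => H; apply/esym; apply: (cvg_unique _ H) => //.
apply: cvg_near_cst; near=> x.
have x0 : 0 < x by [].
have xa : x < a by near: x; exact: nbhs_right_lt.
have := @Rintegral_itvB R f (BLeft 0) (BRight a) x fi0.
rewrite !bnd_simp => /(_ (ltW x0) (ltW xa)).
have fix_ : mu.-integrable `]x, a] (EFin \o f).
  by apply: integrableS fi0 => //; apply: subset_itvr; rewrite bnd_simp ltW.
rewrite Rintegral_itv_obnd_cbnd// -/(sint f x a).
have -> : sint f x a = F a - F x.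
  apply: (sint_FTC _ _ _ _ xa) => t /andP[xt ta]; first by apply: dF; rewrite ta (lt_le_trans x0).
  by apply: cf; rewrite ta (lt_le_trans x0).
by rewrite /parameterized_integral => <-; rewrite subrKC.
Unshelve. all: by end_near. Qed.

Lemma cont_measurable_oc f a : (forall t, 0 < t <= a -> {for t, continuous f}) ->
  measurable_fun `]0, a] f.
Proof.
move=> cf; apply/measurable_fun_itv_bndo_bndcP; apply: open_continuous_measurable_fun => //.
by move=> t; rewrite inE/= in_itv/= => /andP[t0 /ltW ta]; apply: cf; rewrite t0.
Qed.

Lemma itvoc_bigcup a : 0 < a -> `]0, a]%classic = \bigcup_n `[a / n.+2%:R, a]%classic :> set R.
Proof.
move=> a0; apply/seteqP; split=> [t|t [n _]] /=; rewrite !in_itv/= => /andP[t0 ta]; last first.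
  by rewrite ta (lt_le_trans _ t0)// divr_gt0.
have [n _ /(_ n (leqnn n)) /= H] : \forall n \near \oo, a / t < n%:R.
  by near=> n; near: n; exact: nbhs_infty_gtr.
exists n => //=; rewrite in_itv/= ta andbT ler_pdivrMr//.
rewrite mulrC -ler_pdivrMr//; apply: le_trans (ltW H) _.
by rewrite ler_nat -addn2 leq_addr.
Unshelve. all: by end_near. Qed.

(** For a nonnegative integrand, monotone convergence along an exhaustion by segments gives
    finiteness of the integral together with its value. *)
Lemma FTC_at0_ge0 F f a l : 0 < a ->
  (forall t, 0 < t <= a -> is_derive t 1 F (f t)) ->
  (forall t, 0 < t <= a -> {for t, continuous f}) ->
  (forall t, 0 < t <= a -> 0 <= f t) ->
  F t @[t --> 0^'+] --> l ->
  (\int[mu]_(t in `]0%R, a]) (f t)%:E = (F a - l)%:E)%E.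
Proof.
move=> a0 dF cf f0 Fl.
(* Starting the denominators at 2 keeps the left end strictly below [a], as [FTC_segment]
   requires. *)
pose D n := `[a / n.+2%:R, a]%classic : set R.
have Dsub n t : D n t -> 0 < t <= a.
  by rewrite /D /= in_itv/= => /andP[h ->]; rewrite (lt_le_trans _ h)// divr_gt0.
have ndD : nondecreasing_seq D.
  move=> n m nm; apply/subsetPset => t; rewrite /D /= !in_itv/= => /andP[h ->].
  rewrite andbT; apply: le_trans h; rewrite ler_pM2l// lef_pV2 ?posrE//.
  by rewrite ler_nat !ltnS.
have mD n : measurable (D n) by exact: measurable_itv.
have mf n : measurable_fun (D n) (EFin \o f).
  apply/measurable_EFinP; apply: measurable_funS (cont_measurable_oc _ _ cf) => // t /Dsub.
  by rewrite /= in_itv.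
have H : (\int[mu]_(x in D n) (EFin \o f) x @[n --> \oo] -->
    \int[mu]_(x in \bigcup_n D n) (EFin \o f) x)%E.
  apply: ge0_nondecreasing_set_cvg_integral => // n x /Dsub h.
  by rewrite lee_fin; exact: f0.
rewrite -itvoc_bigcup// in H.
apply: (cvg_unique _ H) => //.
have E n : (\int[mu]_(x in D n) (EFin \o f) x)%E = (F a - F (a / n.+2%:R))%:E.
  have lt : a / n.+2%:R < a by rewrite ltr_pdivrMr// ltr_pMr// ltr1n.
  have lt0 : 0 < a / n.+2%:R by rewrite divr_gt0.
  apply: (FTC_segment _ _ _ _ lt).
    by move=> t /andP[h1 h2]; apply: dF; rewrite h2 (lt_le_trans lt0).
  by move=> t /andP[h1 h2]; apply: cf; rewrite h2 (lt_le_trans lt0).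
rewrite (funext E); apply: cvg_EFin; first exact: nearW.
apply: cvgB; first exact: cvg_cst.
move/cvg_at_rightP : Fl; apply; split; first by move=> n; rewrite divr_gt0.
rewrite -[X in _ --> X](mulr0 a); apply: cvgM; first exact: cvg_cst.
have := @cvg_harmonic R; rewrite -(cvg_shiftS) => h.
exact: h.
Qed.
End fundamental_theorem.

(** * Rules of differentiation for real functions *)

Section derivative_rules.
Context {R : realType}.
Implicit Types (f g : R -> R) (t a b : R).

Lemma drv_eq f t a b : is_derive t 1 f a -> a = b -> is_derive t 1 f b.
Proof. by move=> h <-. Qed.

Lemma drv_add f g t a b : is_derive t 1 f a -> is_derive t 1 g b ->
  is_derive t 1 (fun x => f x + g x) (a + b).
Proof. by move=> ? ?; exact: is_deriveD. Qed.

Lemma drv_opp f t a : is_derive t 1 f a -> is_derive t 1 (fun x => - f x) (- a).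
Proof. by move=> ?; exact: is_deriveN. Qed.

Lemma drv_sub f g t a b : is_derive t 1 f a -> is_derive t 1 g b ->
  is_derive t 1 (fun x => f x - g x) (a - b).
Proof. by move=> ? ?; exact: is_deriveB. Qed.

Lemma drv_mul f g t a b : is_derive t 1 f a -> is_derive t 1 g b ->
  is_derive t 1 (fun x => f x * g x) (a * g t + f t * b).
Proof.
move=> hf hg; apply: drv_eq (is_deriveM hf hg) _.
by rewrite /GRing.scale/= addrC mulrC.
Qed.

Lemma drv_scale c f t a : is_derive t 1 f a -> is_derive t 1 (fun x => c * f x) (c * a).
Proof. by move=> ?; exact: is_deriveZ. Qed.

Lemma drv_inv f t a : f t != 0 -> is_derive t 1 f a ->
  is_derive t 1 (fun x => (f x)^-1) (- (a / f t ^+ 2)).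
Proof.
move=> h0 hf; apply: drv_eq (is_deriveV h0 hf) _.
by rewrite /GRing.scale/= mulNr mulrC.
Qed.

Lemma drv_comp f g t a b : is_derive (g t) 1 f a -> is_derive t 1 g b ->
  is_derive t 1 (fun x => f (g x)) (a * b).
Proof. by move=> ? ?; exact: is_derive1_comp. Qed.

Lemma drv_pow f n t a : is_derive t 1 f a ->
  is_derive t 1 (fun x => f x ^+ n) (n%:R * f t ^+ n.-1 * a).
Proof.
have -> : (fun x => f x ^+ n) = f ^+ n by rewrite exprfctE.
by move=> hf; exact: (is_deriveX n hf).
Qed.

Lemma drv_exp f t a : is_derive t 1 f a ->
  is_derive t 1 (fun x => expR (f x)) (expR (f t) * a).
Proof. by move=> hf; apply: drv_comp. Qed.

Lemma drv_ln f t a : 0 < f t -> is_derive t 1 f a ->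
  is_derive t 1 (fun x => ln (f x)) (a / f t).
Proof.
move=> h0 hf; have h1 := is_derive1_ln h0.
by apply: drv_eq (drv_comp _ _ _ _ _ h1 hf) _; rewrite mulrC.
Qed.

Lemma drv_cst (c t : R) : is_derive t 1 (fun _ : R => c) 0.
Proof. exact: is_derive_cst. Qed.

Lemma drv_id t : is_derive t 1 (fun x : R => x) 1.
Proof. exact: is_derive_id. Qed.

Lemma drv_cont f t a : is_derive t 1 f a -> {for t, continuous f}.
Proof.
by move=> [h _]; apply: differentiable_continuous; exact/derivable1_diffP.
Qed.

Lemma drv_D1 f t a : is_derive t 1 f a -> D1 f t = a.
Proof. by move=> [_ <-]; rewrite /D1 derive1E. Qed.

Lemma D1_drv f t : derivable f t 1 -> is_derive t 1 f (D1 f t).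
Proof. by move=> h; rewrite /D1 derive1E; exact: derivableP. Qed.

End derivative_rules.

(** * Tonelli and Fubini on products of sets *)

Section rectangles.
Context {R : realType}.
Notation mu := (@lebesgue_measure R).
Implicit Types (A B : set R).

Definition mu2 := (mu \x mu)%E.

Lemma patch_rect A B (f : R * R -> \bar R) s t :
  (f \_ (A `*` B)) (s, t) = ((fun s => ((fun t => f (s, t)) \_ B) t) \_ A) s.
Proof.
rewrite !patchE; case: (boolP (s \in A)) => sA; case: (boolP (t \in B)) => tB.
- by rewrite ifT// inE; split => /=; [rewrite -in_setE|rewrite -in_setE].
- by rewrite ifF//; apply/negP; rewrite inE => -[_ /= /mem_set]; apply/negP.
- by rewrite ifF//; apply/negP; rewrite inE => -[/= /mem_set h _]; move/negP: sA.
- by rewrite ifF//; apply/negP; rewrite inE => -[/= /mem_set h _]; move/negP: sA.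
Qed.

Lemma iterated_patch A B (f : R * R -> \bar R) :
  (\int[mu]_s \int[mu]_t (f \_ (A `*` B)) (s, t) =
   \int[mu]_(s in A) \int[mu]_(t in B) f (s, t))%E.
Proof.
rewrite [RHS]integral_mkcond; apply: eq_integral => s _.
rewrite patchE; case: (boolP (s \in A)) => sA.
  rewrite [RHS]integral_mkcond; apply: eq_integral => t _.
  by rewrite patch_rect patchE sA.
rewrite -[RHS](integral0 mu setT); apply: eq_integral => t _.
by rewrite patch_rect patchE (negbTE sA).
Qed.

Lemma rect_tonelli A B (f : R * R -> \bar R) : measurable A -> measurable B ->
  measurable_fun (A `*` B) f -> (forall p, (A `*` B) p -> 0 <= f p)%E ->
  (\int[mu2]_(p in A `*` B) f p = \int[mu]_(s in A) \int[mu]_(t in B) f (s, t))%E.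
Proof.
move=> mA mB mf f0; rewrite -iterated_patch integral_mkcond.
rewrite fubini_tonelli1//.
  by apply/(measurable_restrictT f) => //; exact: measurableX.
by move=> p; apply: erestrict_ge0.
Qed.

Lemma rect_fubini A B (f : R * R -> \bar R) : measurable A -> measurable B ->
  mu2.-integrable (A `*` B) f ->
  (\int[mu2]_(p in A `*` B) f p = \int[mu]_(s in A) \int[mu]_(t in B) f (s, t))%E.
Proof.
move=> mA mB intf; rewrite -iterated_patch integral_mkcond -integral12_prod_meas1//.
by apply/integrable_restrict => //; [exact: measurableX|rewrite setTI].
Qed.

Lemma Rrect_fubini A B (f : R -> R -> R) : measurable A -> measurable B ->
  rintegrable mu2 (A `*` B) (fun p => f p.1 p.2) ->
  (forall s, A s -> rintegrable mu B (f s)) ->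
  (\int[mu2]_(p in A `*` B) f p.1 p.2 =
   \int[mu]_(s in A) \int[mu]_(t in B) f s t)%R.
Proof.
move=> mA mB intf intB; rewrite /Rintegral rect_fubini//; congr fine.
apply: eq_integral => s; rewrite inE => sA /=.
by rewrite fineK//; apply: integrable_fin_num => //; exact: intB.
Qed.

(** The majorant depends on the second variable only, which is how powers of [t] control a function
    of [(s, t)] near the diagonal; Tonelli gives at most [|b - a|] times its integral. *)
Lemma rect_integrable (a b : R) B (f : R * R -> R) (h : R -> R) : measurable B ->
  measurable_fun (`[a, b]%classic `*` B) f ->
  rintegrable mu B h ->
  (forall s t, a <= s <= b -> B t -> `|f (s, t)| <= h t) ->
  rintegrable mu2 (`[a, b]%classic `*` B) f.
Proof.
move=> mB mf ih fh; apply/integrableP; split; first exact/measurable_EFinP.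
have mAB : measurable (`[a, b]%classic `*` B) by exact: measurableX.
rewrite rect_tonelli//; last by apply: measurableT_comp => //; exact/measurable_EFinP.
have [mh lth] := integrableP _ _ _ ih.
apply: (@le_lt_trans _ _ (\int[mu]_(s in `[a, b]) (\int[mu]_(t in B) `|(h t)%:E|))%E).
  apply: ge0_le_integral => //.
  - by move=> s _; exact: integral_ge0.
  - have mpatch : measurable_fun [set: R * R] ((fun p => `|(f p)%:E|%E) \_ (`[a, b]%classic `*` B)).
      by apply/(measurable_restrictT _ mAB); apply: measurableT_comp => //; exact/measurable_EFinP.
    have h0 p : (0 <= ((fun p => `|(f p)%:E|%E) \_ (`[a, b]%classic `*` B)) p)%E.
      by apply: erestrict_ge0.
    have := measurable_fun_fubini_tonelli_F (m2 := mu) _ mpatch h0.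
    move=> /(measurable_funS _ (@subsetT _ `[a, b]%classic)) hh.
    apply: eq_measurable_fun (hh _) => // s; rewrite inE => sab.
    rewrite /fubini_F [RHS]integral_mkcond; apply: eq_integral => t _.
    by rewrite patch_rect patchE mem_set.
  - move=> s; rewrite /= in_itv/= => sab.
    have mfs : measurable_fun B (fun t => f (s, t)).
      apply: (@measurable_comp _ _ _ _ _ _ (`[a, b]%classic `*` B) f B (pair s)) => //.
        by move=> _ [t Bt <-]; split => //=; rewrite in_itv.
      by apply: measurable_funTS; exact: measurable_pair1.
    apply: ge0_le_integral => //.
    + by apply/measurable_EFinP; apply: measurableT_comp.
    + by apply/measurable_EFinP; apply: measurableT_comp => //; exact/measurable_EFinP.
    + move=> t Bt; rewrite lee_fin; apply: le_trans (ler_norm _).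
    exact: fh.
rewrite integral_cst//; apply: lte_mul_pinfty => //; first exact: integral_ge0.
  by rewrite ge0_fin_numE//; exact: integral_ge0.
apply: le_lt_trans (ltry (`|b - a|)).
have h1 : (mu `[a, b]%classic <= `|b - a|%:E)%E.
  rewrite lebesgue_measure_itv/=; case: ifP => _; last by rewrite lee_fin.
  by rewrite -EFinB lee_fin ler_norm.
exact: h1.
Qed.

End rectangles.

(** * Real powers near zero *)

Section powers.
Context {R : realType}.
Notation mu := (@lebesgue_measure R).

Lemma drv_power (q t : R) : 0 < t ->
  is_derive t 1 (fun t => expR (q * ln t)) (q * expR (q * ln t) / t).
Proof.
move=> t0; apply: drv_eq (drv_exp _ _ _ (drv_scale q _ _ _ (drv_ln _ _ _ t0 (drv_id t)))) _.
by rewrite div1r; ring.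
Qed.

Lemma power_cvg0 (q : R) : 0 < q -> expR (q * ln t) @[t --> 0^'+] --> (0 : R).
Proof.
move=> q0; apply/cvgrPdist_lt => e e0; near=> t.
have t0 : 0 < t by [].
rewrite sub0r normrN ger0_norm ?expR_ge0// -[ltRHS](@lnK _ e)// ltr_expR.
rewrite mulrC -ltr_pdivlMr// -ltr_expR lnK//.
by near: t; apply: nbhs_right_lt; exact: expR_gt0.
Unshelve. all: by end_near. Qed.

(** The primitive [t^(p + 1) / (p + 1)] tends to 0 at 0. Powers are written as exponentials of
    [ln t] to match [cexpt]. *)
Lemma power_integrable (a p : R) : 0 < a -> -1 < p ->
  rintegrable mu `]0, a] (fun t => expR (p * ln t)).
Proof.
move=> a0 p1; have q0 : 0 < p + 1 by lra.
pose F t : R := (p + 1)^-1 * expR ((p + 1) * ln t).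
have dF t : 0 < t <= a -> is_derive t 1 F (expR (p * ln t)).
  move=> /andP[t0 _]; apply: drv_eq (drv_scale _ _ _ _ (drv_power (p + 1) t t0)) _.
  have -> : (p + 1) * ln t = p * ln t + ln t by ring.
  rewrite expRD lnK ?posrE//.
  by field; rewrite !gt_eqF.
have cf t : 0 < t <= a -> {for t, continuous (fun t => expR (p * ln t))}.
  by move=> /andP[t0 _]; exact: drv_cont (drv_power p t t0).
have F0 : F t @[t --> 0^'+] --> (0 : R).
  by rewrite -[X in _ --> X](mulr0 (p + 1)^-1); apply: cvgM; [exact: cvg_cst|exact: power_cvg0].
have := FTC_at0_ge0 F _ a 0 a0 dF cf (fun t _ => expR_ge0 _) F0 => H.
apply/integrableP; split.
  by apply/measurable_EFinP; exact: cont_measurable_oc.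
by under eq_integral do rewrite /= ger0_norm ?expR_ge0//; rewrite H ltry.
Qed.
End powers.

(** * Functions with bounded derivatives in the second variable, up to the diagonal *)

Section tame.
Context {R : realType}.
Variable T : R.
Implicit Types (b c : R -> R -> R) (f : R -> R) (n : nat).

Definition strip : set (R * R) := [set p | 0 < p.2 < T].

Lemma measurable_strip : measurable strip.
Proof.
have -> : strip = [set: R] `*` `]0, T[.
  by apply/seteqP; split => -[s t] /=; rewrite in_itv/= => h //; case: h.
by apply: measurableX.
Qed.

Definition jmeas b := measurable_fun strip (fun p : R * R => b p.1 p.2).

(** Differentiation is in the second variable only, and the first enters through joint
    measurability. The bounds are uniform on the open strip, hence hold up to [t = 0], where the
    functions of interest are quotients by [t]. *)
Fixpoint tame n b : Prop :=
  [/\ jmeas b, exists C, forall s t, 0 < t < T -> `|b s t| <= C &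
   if n is m.+1 then exists b', (forall s t, 0 < t < T -> is_derive t 1 (b s) (b' s t)) /\ tame m b'
   else True].

Lemma jmeas_ext b c : (forall s t, 0 < t < T -> b s t = c s t) -> jmeas b -> jmeas c.
Proof. by move=> bc; apply: eq_measurable_fun => -[s t]; rewrite inE => /bc. Qed.

Lemma near_strip t : 0 < t < T -> \near t, 0 < t < T.
Proof.
move=> /andP[t0 tT]; near=> x; apply/andP; split; near: x.
  exact: lt_nbhsr.
exact: lt_nbhsl.
Unshelve. all: by end_near. Qed.

Lemma is_derive_ext b c s t d : (forall s t, 0 < t < T -> b s t = c s t) -> 0 < t < T ->
  is_derive t 1 (b s) d -> is_derive t 1 (c s) d.
Proof.
move=> bc ht; apply: near_eq_is_derive.
by near=> x; apply: bc; near: x; exact: near_strip.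
Unshelve. all: by end_near. Qed.

Lemma tame_ext n b c : (forall s t, 0 < t < T -> b s t = c s t) -> tame n b -> tame n c.
Proof.
move=> bc; case: n => [|n] [mb [C hC] hn]; (split; first exact: jmeas_ext mb).
- by exists C => s t ht; rewrite -bc//; exact: hC.
- by [].
- by exists C => s t ht; rewrite -bc//; exact: hC.
- case: hn => b' [db tb]; exists b'; split => // s t ht.
  by apply: is_derive_ext (db s t ht).
Qed.

Lemma tame_jmeas n b : tame n b -> jmeas b. Proof. by case: n => [|n] []. Qed.

Lemma tame_bounded n b : tame n b -> exists C, forall s t, 0 < t < T -> `|b s t| <= C.
Proof. by case: n => [|n] []. Qed.

Lemma tame_pred n b : tame n.+1 b -> tame n b.
Proof.
elim: n b => [|n IH] b [mb bb [b' [db tb]]]; split => //.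
by exists b'; split => //; exact: IH.
Qed.

Lemma tame0_of n b : tame n b -> tame 0 b.
Proof. by case: n => [|n] [mb bb _]. Qed.

(** A canonical choice for the derivative that is only asserted to exist in [tame]; it is meaningful
    on the strip. *)
Definition dtau b : R -> R -> R := fun s t => D1 (b s) t.

Lemma tame_dtau n b : tame n.+1 b ->
  (forall s t, 0 < t < T -> is_derive t 1 (b s) (dtau b s t)) /\ tame n (dtau b).
Proof.
move=> [_ _ [b' [db tb]]].
have E s t : 0 < t < T -> b' s t = dtau b s t.
  move=> ht; rewrite /dtau /D1 derive1E.
  by have [_ <-] := db s t ht.
split; first by move=> s t ht; rewrite -E//; exact: db.
by apply: tame_ext E tb.
Qed.

Lemma tame_cst n (c : R) : tame n (fun _ _ => c).
Proof.
elim: n c => [|n IH] c; (split; [exact: measurable_cst|by exists (`|c|)|]) => //.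
by exists (fun _ _ => 0); split => // s t _; exact: is_derive_cst.
Qed.

Lemma tameD n b c : tame n b -> tame n c -> tame n (fun s t => b s t + c s t).
Proof.
elim: n b c => [|n IH] b c.
  move=> [mb [C hC] _] [mc [C' hC'] _]; split => //; first exact: measurable_funD.
  exists (C + C') => s t ht; apply: le_trans (ler_normD _ _) _.
  by apply: lerD; [exact: hC|exact: hC'].
move=> [mb [C hC] [b' [db tb]]] [mc [C' hC'] [c' [dc tc]]]; split.
- exact: measurable_funD.
- exists (C + C') => s t ht; apply: le_trans (ler_normD _ _) _.
  by apply: lerD; [exact: hC|exact: hC'].
- exists (fun s t => b' s t + c' s t); split; last exact: IH.
  by move=> s t ht; have := db s t ht; have := dc s t ht => ? ?; exact: is_deriveD.
Qed.

Lemma tameM n b c : tame n b -> tame n c -> tame n (fun s t => b s t * c s t).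
Proof.
have bd (b' c' : R -> R -> R) C C' : (forall s t, 0 < t < T -> `|b' s t| <= C) ->
  (forall s t, 0 < t < T -> `|c' s t| <= C') ->
  exists K, forall s t, 0 < t < T -> `|b' s t * c' s t| <= K.
  move=> hC hC'; exists (C * C') => s t ht; rewrite normrM.
  by apply: ler_pM => //; [exact: hC|exact: hC'].
elim: n b c => [|n IH] b c.
  move=> [mb [C hC] _] [mc [C' hC'] _]; split => //; first exact: measurable_funM.
  exact: bd hC hC'.
move=> tb0 tc0; have := tb0; have := tc0.
move=> [mc [C' hC'] [c' [dc tc]]] [mb [C hC] [b' [db tb]]]; split.
- exact: measurable_funM.
- exact: bd hC hC'.
- exists (fun s t => b s t * c' s t + c s t * b' s t); split.
    by move=> s t ht; have ? := db s t ht; have ? := dc s t ht; exact: is_deriveM.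
  by apply: tameD; apply: IH => //; exact: tame_pred.
Qed.

Lemma tameZ n (k : R) b : tame n b -> tame n (fun s t => k * b s t).
Proof. by move=> tb; apply: tameM => //; exact: tame_cst. Qed.

Lemma tameN n b : tame n b -> tame n (fun s t => - b s t).
Proof.
move=> tb; apply: tame_ext (tameZ n (-1) _ tb) => s t _; by rewrite mulN1r.
Qed.

Lemma tameB n b c : tame n b -> tame n c -> tame n (fun s t => b s t - c s t).
Proof. by move=> tb tc; apply: tameD => //; exact: tameN. Qed.

Lemma tame_tau n : 0 < T -> tame n (fun _ t => t).
Proof.
move=> T0; have m : jmeas (fun _ t => t) by apply: measurable_funTS; exact: measurable_snd.
have bd : exists C, forall s t : R, 0 < t < T -> `|t| <= C.
  by exists T => s t /andP[t0 tT]; rewrite ger0_norm ltW.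
case: n => [|n]; split => //; exists (fun _ _ => 1); split; last exact: tame_cst.
by move=> s t _; exact: is_derive_id.
Qed.

(** The inverse of a positive function is [exp (- ln b)], a composition of measurable maps. *)
Lemma jmeas_inv b : (forall s t, 0 < t < T -> 0 < b s t) -> jmeas b ->
  jmeas (fun s t => (b s t)^-1).
Proof.
move=> b0 mb.
apply: (@jmeas_ext (fun s t => expR (- ln (b s t)))) => [s t ht|].
  by rewrite expRN lnK// posrE b0.
apply: measurableT_comp => //; apply: measurableT_comp => //.
by apply: measurableT_comp mb; exact: measurable_ln.
Qed.

Lemma tame_inv n b (c : R) : 0 < c -> (forall s t, 0 < t < T -> c <= b s t) -> tame n b ->
  tame n (fun s t => (b s t)^-1).
Proof.
move=> c0 hc; have b0 s t : 0 < t < T -> 0 < b s t by move=> ht; apply: lt_le_trans c0 (hc s t ht).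
have bd : exists C, forall s t, 0 < t < T -> `|(b s t)^-1| <= C.
  exists c^-1 => s t ht; rewrite ger0_norm ?invr_ge0; last exact/ltW/b0.
  by rewrite lef_pV2 ?posrE ?hc// b0.
elim: n => [|n IH] tb; have mb := tame_jmeas _ _ tb; (split; [exact: jmeas_inv|exact: bd|]) => //.
have [_ _ [b' [db tb']]] := tb.
exists (fun s t => - (b' s t * ((b s t)^-1 * (b s t)^-1))); split.
  move=> s t ht; have dbt := db s t ht.
  have bn0 : b s t != 0 by rewrite gt_eqF// b0.
  apply: drv_eq (drv_inv _ _ _ bn0 dbt) _.
  by rewrite expr2 invfM.
apply: tameN; apply: tameM => //; apply: tameM; apply: IH; exact: tame_pred.
Qed.

(** The mean value theorem on [[e, t]], followed by the limit [e] to 0. The factor [1 / (k + 1)] of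
    exact integration is given up. *)
Lemma growth_from0 (F f : R -> R) C k : 0 < T ->
  (forall t, 0 < t < T -> is_derive t 1 F (f t)) ->
  F t @[t --> 0^'+] --> 0 -> 0 <= C ->
  (forall t, 0 < t < T -> `|f t| <= C * t ^+ k) ->
  forall t, 0 < t < T -> `|F t| <= C * t ^+ k.+1.
Proof.
move=> T0 dF F0 C0 fC t /andP[t0 tT].
have step e : 0 < e < t -> `|F t - F e| <= C * t ^+ k.+1.
  move=> /andP[e0 et].
  have cF : {within `[e, t], continuous F}.
    apply: cont_on_within => x /andP[ex xt]; apply: differentiable_continuous.
    apply/derivable1_diffP; have [|//] := dF x _.
    by rewrite (lt_le_trans e0 ex) (le_lt_trans xt tT).
  have [x|x] := @MVT R F f e t et _ cF.
    rewrite in_itv/= => /andP[ex xt]; apply: dF.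
    by rewrite (lt_trans e0 ex) (lt_trans xt tT).
  rewrite in_itv/= => /andP[ex xt] ->; rewrite normrM exprSr mulrA.
  have x0 : 0 < x by exact: lt_trans ex.
  apply: ler_pM => //.
    have := fC x; rewrite x0 (lt_trans xt tT) => /(_ isT) h; apply: le_trans h _.
    by rewrite ler_wpM2l// lerXn2r// ?nnegrE (ltW x0, ltW xt, ltW t0).
  by rewrite ger0_norm ?subr_ge0 ?gerBl (ltW et, ltW e0).
have : `|F t - F e| @[e --> 0^'+] --> `|F t - 0|.
  by apply: cvg_norm; apply: cvgB => //; exact: cvg_cst.
rewrite subr0 => lm.
have -> : `|F t| = lim (`|F t - F e| @[e --> 0^'+]) by apply/esym/cvg_lim.
apply: limr_le; first by apply/cvg_ex; exists `|F t|.
by near=> e; apply: step; apply/andP; split.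
Unshelve. all: by end_near. Qed.

(** The equation [t Q' = N - (k + 1) Q] says that [Q] is [t^(- k - 1)] times an integral of [t^k N].
    Differentiating it gives [t Q'' = N' - (k + 2) Q'], the same equation for [Q'] with [k + 1] and
    [N']. So the induction only asks that [Q'] be bounded. *)
Lemma tame_div n k N Q : 0 < T -> tame n N -> jmeas Q ->
  (exists C, forall s t, 0 < t < T -> `|Q s t| <= C) ->
  (forall s t, 0 < t < T -> is_derive t 1 (Q s) ((N s t - k.+1%:R * Q s t) / t)) ->
  tame n Q.
Proof.
move=> T0; elim: n k N Q => [|n IH] k N Q tN mQ bQ dQ; split => //.
pose R' s t := (N s t - k.+1%:R * Q s t) / t.
exists R'; split; first exact: dQ.
have [dN tN'] := tame_dtau _ _ tN.
have tp s t : strip (s, t) -> t != 0 by move=> /andP[/= t0 _]; rewrite gt_eqF.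
have mN := tame_jmeas _ _ tN.
have mR : jmeas R'.
  apply: measurable_funM.
    apply: measurable_funB => //; apply: measurable_funM => //; exact: measurable_cst.
  apply: (@jmeas_inv (fun _ t => t)) => [s t /andP[]//|].
  by apply: measurable_funTS; exact: measurable_snd.
have dR s t : 0 < t < T -> is_derive t 1 (R' s) ((dtau N s t - k.+2%:R * R' s t) / t).
  move=> ht; have h1 := dN s t ht; have h2 := dQ s t ht.
  have t0 : t != 0 by exact: (tp s t).
  have h3 : is_derive t 1 (fun x : R => x^-1) (- (t ^- 2)).
    apply: drv_eq (drv_inv (fun x => x) _ _ t0 (drv_id t)) _.
    by rewrite div1r.
  have h4 : is_derive t 1 (fun x => N s x - k.+1%:R * Q s x) (dtau N s t - k.+1%:R * R' s t).
    by apply: drv_sub => //; exact: drv_scale.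
  apply: drv_eq (drv_mul _ _ _ _ _ h4 h3) _.
  by rewrite /R' -[k.+2]addn1 natrD; field.
have [C1 hC1] := tame_bounded _ _ tN'.
have [C2 hC2] := bQ.
have [C3 hC3] := tame_bounded _ _ tN.
apply: (IH k.+1 (dtau N) R' tN' mR _ dR).
exists `|C1| => s t ht.
have t0 : t != 0 by exact: (tp s t).
(* By the differentiated equation [F' = x^(k + 1) N'], while [F = x^(k + 1) (N - (k + 1) Q)] tends
   to 0; [growth_from0] then bounds [R']. *)
pose F x := x ^+ k.+2 * R' s x.
have dF x : 0 < x < T -> is_derive x 1 F (x ^+ k.+1 * dtau N s x).
  move=> hx; have h1 := dR s x hx; have x0 : x != 0 by exact: (tp s x).
  have h2 : is_derive x 1 (fun y : R => y ^+ k.+2) (k.+2%:R * x ^+ k.+1).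
    by apply: drv_eq (drv_pow (fun y => y) k.+2 x _ (drv_id x)) _; rewrite mulr1.
  apply: drv_eq (drv_mul _ _ _ _ _ h2 h1) _.
  by rewrite (exprS x k.+1); field.
have hF : `|F t| <= `|C1| * t ^+ k.+2.
  apply: (growth_from0 F _ `|C1| k.+1 T0 dF) => //; last first.
    move=> x hx; rewrite normrM mulrC normrX (ger0_norm (ltW (proj1 (andP hx)))).
    rewrite ler_wpM2r ?exprn_ge0 ?(ltW (proj1 (andP hx)))//.
    by apply: le_trans (ler_norm _); exact: hC1.
  pose K := `|C3| + k.+1%:R * `|C2|.
  have FE x : 0 < x < T -> `|F x| <= x ^+ k.+1 * K.
    move=> hx; have x0 : x != 0 by exact: (tp s x).
    have xp := ltW (proj1 (andP hx)).
    have -> : F x = x ^+ k.+1 * (N s x - k.+1%:R * Q s x).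
      by rewrite /F /R' exprS; field.
    rewrite normrM normrX (ger0_norm xp) ler_wpM2l ?exprn_ge0//.
    apply: le_trans (ler_normB _ _) _; apply: lerD.
      by apply: le_trans (ler_norm _); exact: hC3.
    rewrite normrM ger0_norm// ler_wpM2l//.
    by apply: le_trans (ler_norm _); exact: hC2.
  have lim0 : x ^+ k.+1 * K @[x --> 0^'+] --> 0.
    rewrite -[X in _ --> X](mul0r K) -[X in X * K](expr0n R k.+1) /=.
    apply: cvg_at_right_filter; apply: cvgM; last exact: cvg_cst.
    have := @exprn_continuous R k.+1 0; exact.
  apply/norm_cvg0P; apply: (squeeze_cvgr _ (cvg_cst 0) lim0).
  by near=> x; rewrite normr_ge0/=; apply: FE; apply/andP; split.
have tp0 := proj1 (andP ht).
have : `|R' s t| * t ^+ k.+2 <= `|C1| * t ^+ k.+2.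
  by move: hF; rewrite /F normrM mulrC normrX (ger0_norm (ltW tp0)).
by rewrite ler_pM2r// exprn_gt0.
Unshelve. all: by end_near. Qed.

End tame.

(** * Periodic smooth functions and their divided differences *)

Section periodic.
Context {R : realType}.
Variable L : R.
Hypothesis L0 : 0 < L.
Implicit Types (f : R -> R) (s t : R).

Definition periodic {A : Type} (f : R -> A) := forall s, f (s + L) = f s.

Lemma periodicMn {A : Type} (f : R -> A) n s : periodic f -> f (s + n%:R * L) = f s.
Proof.
move=> pf; elim: n => [|n IH]; first by rewrite mul0r addr0.
by rewrite -addn1 natrD mulrDl mul1r addrA pf.
Qed.

Lemma periodicMz {A : Type} (f : R -> A) (k : int) s : periodic f -> f (s + k%:~R * L) = f s.
Proof.
move=> pf; case: k => n; first exact: periodicMn.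
rewrite NegzE mulrNz mulNr.
by have := periodicMn f n.+1 (s - n.+1%:R * L) pf; rewrite subrK => ->.
Qed.

Lemma period_reduction s : exists k : int, 0 <= s + k%:~R * L < L.
Proof.
exists (- Num.floor (s / L)).
have /andP[h1 h2] := Num.Theory.floor_itv (s / L).
rewrite mulrNz mulNr subr_ge0 ltrBlDr -{3}(mul1r L) -mulrDl addrC.
by rewrite -ler_pdivlMr// h1/= -ltr_pdivrMr// -intrD1.
Qed.

Lemma periodic_bounded f : continuous f -> periodic f -> exists C, forall s, `|f s| <= C.
Proof.
move=> cf pf.
have cn : {within `[0, L], continuous (fun s => `|f s|)}.
  by apply: cont_on_within => x _; apply: cvg_norm; exact: cf.
have [c _ hc] := @EVT_max R (fun s => `|f s|) 0 L (ltW L0) cn.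
exists `|f c| => s; have [k /andP[k0 kL]] := period_reduction s.
by rewrite -(periodicMz f k s pf); apply: hc; rewrite in_itv/= k0 ltW.
Qed.

Lemma drv_shift f s t a : is_derive (s + t) 1 f a -> is_derive t 1 (fun t => f (s + t)) a.
Proof.
move=> h; apply: drv_eq (drv_comp f (fun t => s + t) t a 1 h _) _; last by rewrite mulr1.
by apply: drv_eq (drv_add _ _ _ _ _ (drv_cst s t) (drv_id t)) _; rewrite add0r.
Qed.

Lemma smooth_D1 f : smooth_fun f -> smooth_fun (D1 f).
Proof. by move=> sf n s; have := sf n.+1 s; rewrite iterSr. Qed.

Lemma smooth_drv f s : smooth_fun f -> is_derive s 1 f (D1 f s).
Proof. by move=> sf; apply: D1_drv; exact: (sf 0%N). Qed.

Lemma smooth_continuous f : smooth_fun f -> continuous f.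
Proof. by move=> sf s; apply: drv_cont (smooth_drv f s sf). Qed.

Lemma periodic_D1 f : smooth_fun f -> periodic f -> periodic (D1 f).
Proof.
move=> sf pf s; apply/esym; apply: drv_D1.
have := drv_shift f L s _ (smooth_drv f (L + s) sf).
rewrite [L + s]addrC; congr (is_derive s 1 _ _).
by apply/funext => t; rewrite addrC pf.
Qed.

Variable T : R.

Lemma jmeas_shift f : continuous f -> jmeas T (fun s t => f (s + t)).
Proof.
move=> cf; apply: measurable_funTS; apply: measurableT_comp.
  exact: continuous_measurable_fun.
by apply: measurable_funD; [exact: measurable_fst|exact: measurable_snd].
Qed.

Lemma jmeas_fst f : continuous f -> jmeas T (fun s t => f s).
Proof.
move=> cf; apply: measurable_funTS; apply: measurableT_comp; last exact: measurable_fst.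
exact: continuous_measurable_fun.
Qed.

Lemma tame_shift n f : smooth_fun f -> periodic f -> tame T n (fun s t => f (s + t)).
Proof.
elim: n f => [|n IH] f sf pf; have cf := smooth_continuous f sf;
  have [C hC] := periodic_bounded f cf pf; (split; [exact: jmeas_shift|by exists C => s t _|]) => //.
exists (fun s t => D1 f (s + t)); split.
  by move=> s t _; apply: drv_shift; exact: smooth_drv.
by apply: IH; [exact: smooth_D1|exact: periodic_D1].
Qed.

(** The divided difference of [f]; [quo2] and [quo3] are its first and second derivatives in [t],
    written so that each division by [t] is visible. *)
Definition quo1 f s t := (f (s + t) - f s) / t.
Definition quo2 f s t := (D1 f (s + t) - quo1 f s t) / t.
Definition quo3 f s t := (D1 (D1 f) (s + t) - 2 * quo2 f s t) / t.

Hypothesis T0 : 0 < T.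

Lemma pos_neq0 t : 0 < t < T -> t != 0. Proof. by move=> /andP[h _]; rewrite gt_eqF. Qed.

Lemma jmeas_div b : jmeas T b -> jmeas T (fun s t => b s t / t).
Proof.
move=> mb; apply: measurable_funM => //; apply: (@jmeas_inv _ _ (fun _ t => t)) => [s t /andP[]//|].
by apply: measurable_funTS; exact: measurable_snd.
Qed.

Lemma drv_over (f : R -> R) t a : 0 < t < T -> is_derive t 1 f a ->
  is_derive t 1 (fun t => f t / t) ((a - f t / t) / t).
Proof.
move=> /pos_neq0 t0 h; apply: drv_eq (drv_mul _ _ _ _ _ h (drv_inv (fun t => t) _ _ t0 (drv_id t))) _.
by field.
Qed.

Lemma drv_quo1 f s t : smooth_fun f -> 0 < t < T -> is_derive t 1 (quo1 f s) (quo2 f s t).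
Proof.
move=> sf ht; have h := drv_shift f s t _ (smooth_drv f (s + t) sf).
have := drv_over (fun t => f (s + t) - f s) t (D1 f (s + t)) ht.
by apply; apply: drv_eq (drv_sub _ _ _ _ _ h (drv_cst (f s) t)) _; rewrite subr0.
Qed.

Lemma drv_quo2 f s t : smooth_fun f -> 0 < t < T -> is_derive t 1 (quo2 f s) (quo3 f s t).
Proof.
move=> sf ht; have h := drv_shift (D1 f) s t _ (smooth_drv (D1 f) (s + t) (smooth_D1 f sf)).
have h2 := drv_sub _ _ _ _ _ h (drv_quo1 f s t sf ht).
apply: drv_eq (drv_over _ _ _ ht h2) _.
by rewrite /quo3 /quo2; congr (_ / _); ring.
Qed.

(** From [t quo1 = f (s + t) - f s] follows [t quo1' = f' (s + t) - quo1], the equation of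
    [tame_div] with [k = 0]. Boundedness is the mean value theorem. *)
Lemma tame_quo1 n f : smooth_fun f -> periodic f -> tame T n (quo1 f).
Proof.
move=> sf pf; apply: (@tame_div _ T n 0 (fun s t => D1 f (s + t)) (quo1 f)) => //.
- by apply: tame_shift; [exact: smooth_D1|exact: periodic_D1].
- apply: jmeas_div; apply: measurable_funB; [apply: jmeas_shift|apply: jmeas_fst];
    exact: smooth_continuous.
- have [C hC] := periodic_bounded (D1 f) (smooth_continuous _ (smooth_D1 f sf)) (periodic_D1 f sf pf).
  exists C => s t /andP[t0 tT].
  have sst : s <= s + t by rewrite lerDl ltW.
  have cf : {within `[s, (s + t)], continuous f}.
    by apply: cont_on_within => x _; exact: smooth_continuous.
  have [c _] := @MVT_segment R f (D1 f) s (s + t) sst (fun x _ => smooth_drv f x sf) cf.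
  rewrite /quo1 => ->; rewrite addrAC subrr add0r mulfK ?gt_eqF//.
- by move=> s t ht; rewrite mul1r; exact: drv_quo1.
Qed.

Lemma tame_quo2 n f : smooth_fun f -> periodic f -> tame T n (quo2 f).
Proof.
move=> sf pf; have [_ tq] := tame_dtau _ _ _ (tame_quo1 n.+1 f sf pf).
by apply: tame_ext tq => s t ht; apply: drv_D1; exact: drv_quo1.
Qed.

Lemma tame_quo3 n f : smooth_fun f -> periodic f -> tame T n (quo3 f).
Proof.
move=> sf pf; have [_ tq] := tame_dtau _ _ _ (tame_quo2 n.+1 f sf pf).
by apply: tame_ext tq => s t ht; apply: drv_D1; exact: drv_quo2.
Qed.

End periodic.

(** * The fourth power of the distance along a Legendrian knot *)

Section knot.
Context {R : realType}.
Variables (L : R) (g : R -> hpt R).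
Hypothesis knot : legendrian_knot L g.
Implicit Types s t : R.
Notation x := (cx g).
Notation y := (cy g).
Notation u := (cu g).
Notation x1 := (D1 (cx g)).
Notation y1 := (D1 (cy g)).
Notation x2 := (D1 (D1 (cx g))).
Notation y2 := (D1 (D1 (cy g))).

Lemma knot_length_gt0 : 0 < L. Proof. by case: knot. Qed.
Lemma knot_periodic : periodic L g. Proof. by case: knot => _ p _ _ _ s; exact: p. Qed.
Lemma periodic_x : periodic L x. Proof. by move=> s; rewrite /cx knot_periodic. Qed.
Lemma periodic_y : periodic L y. Proof. by move=> s; rewrite /cy knot_periodic. Qed.
Lemma periodic_u : periodic L u. Proof. by move=> s; rewrite /cu knot_periodic. Qed.
Lemma smooth_x : smooth_fun x. Proof. by case: knot => _ _ _ []. Qed.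
Lemma smooth_y : smooth_fun y. Proof. by case: knot => _ _ _ []. Qed.
Lemma smooth_u : smooth_fun u. Proof. by case: knot => _ _ _ []. Qed.
Lemma knot_contact s : D1 u s = 2^-1 * (x s * y1 s - y s * x1 s).
Proof. by case: knot => _ _ _ _ []. Qed.
Lemma knot_unit_speed s : x1 s ^+ 2 + y1 s ^+ 2 = 1.
Proof. by case: knot => _ _ _ _ []. Qed.

Local Notation L0 := knot_length_gt0.

Lemma drv_x s : is_derive s 1 x (x1 s). Proof. exact: smooth_drv smooth_x. Qed.
Lemma drv_y s : is_derive s 1 y (y1 s). Proof. exact: smooth_drv smooth_y. Qed.
Lemma drv_u s : is_derive s 1 u (D1 u s). Proof. exact: smooth_drv smooth_u. Qed.
Lemma drv_x1 s : is_derive s 1 x1 (x2 s). Proof. exact: smooth_drv (smooth_D1 _ smooth_x). Qed.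
Lemma drv_y1 s : is_derive s 1 y1 (y2 s). Proof. exact: smooth_drv (smooth_D1 _ smooth_y). Qed.

Lemma knot_acceleration s : x1 s * x2 s + y1 s * y2 s = 0.
Proof.
have h := drv_add _ _ _ _ _ (drv_pow _ 2 _ _ (drv_x1 s)) (drv_pow _ 2 _ _ (drv_y1 s)).
have h1 : is_derive s 1 (fun t => x1 t ^+ 2 + y1 t ^+ 2) 0.
  have -> : (fun t => x1 t ^+ 2 + y1 t ^+ 2) = (fun=> 1).
    by apply/funext => t; rewrite knot_unit_speed.
  exact: drv_cst.
have := drv_D1 _ _ _ h; rewrite (drv_D1 _ _ _ h1) /= !expr1.
have E (p q r v : R) : 0 = 2 * p * q + 2 * r * v -> p * q + r * v = 0 by lra.
exact: E.
Qed.

(** A length strictly between [L / 2] and [L]: opposite points are interior to the range of [t], and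
    the range stays away from [t = L], where the chord closes up. *)
Definition reach : R := 3 / 4 * L.
Notation T := reach.
Lemma reach_gt0 : 0 < T. Proof. by rewrite /reach; have := L0; lra. Qed.
Local Notation T0 := reach_gt0.

Lemma tame_x n : tame T n (fun s t => x1 (s + t)).
Proof. by apply: (tame_shift L L0); [exact: smooth_D1 smooth_x|exact: periodic_D1 smooth_x periodic_x]. Qed.
Lemma tame_y n : tame T n (fun s t => y1 (s + t)).
Proof. by apply: (tame_shift L L0); [exact: smooth_D1 smooth_y|exact: periodic_D1 smooth_y periodic_y]. Qed.

(* The [u]-coordinate of [(g s)^-1 * g (s + t)]. *)
Definition vert s t := u (s + t) - u s - 2^-1 * (x s * y (s + t) - y s * x (s + t)).
Definition vert2 s t := 2^-1 * (quo2 y s t * x1 (s + t) - quo2 x s t * y1 (s + t)).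
Definition vert3 s t := vert s t / t ^+ 3.

Lemma quo1E (f : R -> R) s t : 0 < t < T -> f (s + t) - f s = t * quo1 f s t.
Proof. by move=> /pos_neq0 t0; rewrite /quo1; field. Qed.
Lemma quo2E (f : R -> R) s t : 0 < t < T -> quo1 f s t = D1 f (s + t) - t * quo2 f s t.
Proof. by move=> /pos_neq0 t0; rewrite /quo2; field. Qed.
Lemma quo3E (f : R -> R) s t : 0 < t < T -> 2 * quo2 f s t = D1 (D1 f) (s + t) - t * quo3 f s t.
Proof. by move=> /pos_neq0 t0; rewrite /quo3; field. Qed.

(** The contact condition after left translation to [g s]: the vertical velocity is half the
    determinant of chord and tangent. *)
Lemma drv_vert0 s t : is_derive t 1 (vert s)
  (2^-1 * ((x (s + t) - x s) * y1 (s + t) - (y (s + t) - y s) * x1 (s + t))).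
Proof.
have hx := drv_shift x s t _ (drv_x (s + t)).
have hy := drv_shift y s t _ (drv_y (s + t)).
have hu := drv_shift u s t _ (drv_u (s + t)).
apply: drv_eq (drv_sub _ _ _ _ _ (drv_sub _ _ _ _ _ hu (drv_cst (u s) t))
  (drv_scale _ _ _ _ (drv_sub _ _ _ _ _ (drv_scale (x s) _ _ _ hy) (drv_scale (y s) _ _ _ hx)))) _.
by rewrite knot_contact; ring.
Qed.

(** The chord is [t] times the tangent at [s + t] minus [t^2] times [quo2]. The tangent part drops
    out of the determinant with the tangent, which leaves [t^2]. *)
Lemma drv_vert s t : 0 < t < T -> is_derive t 1 (vert s) (t ^+ 2 * vert2 s t).
Proof.
move=> ht; apply: drv_eq (drv_vert0 s t) _.
by rewrite !quo1E// !quo2E// /vert2; ring.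
Qed.

Lemma tame_vert2 n : tame T n vert2.
Proof.
apply: tameZ; apply: tameB; apply: tameM; try exact: tame_x; try exact: tame_y.
  exact: (tame_quo2 L L0 T T0 n _ smooth_y periodic_y).
exact: (tame_quo2 L L0 T T0 n _ smooth_x periodic_x).
Qed.

Lemma vert0 s : vert s 0 = 0.
Proof. by rewrite /vert addr0; ring. Qed.

Lemma vert_cvg0 s : vert s t @[t --> 0^'+] --> 0.
Proof.
have h : vert s t @[t --> (0 : R)] --> vert s 0 by exact: drv_cont (drv_vert0 s 0).
by rewrite vert0 in h; exact: cvg_at_right_filter.
Qed.

(** From [vert' = t^2 vert2] follows [t vert3' = vert2 - 3 vert3], the equation of [tame_div] with
    [k = 2]. *)
Lemma tame_vert3 n : tame T n vert3.
Proof.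
apply: (@tame_div _ T n 2 vert2 vert3 T0 (tame_vert2 n)).
- have mV : jmeas T vert.
    have mx := jmeas_shift T _ (smooth_continuous _ smooth_x).
    have my := jmeas_shift T _ (smooth_continuous _ smooth_y).
    have mu_ := jmeas_shift T _ (smooth_continuous _ smooth_u).
    have fx := jmeas_fst T _ (smooth_continuous _ smooth_x).
    have fy := jmeas_fst T _ (smooth_continuous _ smooth_y).
    have fu := jmeas_fst T _ (smooth_continuous _ smooth_u).
    apply: measurable_funB; first exact: measurable_funB.
    apply: measurable_funM; first exact: measurable_cst.
    by apply: measurable_funB; exact: measurable_funM.
  have := jmeas_div T _ (jmeas_div T _ (jmeas_div T _ mV)).
  by apply: jmeas_ext => s t /pos_neq0 t0; rewrite /vert3; field.
- have [C hC] := tame_bounded _ _ _ (tame_vert2 0).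
  exists `|C| => s t ht; have /andP[tp _] := ht.
  have h := growth_from0 T (vert s) (fun t => t ^+ 2 * vert2 s t) `|C| 2 T0 (drv_vert s) (vert_cvg0 s)
    (normr_ge0 C) _ t ht.
  rewrite /vert3 normrM normfV normrX (gtr0_norm tp) ler_pdivrMr ?exprn_gt0//.
  apply: h => r hr; have /andP[rp _] := hr.
  rewrite normrM normrX (gtr0_norm rp) mulrC ler_wpM2r ?exprn_ge0 ?(ltW rp)//.
  by apply: le_trans (ler_norm _); exact: hC.
- move=> s t ht; have t0 := pos_neq0 _ _ ht.
  have h3 := drv_pow (fun t => t) 3 t _ (drv_id t).
  have t30 : t ^+ 3 != 0 by rewrite expf_neq0.
  have h4 := drv_mul _ _ _ _ _ (drv_vert s t ht) (drv_inv (fun t => t ^+ 3) _ _ t30 h3).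
  have -> : vert3 s = (fun t => vert s t * (t ^+ 3)^-1) by [].
  apply: drv_eq h4 _.
  by rewrite /vert3 /=; field.
Qed.

(** [hor] is the squared horizontal chord over [t^2] and [gauge] the fourth power of the distance
    over [t^4]; [hor2] and [gauge2] are their differences from 1, over [t^2]. *)
Definition hor s t := quo1 x s t ^+ 2 + quo1 y s t ^+ 2.
Definition hor2 s t := x1 (s + t) * quo3 x s t + y1 (s + t) * quo3 y s t +
  (quo2 x s t ^+ 2 + quo2 y s t ^+ 2).
Definition gauge s t := hor s t ^+ 2 + 16 * t ^+ 2 * vert3 s t ^+ 2.
Definition gauge2 s t := 2 * hor2 s t + t ^+ 2 * hor2 s t ^+ 2 + 16 * vert3 s t ^+ 2.

(** Unit speed gives the leading 1. The term of order [t] pairs velocity with [2 quo2], which is the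
    acceleration up to [t quo3], and acceleration is orthogonal to velocity. *)
Lemma horE s t : 0 < t < T -> hor s t = 1 + t ^+ 2 * hor2 s t.
Proof.
move=> ht.
have -> : hor s t = (x1 (s + t) ^+ 2 + y1 (s + t) ^+ 2)
    - t * (x1 (s + t) * (2 * quo2 x s t) + y1 (s + t) * (2 * quo2 y s t))
    + t ^+ 2 * (quo2 x s t ^+ 2 + quo2 y s t ^+ 2).
  by rewrite /hor !quo2E//; ring.
rewrite knot_unit_speed !quo3E//.
have E (p q a b c d : R) : p * (a - t * c) + q * (b - t * d) = p * a + q * b - t * (p * c + q * d) by ring.
by rewrite E knot_acceleration /hor2; ring.
Qed.

Lemma gaugeE s t : 0 < t < T -> gauge s t = 1 + t ^+ 2 * gauge2 s t.
Proof. by move=> ht; rewrite /gauge horE// /gauge2; ring. Qed.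

Lemma tame_sqr n b : tame T n b -> tame T n (fun s t => b s t ^+ 2).
Proof. by move=> tb; apply: tame_ext (tameM _ _ _ _ tb tb) => s t _; rewrite expr2. Qed.

Lemma tame_hor2 n : tame T n hor2.
Proof.
apply: tameD; apply: tameD.
- by apply: tameM; [exact: tame_x|exact: (tame_quo3 L L0 T T0 n _ smooth_x periodic_x)].
- by apply: tameM; [exact: tame_y|exact: (tame_quo3 L L0 T T0 n _ smooth_y periodic_y)].
- by apply: tame_sqr; exact: (tame_quo2 L L0 T T0 n _ smooth_x periodic_x).
- by apply: tame_sqr; exact: (tame_quo2 L L0 T T0 n _ smooth_y periodic_y).
Qed.

Lemma tame_gauge2 n : tame T n gauge2.
Proof.
apply: tameD; last by apply: tameZ; apply: tame_sqr; exact: tame_vert3.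
apply: tameD; first by apply: tameZ; exact: tame_hor2.
apply: tameM; last by apply: tame_sqr; exact: tame_hor2.
by apply: (tame_sqr n (fun _ t => t)); exact: tame_tau T0.
Qed.

Lemma tame_gauge n : tame T n gauge.
Proof.
apply: (@tame_ext _ T n (fun s t => 1 + t ^+ 2 * gauge2 s t)); first by move=> s t ht; rewrite gaugeE.
apply: tameD; first exact: tame_cst.
apply: tameM; last exact: tame_gauge2.
by apply: (tame_sqr n (fun _ t => t)); exact: tame_tau T0.
Qed.

(* The fourth power of the Koranyi distance between [g s] and [g (s + t)]. *)
Definition dist4 s t := ((x (s + t) - x s) ^+ 2 + (y (s + t) - y s) ^+ 2) ^+ 2 + 16 * vert s t ^+ 2.

Lemma dist4E s t : 0 < t < T -> dist4 s t = t ^+ 4 * gauge s t.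
Proof.
move=> ht; have t0 := pos_neq0 _ _ ht.
rewrite /dist4 !quo1E// /gauge /hor /vert3; field; lra.
Qed.

Lemma dist4_ge0 s t : 0 <= dist4 s t.
Proof. by rewrite addr_ge0// ?sqr_ge0// mulr_ge0// sqr_ge0. Qed.

Lemma dH_dist4 s t : dH (g s) (g (s + t)) = powR (dist4 s t) (4^-1).
Proof.
rewrite /dH /koranyi_norm /dist4 /vert /cx /cy /cu /hmul /hinv /hx /hy /hu /=.
by congr powR; ring.
Qed.

(** Zero distance would force [g (s + t) = g s]. Injectivity is available on [[0, L[] only, so [s]
    is moved there by periods, and [L] is subtracted from [s + t] if it leaves that interval. *)
Lemma dist4_gt0 s t : 0 < t < L -> 0 < dist4 s t.
Proof.
move=> /andP[t0 tL]; rewrite lt_neqAle dist4_ge0 andbT eq_sym; apply/eqP => d0.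
have [dd vv] : (x (s + t) - x s) ^+ 2 + (y (s + t) - y s) ^+ 2 = 0 /\ vert s t = 0.
  have h1 : 0 <= 16 * vert s t ^+ 2 by rewrite mulr_ge0// sqr_ge0.
  move/eqP: d0; rewrite /dist4 paddr_eq0 ?sqr_ge0// => /andP[].
  by rewrite sqrf_eq0 mulf_eq0 sqrf_eq0 pnatr_eq0 /= => /eqP-> /eqP->.
have [ex ey] : x (s + t) = x s /\ y (s + t) = y s.
  move/eqP: dd; rewrite paddr_eq0 ?sqr_ge0// => /andP[].
  by rewrite !sqrf_eq0 !subr_eq0 => /eqP -> /eqP ->.
have eu : u (s + t) = u s by move: vv; rewrite /vert ex ey; lra.
have eg : g (s + t) = g s.
  move: ex ey eu; rewrite /cx /cy /cu /hx /hy /hu.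
  by case: (g (s + t)) => [[? ?] ?]; case: (g s) => [[? ?] ?] /= -> -> ->.
have [k /andP[k0 kL]] := period_reduction L L0 s.
have e1 := periodicMz L g k s knot_periodic.
have e2 := periodicMz L g k (s + t) knot_periodic.
have [_ _ inj _ _] := knot.
have [lt|ge] := ltP (s + k%:~R * L + t) L.
  have := inj (s + k%:~R * L + t) (s + k%:~R * L).
  rewrite k0 kL lt addr_ge0 ?(ltW t0)//= e1 addrAC e2 eg => /(_ isT isT erefl) E.
  by move: t0; rewrite -[t](addrK (s + k%:~R * L)) addrC; move: E; lra.
have g3 : g (s + k%:~R * L + t - L) = g (s + k%:~R * L).
  by rewrite -(knot_periodic (s + k%:~R * L + t - L)) subrK addrAC e2 eg e1.
have E : s + k%:~R * L + t - L = s + k%:~R * L.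
  by apply: inj => //; apply/andP; split => //; move: ge kL tL; lra.
by move: tL E; lra.
Qed.

End knot.

(** * The logarithm of the distance and its expansion at the diagonal *)

Section knot_log_distance.
Context {R : realType}.
Variables (L : R) (g : R -> hpt R).
Hypothesis knot : legendrian_knot L g.
Implicit Types s t : R.
Notation T := (reach L).
Local Notation L0 := (knot_length_gt0 L g knot).
Local Notation T0 := (reach_gt0 L g knot).
Local Notation gg := (gauge g).
Local Notation gg2 := (gauge2 g).
Local Notation d4 := (dist4 g).

Lemma reach_lt : T < L. Proof. by rewrite /reach; have := L0; lra. Qed.

Lemma continuous_add_snd (f : R -> R) : continuous f -> continuous (fun p : R * R => f (p.1 + p.2)).
Proof.
move=> cf p; apply: (@continuous_comp _ _ _ (fun p : R * R => p.1 + p.2) f); last exact: cf.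
by apply: cvgD; [exact: cvg_fst|exact: cvg_snd].
Qed.

Lemma continuous_fst_comp (f : R -> R) : continuous f -> continuous (fun p : R * R => f p.1).
Proof.
by move=> cf p; apply: (@continuous_comp _ _ _ fst f); [exact: cvg_fst|exact: cf].
Qed.

Lemma continuous_dist4 : continuous (fun p : R * R => d4 p.1 p.2).
Proof.
have cx1 := continuous_add_snd _ (smooth_continuous _ (smooth_x L g knot)).
have cx2 := continuous_fst_comp _ (smooth_continuous _ (smooth_x L g knot)).
have cy1 := continuous_add_snd _ (smooth_continuous _ (smooth_y L g knot)).
have cy2 := continuous_fst_comp _ (smooth_continuous _ (smooth_y L g knot)).
have cu1 := continuous_add_snd _ (smooth_continuous _ (smooth_u L g knot)).
have cu2 := continuous_fst_comp _ (smooth_continuous _ (smooth_u L g knot)).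
have sq (f : R * R -> R) p : {for p, continuous f} -> {for p, continuous (fun q => f q ^+ 2)}.
  move=> cf; have -> : (fun q => f q ^+ 2) = (fun q => f q * f q) by apply/funext => q; rewrite expr2.
  exact: cvgM.
move=> p; apply: cvgD.
  by apply: (sq (fun q : R * R => (cx g (q.1 + q.2) - cx g q.1) ^+ 2 + (cy g (q.1 + q.2) - cy g q.1) ^+ 2));
    apply: cvgD; apply: sq; apply: cvgB; [exact: cx1|exact: cx2|exact: cy1|exact: cy2].
apply: cvgM; first exact: cvg_cst.
apply: sq; apply: cvgB; first by apply: cvgB; [exact: cu1|exact: cu2].
apply: cvgM; first exact: cvg_cst.
by apply: cvgB; apply: cvgM; [exact: cx2|exact: cy1|exact: cy2|exact: cx1].
Qed.

Lemma dist4_periodic t : periodic L (d4^~ t).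
Proof.
move=> s; rewrite /dist4 /vert addrAC.
by rewrite !(periodic_x L g knot) !(periodic_y L g knot) !(periodic_u L g knot).
Qed.

(** For small [t] the expansion [gauge = 1 + t^2 gauge2] suffices. For the other [t], [dist4] is
    continuous and positive on a compact rectangle, so its inverse is bounded there. *)
Lemma gauge_lower : exists2 c, 0 < c & forall s t, 0 < t < T -> c <= gg s t.
Proof.
have [C hC] := tame_bounded _ _ _ (tame_gauge2 L g knot 0).
(* With [t <= 1] and [2 t (|C| + 1) <= 1], the deviation of [gauge] from below is at most
   [t^2 (|C| + 1) <= 1 / 2]. *)
pose d := Num.min T (Num.min 1 ((2 * (`|C| + 1))^-1)).
have C1 : 0 < `|C| + 1 by rewrite ltr_wpDl.
have d0 : 0 < d by rewrite !lt_min T0 ltr01 invr_gt0 mulr_gt0.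
have near0 s t : 0 < t < T -> t <= d -> 2^-1 <= gg s t.
  move=> ht td; rewrite (gaugeE L g knot)//; have /andP[t0 _] := ht.
  have t1 : t <= 1 by move: td; rewrite !le_min => /and3P[].
  have tC : t * (2 * (`|C| + 1)) <= 1.
    by rewrite -ler_pdivlMr ?mulr_gt0// div1r; move: td; rewrite !le_min => /and3P[].
  have := hC s t ht; rewrite ler_norml => /andP[h1 _].
  have lC : C <= `|C| by exact: ler_norm.
  have tt : t ^+ 2 <= t by rewrite expr2 ler_piMl// ltW.
  have : - (t ^+ 2 * (`|C| + 1)) <= t ^+ 2 * gg2 s t.
    by rewrite -mulrN ler_wpM2l ?sqr_ge0//; lra.
  have : t ^+ 2 * (`|C| + 1) <= t * (`|C| + 1) by rewrite ler_wpM2r// ltW.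
  by move: tC; clear; lra.
pose A : set (R * R) := `[0, L] `*` `[d, T].
have cA : compact A by apply: compact_setX; exact: segment_compact.
have dT : d <= T by rewrite ge_min lexx.
have pos p : A p -> 0 < d4 p.1 p.2.
  move=> [_ /=]; rewrite in_itv/= => /andP[h1 h2]; apply: (dist4_gt0 L g knot).
  by rewrite (lt_le_trans d0 h1) (le_lt_trans h2 reach_lt).
have cI : {within A, continuous (fun p : R * R => (d4 p.1 p.2)^-1)}.
  apply: continuous_in_subspaceT => p; rewrite inE => Ap.
  by apply: cvgV; [rewrite gt_eqF// pos|exact: continuous_dist4].
have /compact_bounded := continuous_compact cI cA.
move=> [M [_ /(_ (`|M| + 1))]].
rewrite (le_lt_trans (ler_norm M)) ?ltrDl// => /(_ isT) hM.
have K0 : 0 < (`|M| + 1) * T ^+ 4 by rewrite mulr_gt0 ?exprn_gt0 ?ltr_wpDl ?T0.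
exists (Num.min 2^-1 ((`|M| + 1) * T ^+ 4)^-1); first by rewrite lt_min !invr_gt0 K0 ltr0n.
move=> s t ht; rewrite ge_min; have [td|dt] := leP t d; first by rewrite near0.
apply/orP; right.
(* Periodicity in [s] brings an arbitrary [s] into the compact rectangle. *)
have [k /andP[k0 kL]] := period_reduction L L0 s.
have /andP[t0 tT] := ht.
have As : A (s + k%:~R * L, t) by split => /=; rewrite in_itv/= ?k0 ltW// ltW.
have := hM _ (ex_intro2 _ _ _ As erefl); rewrite /= (periodicMz L (d4^~ t) k s (dist4_periodic t)).
have dp : 0 < d4 s t by apply: (dist4_gt0 L g knot); rewrite t0 (lt_trans tT reach_lt).
rewrite ger0_norm ?invr_ge0 ?(ltW dp)// => hd.
have gp : 0 < gg s t.
  by have := dp; rewrite (dist4E L g s t ht) pmulr_rgt0// exprn_gt0.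
rewrite -[leRHS]invrK lef_pV2 ?posrE ?invr_gt0//.
have -> : (gg s t)^-1 = (d4 s t)^-1 * t ^+ 4.
  by rewrite (dist4E L g s t ht); field; rewrite !gt_eqF.
rewrite ler_pM// ?invr_ge0 ?(ltW dp) ?exprn_ge0 ?(ltW t0)//.
by apply: lerXn2r; rewrite ?nnegrE ?(ltW t0) ?(ltW T0) ?(ltW tT).
Qed.

Lemma gauge_gt0 s t : 0 < t < T -> 0 < gg s t.
Proof. by have [c c0 hc] := gauge_lower; move=> /(hc s); exact: lt_le_trans. Qed.

(** The logarithm of the distance from [g s] to [g (s + t)], since [dist4] is its fourth power. *)
Definition ell s t : R := ln (d4 s t) / 4.

Lemma ellE s t : 0 < t < T -> ell s t = ln t + ln (gg s t) / 4.
Proof.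
move=> ht; have /andP[t0 _] := ht.
rewrite /ell (dist4E L g)// lnM ?posrE ?exprn_gt0 ?gauge_gt0//.
by rewrite lnXn//; field.
Qed.

(* [t * corr s t] is the derivative of [ell s t - ln t]. *)
Definition corr s t : R := (2 * gg2 s t + t * dtau gg2 s t) / (4 * gg s t).

Lemma drv_gauge2 s t : 0 < t < T -> is_derive t 1 (gg2 s) (dtau gg2 s t).
Proof. by have [+ _] := tame_dtau _ _ _ (tame_gauge2 L g knot 1); apply. Qed.

Lemma drv_gauge s t : 0 < t < T -> is_derive t 1 (gg s) (4 * t * gg s t * corr s t).
Proof.
move=> ht; have h := drv_gauge2 s t ht.
apply: (@is_derive_ext _ T (fun s t => 1 + t ^+ 2 * gg2 s t)) => //.
  by move=> ? ? ?; rewrite (gaugeE L g knot).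
have h1 := drv_mul _ _ _ _ _ (drv_pow _ 2 _ _ (drv_id t)) h.
apply: drv_eq (drv_add _ _ _ _ _ (drv_cst 1 t) h1) _.
rewrite /corr /=; field; rewrite gt_eqF ?gauge_gt0//.
Qed.

Lemma drv_ell s t : 0 < t < T -> is_derive t 1 (ell s) ((1 + t ^+ 2 * corr s t) / t).
Proof.
move=> ht; have /andP[t0 _] := ht; have g0 := gauge_gt0 s t ht.
apply: (@is_derive_ext _ T (fun s t => ln t + 4^-1 * ln (gg s t))) => //.
  by move=> ? ? ?; rewrite ellE// mulrC.
have h1 := drv_ln _ _ _ t0 (drv_id t).
have h2 := drv_scale 4^-1 _ _ _ (drv_ln _ _ _ g0 (drv_gauge s t ht)).
apply: drv_eq (drv_add _ _ _ _ _ h1 h2) _.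
by field; rewrite !gt_eqF.
Qed.

Lemma tame_corr n : tame T n corr.
Proof.
have [c c0 hc] := gauge_lower.
apply: tameM.
  apply: tameD; first by apply: tameZ; exact: (tame_gauge2 L g knot).
  apply: tameM; first exact: tame_tau T0.
  by have [_] := tame_dtau _ _ _ (tame_gauge2 L g knot n.+1).
apply: (@tame_inv _ T n _ (4 * c)); first by rewrite mulr_gt0.
  by move=> s t ht; rewrite ler_pM2l// hc.
by apply: tameZ; exact: (tame_gauge L g knot).
Qed.

(** It makes the real powers of the distance comparable to those of [t], uniformly in [s]. *)
Lemma ell_bound : exists B, forall s t, 0 < t < T -> `|ell s t - ln t| <= B.
Proof.
have [c c0 hc] := gauge_lower.
have [C hC] := tame_bounded _ _ _ (tame_gauge L g knot 0).
exists (`|ln c| + `|ln (`|C| + 1)|) => s t ht; have g0 := gauge_gt0 s t ht.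
have C1 : 0 < `|C| + 1 by rewrite ltr_wpDl.
rewrite ellE// addrAC subrr add0r normrM [X in _ * X]ger0_norm ?invr_ge0//.
have h1 : ln c <= ln (gg s t) by rewrite ler_ln ?posrE ?hc.
have h2 : ln (gg s t) <= ln (`|C| + 1).
  rewrite ler_ln ?posrE//; have := hC s t ht; rewrite (gtr0_norm g0) => h.
  by apply: le_trans h _; have := ler_norm C; lra.
have h3 : `|ln (gg s t)| <= `|ln c| + `|ln (`|C| + 1)|.
  have := ler_norm (ln (`|C| + 1)); have := ler_norm (- ln c); rewrite normrN => h4 h5.
  have := normr_ge0 (ln c); have := normr_ge0 (ln (`|C| + 1)).
  by rewrite ler_norml; move: h1 h2 h4 h5; clear; lra.
by apply: le_trans h3; rewrite ler_piMr// invf_le1//; lra.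
Qed.

Lemma jmeas_ell : jmeas T ell.
Proof.
apply: measurable_funM; last exact: measurable_cst.
have mg : jmeas T d4.
  apply: (@jmeas_ext _ T (fun s t => t ^+ 4 * gg s t)) => [s t ht|]; first by rewrite (dist4E L g).
  apply: measurable_funM; last exact: tame_jmeas (tame_gauge L g knot 0).
  apply: measurable_funX; apply: measurable_funTS; exact: measurable_snd.
by apply: measurableT_comp mg; exact: measurable_ln.
Qed.

End knot_log_distance.

(** * Integrals of powers of the distance, and integration by parts *)

Section mellin_integrals.
Context {R : realType}.
Variables (L : R) (g : R -> hpt R).
Hypothesis knot : legendrian_knot L g.
Implicit Types (s t : R) (b : R -> R -> R) (z : R[i]) (m n k : nat).
Notation mu := (@lebesgue_measure R).
Notation T := (reach L).
Local Notation L0 := (knot_length_gt0 L g knot).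
Local Notation ell := (ell g).
Local Notation corr := (corr g).

Definition half : R := L / 2.
Local Notation a := half.
Lemma half_gt0 : 0 < a. Proof. by rewrite divr_gt0// L0. Qed.
Lemma half_strip t : 0 < t <= a -> 0 < t < T.
Proof.
by move=> /andP[-> h]; apply: le_lt_trans h _; rewrite /half /reach; have := L0; lra.
Qed.
Lemma half_in : 0 < a < T. Proof. by apply: half_strip; rewrite half_gt0 lexx. Qed.

Definition box : set (R * R) := `[0, L] `*` `]0, a].
Lemma measurable_box : measurable box. Proof. exact: measurableX. Qed.
Lemma box_strip p : box p -> strip T p.
Proof. by move=> [_]; rewrite /= in_itv/=; exact: half_strip. Qed.

(** The exponent [m] records the vanishing at the diagonal: the integral of [t^m b d^z] converges
    for [-1 - m < Re z], where [d] is the distance. *)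
Definition dens m b s t : R := t ^+ m * b s t.
Definition kernel m b z s t : R[i] := Complex (dens m b s t) 0 * cexpt z (ell s t).
Definition mellin m b z : R[i] := cint mu2 box (fun p => kernel m b z p.1 p.2).
(** The exponent is [m + 1] because this is the boundary term at [t = a] left by integrating
    [mellin m b] by parts. *)
Definition bdry m b z : R[i] := cint mu `[0, L] (fun s => kernel m.+1 b z s a).

Lemma jmeas_dens m b : jmeas T b -> jmeas T (dens m b).
Proof.
move=> mb; apply: measurable_funM => //; apply: measurable_funX.
by apply: measurable_funTS; exact: measurable_snd.
Qed.

Lemma box_measurable b : jmeas T b -> measurable_fun box (fun p => b p.1 p.2).
Proof.
move=> mb; apply: measurable_funS mb => //; first exact: measurable_strip.
by move=> p /box_strip.
Qed.

Lemma slice_measurable b t (D : set R) : 0 < t < T -> jmeas T b -> measurable D ->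
  measurable_fun D (fun s => b s t).
Proof.
move=> ht mb mD; apply: (@measurable_comp _ _ _ _ _ _ (strip T) (fun p => b p.1 p.2) D (fun s => (s, t))) => //.
- exact: measurable_strip.
- by move=> _ [s _ <-].
- by apply: measurable_funTS; exact: measurable_pair2.
Qed.

Lemma dens_bound m b x : tame T 0 b -> exists2 K, 0 <= K & forall s t, 0 < t < T ->
  `|dens m b s t| * expR (x * ell s t) <= K * expR ((x + m%:R) * ln t).
Proof.
move=> [_ [C hC] _]; have [B hB] := ell_bound L g knot.
exists (`|C| * expR (`|x| * B)); first by rewrite mulr_ge0// expR_ge0.
move=> s t ht; have /andP[t0 _] := ht.
have -> : `|dens m b s t| = `|b s t| * t ^+ m.
  by rewrite /dens normrM normrX (gtr0_norm t0) mulrC.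
have -> : t ^+ m = expR (m%:R * ln t).
  by rewrite expRM_natl lnK// posrE.
have -> : expR ((x + m%:R) * ln t) = expR (x * ln t) * expR (m%:R * ln t).
  by rewrite -expRD mulrDl.
have h1 : expR (x * ell s t) <= expR (`|x| * B) * expR (x * ln t).
  rewrite -expRD ler_expR -lerBlDr -mulrBr; apply: le_trans (ler_norm _) _.
  by rewrite normrM ler_wpM2l// hB.
have h2 : `|b s t| <= `|C| by apply: le_trans (hC s t ht) (ler_norm _).
have -> : `|C| * expR (`|x| * B) * (expR (x * ln t) * expR (m%:R * ln t)) =
  `|C| * expR (m%:R * ln t) * (expR (`|x| * B) * expR (x * ln t)) by ring.
by rewrite ler_pM ?expR_ge0 ?mulr_ge0 ?expR_ge0// ler_wpM2r ?expR_ge0.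
Qed.

Lemma dens_integrable m b x : tame T 0 b -> -1 - m%:R < x ->
  rintegrable mu2 box (fun p => `|dens m b p.1 p.2| * expR (x * ell p.1 p.2)).
Proof.
move=> tb hx; have [K K0 hK] := dens_bound m b x tb.
apply: (@rect_integrable R 0 L `]0, a] _ (fun t => K * expR ((x + m%:R) * ln t))) => //.
- apply: (@box_measurable (fun s t => `|dens m b s t| * expR (x * ell s t))).
  apply: measurable_funM.
    by apply: measurableT_comp => //; exact: jmeas_dens (tame_jmeas _ _ _ tb).
  apply: measurableT_comp => //; apply: measurable_funM; first exact: measurable_cst.
  exact: jmeas_ell L g knot.
- apply: rintegrableZ => //; apply: power_integrable; first exact: half_gt0.
  by move: hx; lra.
- move=> s t _; rewrite /= in_itv/= => /half_strip ht.
  by rewrite ger0_norm ?mulr_ge0 ?expR_ge0//; exact: hK.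
Qed.

Lemma kernel_integrable m b z : tame T 0 b -> -1 - m%:R < cre z ->
  cintegrable mu2 box (fun p => kernel m b z p.1 p.2).
Proof.
move=> tb hz.
apply: (@cexpt_integrable _ _ _ mu2 box (fun p => dens m b p.1 p.2) (fun p => ell p.1 p.2)).
- exact: measurable_box.
- apply: (@box_measurable (dens m b)); apply: jmeas_dens; exact: tame_jmeas tb.
- exact: (box_measurable _ (jmeas_ell L g knot)).
- exact: dens_integrable.
Qed.

Lemma mellin_differentiable m b z : tame T 0 b -> -1 - m%:R < cre z ->
  cdifferentiable (mellin m b) z.
Proof.
move=> tb hz; pose r := (cre z + 1 + m%:R) / 2.
have r0 : 0 < r by rewrite /r; move: hz; lra.
apply: (@cexpt_int_differentiable _ _ _ mu2 box (fun p => dens m b p.1 p.2) (fun p => ell p.1 p.2) z r) => //.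
- exact: measurable_box.
- apply: (@box_measurable (dens m b)); apply: jmeas_dens; exact: tame_jmeas tb.
- exact: (box_measurable _ (jmeas_ell L g knot)).
- move=> x hx; apply: dens_integrable => //.
  by move: hx; rewrite ler_norml /r; move: hz; lra.
Qed.

Lemma bdry_integrable m b x : tame T 0 b ->
  rintegrable mu `[0, L] (fun s => `|dens m.+1 b s a| * expR (x * ell s a)).
Proof.
move=> tb; have [K K0 hK] := dens_bound m.+1 b x tb.
have mI : measurable (`[0, L]%classic : set R) by [].
apply: (@rintegrable_le _ _ _ mu _ _ (fun=> K * expR ((x + m.+1%:R) * ln a))) => //.
- apply: measurable_funM.
    apply: measurableT_comp => //; apply: slice_measurable => //; first exact: half_in.
    exact: jmeas_dens (tame_jmeas _ _ _ tb).
  apply: measurableT_comp => //; apply: measurable_funM; first exact: measurable_cst.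
  by apply: slice_measurable => //; [exact: half_in|exact: jmeas_ell L g knot].
- move=> s _; rewrite ger0_norm ?mulr_ge0 ?expR_ge0//; exact: hK half_in.
- by apply: cont_on_integrable => s _; exact: cvg_cst.
Qed.

Lemma bdry_differentiable m b z : tame T 0 b -> cdifferentiable (bdry m b) z.
Proof.
move=> tb.
apply: (@cexpt_int_differentiable _ _ _ mu `[0, L] (fun s => dens m.+1 b s a) (fun s => ell s a) z 1) => //.
- apply: slice_measurable => //; first exact: half_in.
  exact: jmeas_dens (tame_jmeas _ _ _ tb).
- by apply: slice_measurable => //; [exact: half_in|exact: jmeas_ell L g knot].
- by move=> x _; exact: bdry_integrable.
Qed.

(** Real and imaginary parts under one name, so that real calculus is applied once for both. *)
Definition cproj (i : bool) z : R := if i then cre z else cim z.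

Lemma cproj_le i z : `|cproj i z| <= cnorm z.
Proof. by case: i; [exact: cre_le_cnorm|exact: cim_le_cnorm]. Qed.

Lemma drv_kernel (phi : R -> R) dphi s t z i : 0 < t < T -> is_derive t 1 phi dphi ->
  is_derive t 1 (fun t => cproj i (Complex (phi t) 0 * cexpt z (ell s t)))
   (cproj i ((Complex dphi 0 + z * Complex (phi t * ((1 + t ^+ 2 * corr s t) / t)) 0) * cexpt z (ell s t))).
Proof.
move=> ht hphi; have he := drv_ell L g knot s t ht.
have hx := drv_exp _ _ _ (drv_scale (cre z) _ _ _ he).
have hc := drv_comp cos _ _ _ _ (is_derive_cos _) (drv_scale (cim z) _ _ _ he).
have hs := drv_comp sin _ _ _ _ (is_derive_sin _) (drv_scale (cim z) _ _ _ he).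
case: i; rewrite /cproj.
  have -> : (fun t => cre (Complex (phi t) 0 * cexpt z (ell s t))) =
    (fun t => phi t * (expR (cre z * ell s t) * cos (cim z * ell s t))).
    by apply/funext => r; rewrite creM /=; ring.
  apply: drv_eq (drv_mul _ _ _ _ _ hphi (drv_mul _ _ _ _ _ hx hc)) _.
  by rewrite !compE /=; ring.
have -> : (fun t => cim (Complex (phi t) 0 * cexpt z (ell s t))) =
    (fun t => phi t * (expR (cre z * ell s t) * sin (cim z * ell s t))).
  by apply/funext => r; rewrite cimM /=; ring.
apply: drv_eq (drv_mul _ _ _ _ _ hphi (drv_mul _ _ _ _ _ hx hs)) _.
by rewrite !compE /=; ring.
Qed.

(** As [ell' = 1 / t + t corr], differentiating [d^z] in [t^(m + 1) b d^z] yields [z t^m b d^z] from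
    the first part; the second part gives [z t^(m + 1) (next b) d^z]. *)
Definition next b s t : R := t * corr s t * b s t.

Lemma tame_next n b : tame T n b -> tame T n (next b).
Proof.
move=> tb; apply: tameM => //; apply: tameM; last exact: tame_corr knot n.
by apply: tame_tau; exact: reach_gt0 knot.
Qed.

Lemma drv_dens m b s t d : is_derive t 1 (b s) d ->
  is_derive t 1 (dens m.+1 b s) (m.+1%:R * t ^+ m * b s t + t ^+ m.+1 * d).
Proof.
move=> hb; apply: drv_eq (drv_mul _ _ _ _ _ (drv_pow _ m.+1 _ _ (drv_id t)) hb) _.
by rewrite mulr1.
Qed.

Lemma dens_derivable m b s t d : is_derive t 1 (b s) d -> exists d', is_derive t 1 (dens m b s) d'.
Proof.
move=> hb; exists (m%:R * t ^+ m.-1 * 1 * b s t + t ^+ m * d).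
exact: (drv_mul _ _ _ _ _ (drv_pow _ m _ _ (drv_id t)) hb).
Qed.

Lemma kernel_continuous m b z s t i : tame T 1 b -> 0 < t < T ->
  {for t, continuous (fun t => cproj i (kernel m b z s t))}.
Proof.
move=> tb ht; have [db _] := tame_dtau _ _ _ tb.
have [d hd] := dens_derivable m b s t _ (db s t ht).
exact: drv_cont (drv_kernel _ _ s t z i ht hd).
Qed.

Lemma kernel_cnorm m b z s t : cnorm (kernel m b z s t) = `|dens m b s t| * expR (cre z * ell s t).
Proof. exact: cnorm_bcexpt. Qed.

(** The derivative of [kernel m.+1 b] in [t], sorted into kernels: [m + 1] comes from the power of
    [t], [z] from the power of the distance. *)
Definition total m b z s t : R[i] := (z + Complex m.+1%:R 0) * kernel m b z s t +
  (kernel m.+1 (dtau b) z s t + z * kernel m.+1 (next b) z s t).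

Lemma drv_total m b z s t i : tame T 1 b -> 0 < t < T ->
  is_derive t 1 (fun t => cproj i (kernel m.+1 b z s t)) (cproj i (total m b z s t)).
Proof.
move=> tb ht; have [db _] := tame_dtau _ _ _ tb.
have t0 := pos_neq0 T t ht.
apply: drv_eq (drv_kernel _ _ s t z i ht (drv_dens m b s t _ (db s t ht))) _.
congr (cproj i _); rewrite /total /kernel /dens /next.
have -> : t ^+ m.+1 * b s t * ((1 + t ^+ 2 * corr s t) / t) =
  t ^+ m * b s t + t ^+ m.+1 * (t * corr s t * b s t) by rewrite exprS; field.
set e := cexpt z _; set cc := _ * (_ * _ * _).
rewrite !mulrA -!mulrDl; congr (_ * _).
by apply: complex_eq; rewrite !compE /=; ring.
Qed.

Lemma total_cproj_cont m b z s t i : tame T 2 b -> 0 < t < T ->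
  {for t, continuous (fun t => cproj i (total m b z s t))}.
Proof.
move=> tb ht.
have tb1 := tame_pred _ _ _ tb.
have [_ tb'] := tame_dtau _ _ _ tb.
have tn := tame_next 1 b tb1.
have k1 j := kernel_continuous m b z s t j tb1 ht.
have k2 j := kernel_continuous m.+1 (dtau b) z s t j tb' ht.
have k3 j := kernel_continuous m.+1 (next b) z s t j tn ht.
have mc (w : R[i]) (f : R -> R[i]) : (forall j, {for t, continuous (fun t => cproj j (f t))}) ->
   forall j, {for t, continuous (fun t => cproj j (w * f t))}.
  move=> hf [] /=.
    have -> : (fun t => cre (w * f t)) = (fun t => cre w * cre (f t) - cim w * cim (f t)).
      by apply/funext => r; rewrite creM.
    by apply: cvgB; apply: cvgM; [exact: cvg_cst|exact: (hf true)|exact: cvg_cst|exact: (hf false)].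
  have -> : (fun t => cim (w * f t)) = (fun t => cre w * cim (f t) + cim w * cre (f t)).
    by apply/funext => r; rewrite cimM.
  by apply: cvgD; apply: cvgM; [exact: cvg_cst|exact: (hf false)|exact: cvg_cst|exact: (hf true)].
have ac (f h : R -> R[i]) : (forall j, {for t, continuous (fun t => cproj j (f t))}) ->
  (forall j, {for t, continuous (fun t => cproj j (h t))}) ->
   forall j, {for t, continuous (fun t => cproj j (f t + h t))}.
  move=> hf hh [] /=.
    have -> : (fun t => cre (f t + h t)) = (fun t => cre (f t) + cre (h t)).
      by apply/funext => r; rewrite creD.
    by apply: cvgD; [exact: (hf true)|exact: (hh true)].
  have -> : (fun t => cim (f t + h t)) = (fun t => cim (f t) + cim (h t)).
    by apply/funext => r; rewrite cimD.
  by apply: cvgD; [exact: (hf false)|exact: (hh false)].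
by apply: (ac _ _ (mc _ _ k1)); apply: (ac _ _ k2); exact: (mc _ _ k3).
Qed.

Lemma total_integrable m b z : tame T 1 b -> -1 - m%:R < cre z ->
  cintegrable mu2 box (fun p => total m b z p.1 p.2) /\
  cint mu2 box (fun p => total m b z p.1 p.2) =
   (z + Complex m.+1%:R 0) * mellin m b z +
    (mellin m.+1 (dtau b) z + z * mellin m.+1 (next b) z).
Proof.
move=> tb hz; have [_ tb'] := tame_dtau _ _ _ tb.
have hz1 : -1 - m.+1%:R < cre z by apply: lt_trans hz; rewrite ltrD2l ltrN2 ltr_nat.
have i1 := kernel_integrable m b z (tame0_of _ _ _ tb) hz.
have i2 := kernel_integrable m.+1 (dtau b) z tb' hz1.
have i3 := kernel_integrable m.+1 (next b) z (tame_next 0 b (tame0_of _ _ _ tb)) hz1.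
have mb := measurable_box.
have j1 := cintegrableM mu2 _ (z + Complex m.+1%:R 0) _ mb i1.
have j3 := cintegrableM mu2 _ z _ mb i3.
have j23 := cintegrableD mu2 _ _ _ mb i2 j3.
split; first exact: (cintegrableD mu2 _ _ _ mb j1 j23).
by rewrite (cintD mu2 _ _ _ mb j1 j23) (cintD mu2 _ _ _ mb i2 j3) !cintM.
Qed.

Lemma total_bound m b z : tame T 1 b -> exists K, forall s t, 0 < t <= a ->
  cnorm (total m b z s t) <= K * expR ((cre z + m%:R) * ln t).
Proof.
move=> tb; have [_ tb'] := tame_dtau _ _ _ tb.
have [K1 K10 h1] := dens_bound m b (cre z) (tame0_of _ _ _ tb).
have [K2 K20 h2] := dens_bound m.+1 (dtau b) (cre z) tb'.
have [K3 K30 h3] := dens_bound m.+1 (next b) (cre z) (tame_next 0 b (tame0_of _ _ _ tb)).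
exists (cnorm (z + Complex m.+1%:R 0) * K1 + (a * K2 + cnorm z * (a * K3))).
move=> s t ht; have hs := half_strip t ht; have /andP[t0 ta] := ht.
set e := expR _.
have e' : expR ((cre z + m.+1%:R) * ln t) <= a * e.
  have -> : (cre z + m.+1%:R) * ln t = ln t + (cre z + m%:R) * ln t by rewrite -addn1 natrD; ring.
  by rewrite expRD lnK ?posrE// ler_wpM2r ?expR_ge0.
have b1 : cnorm (kernel m b z s t) <= K1 * e by rewrite kernel_cnorm; exact: h1.
have b2 : cnorm (kernel m.+1 (dtau b) z s t) <= a * K2 * e.
  rewrite kernel_cnorm; apply: le_trans (h2 s t hs) _.
  by rewrite [a * K2]mulrC -mulrA ler_wpM2l.
have b3 : cnorm (kernel m.+1 (next b) z s t) <= a * K3 * e.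
  rewrite kernel_cnorm; apply: le_trans (h3 s t hs) _.
  by rewrite [a * K3]mulrC -mulrA ler_wpM2l.
rewrite /total; apply: le_trans (cnormD _ _) _.
rewrite [leRHS]mulrDl; apply: lerD; first by rewrite cnormM -mulrA ler_wpM2l ?cnorm_ge0.
apply: le_trans (cnormD _ _) _; rewrite [leRHS]mulrDl; apply: lerD => //.
by rewrite cnormM -mulrA ler_wpM2l ?cnorm_ge0.
Qed.

(** The primitive [kernel m.+1 b] is of order [t^(Re z + m + 1)] and vanishes at the diagonal, so
    only its value at [a] survives. *)
Lemma total_slice m b z s i : tame T 2 b -> -1 - m%:R < cre z ->
  rintegrable mu `]0, a] (fun t => cproj i (total m b z s t)) /\
  (\int[mu]_(t in `]0, a]) cproj i (total m b z s t))%R = cproj i (kernel m.+1 b z s a).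
Proof.
move=> tb hz; have tb1 := tame_pred _ _ _ tb.
have [K hK] := total_bound m b z tb1.
have hint : rintegrable mu `]0, a] (fun t => cproj i (total m b z s t)).
  apply: (@rintegrable_le _ _ _ mu _ _ (fun t => K * expR ((cre z + m%:R) * ln t))) => //.
  - apply: cont_measurable_oc => t /half_strip ht; exact: total_cproj_cont.
  - by move=> t; rewrite /= in_itv/= => ht; apply: le_trans (cproj_le i _) (hK s t ht).
  - apply: rintegrableZ => //; apply: power_integrable; first exact: half_gt0.
    by move: hz; lra.
split => //.
have [K1 _ h1] := dens_bound m.+1 b (cre z) (tame0_of _ _ _ tb).
have hd t : 0 < t <= a ->
    is_derive t 1 (fun t => cproj i (kernel m.+1 b z s t)) (cproj i (total m b z s t)).
  by move=> /half_strip ht; exact: drv_total.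
have hc t : 0 < t <= a -> {for t, continuous (fun t => cproj i (total m b z s t))}.
  by move=> /half_strip ht; exact: total_cproj_cont.
have hl : cproj i (kernel m.+1 b z s t) @[t --> 0^'+] --> (0 : R).
  have q0 : 0 < cre z + m.+1%:R by move: hz; rewrite -addn1 natrD; lra.
  have lim0 : K1 * expR ((cre z + m.+1%:R) * ln t) @[t --> 0^'+] --> (0 : R).
    by rewrite -[X in _ --> X](mulr0 K1); apply: cvgM; [exact: cvg_cst|exact: power_cvg0].
  apply/norm_cvg0P; apply: (squeeze_cvgr _ (cvg_cst 0) lim0).
  near=> t; rewrite normr_ge0/=; apply: le_trans (cproj_le i _) _.
  rewrite kernel_cnorm; apply: h1; apply: half_strip; apply/andP; split => //.
  by near: t; apply: nbhs_right_le; exact: half_gt0.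
by rewrite (FTC_at0 _ _ a 0 half_gt0 hd hc hl hint) subr0.
Unshelve. all: by end_near. Qed.

(** Integrate the slice identity over [s]. The two integrals on the right carry one more power of
    [t] and converge for [-2 - m < Re z]. *)
Theorem mellin_by_parts m b z : tame T 2 b -> -1 - m%:R < cre z ->
  (z + Complex m.+1%:R 0) * mellin m b z =
  bdry m b z - mellin m.+1 (dtau b) z - z * mellin m.+1 (next b) z.
Proof.
move=> tb hz; have [i12 E] := total_integrable m b z (tame_pred _ _ _ tb) hz.
suff H : cint mu2 box (fun p => total m b z p.1 p.2) = bdry m b z by rewrite -H E; ring.
have mI : measurable (`[0, L]%classic : set R) by [].
have mJ : measurable (`]0, a]%classic : set R) by [].
have fub i : (rintegrable mu2 box (fun p => cproj i (total m b z p.1 p.2))) ->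
  (\int[mu2]_(p in box) cproj i (total m b z p.1 p.2))%R =
  (\int[mu]_(s in `[0, L]) cproj i (kernel m.+1 b z s a))%R.
  move=> hi; rewrite (Rrect_fubini _ _ (fun s t => cproj i (total m b z s t)) mI mJ hi).
    by apply: eq_Rintegral => s _; have [_] := total_slice m b z s i tb hz.
  by move=> s _; have [] := total_slice m b z s i tb hz.
have [i1 i2] := i12.
by rewrite /cint /bdry /cint; congr Complex; [exact: (fub true)|exact: (fub false)].
Qed.

End mellin_integrals.

(** * Continuation to the left and uniqueness of its value at -2 *)

Section continuation.
Context {R : realType}.
Variables (L : R) (g : R -> hpt R).
Hypothesis knot : legendrian_knot L g.
Implicit Types (b : R -> R -> R) (z w : R[i]) (m n k : nat) (U : set R[i]) (F : R[i] -> R[i]).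
Notation T := (reach L).
Local Notation mellin := (mellin L g).
Local Notation bdry := (bdry L g).
Local Notation next := (next g).
Local Notation corr := (corr g).

(** Its zeros [- m - 1, ..., - m - n] are the only places where [n] integrations by parts can create
    poles. *)
Definition poles n m z : R[i] := \prod_(j < n) (z + Complex (m + j.+1)%:R 0).

Lemma polesS n m z : poles n.+1 m z = poles n m z * (z + Complex (m + n.+1)%:R 0).
Proof. by rewrite /poles big_ord_recr. Qed.

Lemma poles_differentiable n m z : cdifferentiable (poles n m) z.
Proof.
elim: n => [|n IH].
  have -> : poles 0 m = fun=> 1 by apply/funext => w; rewrite /poles big_ord0.
  exact: cdiff_cst.
have -> : poles n.+1 m = fun w => poles n m w * (w + Complex (m + n.+1)%:R 0).
  by apply/funext => w; rewrite polesS.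
by apply: cdiffM => //; apply: cdiffD; [exact: cdiff_id|exact: cdiff_cst].
Qed.

(* The continuation of [poles n m * mellin m b], from [-1 - m < Re z] to [-1 - m - n < Re z]. *)
Fixpoint cont n m b z : R[i] :=
  if n is k.+1 then
    poles k m.+1 z * bdry m b z - cont k m.+1 (dtau b) z - z * cont k m.+1 (next b) z
  else mellin m b z.

Definition smooth b := forall n, tame T n b.

Lemma smooth_dtau b : smooth b -> smooth (dtau b).
Proof. by move=> sb n; have [] := tame_dtau _ _ _ (sb n.+1). Qed.

Lemma smooth_next b : smooth b -> smooth (next b).
Proof. by move=> sb n; exact: tame_next knot n b (sb n). Qed.

Lemma shift_re n m (x : R) : -1 - m%:R - n.+1%:R < x -> -1 - m.+1%:R - n%:R < x.
Proof. by rewrite -[n.+1]addn1 -[m.+1]addn1 !natrD; lra. Qed.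

Lemma cont_differentiable n m b z : smooth b -> -1 - m%:R - n%:R < cre z ->
  cdifferentiable (cont n m b) z.
Proof.
elim: n m b => [|n IH] m b sb hz.
  by rewrite subr0 in hz; apply: (mellin_differentiable L g knot m b z (sb 0%N)).
have hz' := shift_re _ _ _ hz.
have sd := smooth_dtau b sb; have sn := smooth_next b sb.
apply: cdiffB.
  apply: cdiffB; last exact: IH.
  by apply: cdiffM; [exact: poles_differentiable|exact: (bdry_differentiable L g knot m b z (sb 0%N))].
by apply: cdiffM; [exact: cdiff_id|exact: IH].
Qed.

(** The extra factor vanishes only on the line [Re z = - 1 - m - n], outside the half plane of the
    statement. So on a common half plane, different depths differ by a function without zeros. *)
Lemma cont_step n m b z : smooth b -> -1 - m%:R - n%:R < cre z ->
  cont n.+1 m b z = (z + Complex (m + n.+1)%:R 0) * cont n m b z.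
Proof.
elim: n m b => [|n IH] m b sb hz.
  rewrite subr0 in hz; rewrite /= addn1 (mellin_by_parts L g knot m b z (sb 2%N) hz).
  by rewrite /poles big_ord0 mul1r.
have hz' := shift_re _ _ _ hz.
have -> : cont n.+2 m b z = poles n.+1 m.+1 z * bdry m b z - cont n.+1 m.+1 (dtau b) z
   - z * cont n.+1 m.+1 (next b) z by [].
rewrite IH//; last exact: smooth_dtau.
rewrite IH//; last exact: smooth_next.
by rewrite polesS /= addSnnS; ring.
Qed.

Definition one : R -> R -> R := fun _ _ => 1.

Lemma smooth_one : smooth one. Proof. by move=> n; exact: tame_cst. Qed.
Lemma smooth_corr : smooth corr. Proof. by move=> n; exact: tame_corr knot n. Qed.

(* [(z + 1) * mellin 0 one z], continued to [-3 < Re z]. *)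
Definition reg z : R[i] := bdry 0 one z - z * mellin 2 corr z.

(** The density [one] has zero derivative, and [next one = t corr] raises the exponent once more. A
    single integration by parts therefore gains two powers of [t]. *)
Lemma regE z : -1 < cre z -> (z + 1) * mellin 0 one z = reg z.
Proof.
move=> hz; have h0 : -1 - 0%:R < cre z by rewrite subr0.
have := mellin_by_parts L g knot 0 one z (smooth_one 2%N) h0.
have -> : Complex 1%:R 0 = 1 :> R[i] by [].
move=> ->; rewrite /reg.
have -> : mellin 1 (dtau one) z = 0.
  have -> : (0 : R[i]) = 0 * mellin 1 one z by rewrite mul0r.
  have h1 : -1 - 1%:R < cre z by move: hz; lra.
  have i1 := kernel_integrable L g knot 1 one z (smooth_one 0%N) h1.
  rewrite -(cintM mu2 _ 0 _ (measurable_box L) i1).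
  apply: eq_cint => p /(box_strip L g knot) hp.
  rewrite mul0r /kernel /dens.
  have -> : dtau one p.1 p.2 = 0 by apply: drv_D1; exact: drv_cst.
  by rewrite mulr0 mul0r.
rewrite subr0; congr (_ - _ * _); apply: eq_cint => p _.
by rewrite /kernel; congr (Complex _ _ * _); rewrite /dens /next /one; ring.
Qed.

Lemma reg_differentiable z : -3 < cre z -> cdifferentiable reg z.
Proof.
move=> hz; apply: cdiffB; first by exact: (bdry_differentiable L g knot 0 one _ (smooth_one 0%N)).
apply: cdiffM; first exact: cdiff_id.
by apply: (mellin_differentiable L g knot 2 corr z (smooth_corr 0%N)); move: hz; lra.
Qed.

Definition right_half : set R[i] := [set z | -1 < cre z].

(** The part of [U] with [-3 < Re z] may be disconnected, so [(z + 1) F - 2 reg] cannot be followed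
    inside it. Multiplied by the poles it extends to every depth, and the points near which some of
    these extensions vanishes form an open and relatively closed subset of [U]. *)
Theorem continuation_unique U F : copen U -> cconnected U -> right_half `<=` U ->
  (forall z, U z -> cdifferentiable F z) ->
  (forall z, right_half z -> F z = 2 * mellin 0 one z) ->
  U (rC (-2)) -> F (rC (-2)) = - (2 * reg (rC (-2))).
Proof.
move=> oU cU hU dF FE U2.
(* Where [mellin 2 corr] converges this is [(w + 1) F - 2 reg] times [poles n 2]. *)
pose f n w := (F w * (w + 1) - 2 * bdry 0 one w) * poles n 2 w + 2 * (w * cont n 2 corr w).
have fS n w : - 3 - n%:R < cre w -> f n.+1 w = (w + Complex (2 + n.+1)%:R 0) * f n w.
  move=> hw; rewrite /f polesS (cont_step _ _ _ _ smooth_corr); last by move: hw; lra.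
  by ring.
have f_iter n k w : - 3 - n%:R < cre w -> (f (k + n)%N w = 0 <-> f n w = 0).
  move=> hw; elim: k => [|k IH]; first by [].
  rewrite addSn fS; last by apply: le_lt_trans hw; rewrite lerD2l lerN2 ler_nat leq_addl.
  (* The new factor has positive real part on the half plane of [f n], so passing to a larger depth
     neither creates nor destroys zeros there. *)
  have nz : w + Complex (2 + (k + n).+1)%:R 0 != 0 :> R[i].
    apply/eqP => /(congr1 (@cre R)); rewrite creD /= => E.
    have h1 : (n%:R : R) <= (k + n)%:R by rewrite ler_nat leq_addl.
    have e3 : ((2 + (k + n).+1)%:R : R) = 3 + (k + n)%:R.
      by rewrite natrD -[(k + n).+1]addn1 natrD; ring.
    by move: hw E h1; rewrite e3; clear; lra.
  split => [/eqP|/IH ->]; last by rewrite mulr0.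
  by rewrite mulf_eq0 (negbTE nz) /= => /eqP/IH.
have f_eq n k w : - 3 - n%:R < cre w -> - 3 - k%:R < cre w -> f n w = 0 -> f k w = 0.
  move=> hn hk fn; have [nk|/ltnW kn] := leqP n k.
    by rewrite -(subnK nk); apply/f_iter.
  by apply/(f_iter k (n - k)%N w hk); rewrite subnK.
have f0 w : right_half w -> f 0%N w = 0.
  move=> hw; rewrite /f /poles big_ord0 mulr1 FE//.
  have -> : 2 * mellin 0 one w * (w + 1) = 2 * ((w + 1) * mellin 0 one w) by ring.
  by rewrite regE// /reg /=; ring.
have df n w : U w -> - 3 - n%:R < cre w -> cdifferentiable (f n) w.
  move=> Uw hw; apply: cdiffD.
    apply: cdiffM; last exact: poles_differentiable.
    apply: cdiffB.
      by apply: cdiffM; [exact: dF|apply: cdiffD; [exact: cdiff_id|exact: cdiff_cst]].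
    by apply: cdiffM; [exact: cdiff_cst|exact: (bdry_differentiable L g knot 0 one _ (smooth_one 0%N))].
  apply: cdiffM; first exact: cdiff_cst.
  apply: cdiffM; first exact: cdiff_id.
  by apply: cont_differentiable; [exact: smooth_corr|move: hw; lra].
(* The condition on [r] keeps the whole disc in the half plane where [f n] is controlled. *)
pose Z := [set z | U z /\ exists n, exists2 r : R, 0 < r &
  - 3 - n%:R < cre z - r /\ forall w, cnorm (w - z) < r -> f n w = 0].
have reB w z (r : R) : cnorm (w - z) < r -> cre z - r < cre w.
  move=> h; have := le_lt_trans (cre_le_cnorm _) h.
  by rewrite creD creN ltr_norml => /andP[+ _]; lra.
have UZ : U `<=` Z.
  apply: connected_open_closed => //.
  - by move=> z [].
  - exists 0; split; first by apply: hU; rewrite /right_half /=; lra.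
    exists 0%N, (2^-1) => //; split => [/=|w /reB h]; first by rewrite subr0; lra.
    by apply: f0; rewrite /right_half /=; move: h => /=; lra.
  - move=> z [Uz [n [r r0 [hr hf]]]]; have [e e0 he] := oU z Uz.
    exists (Num.min e (r / 2)); first by rewrite lt_min e0 divr_gt0.
    move=> w; rewrite lt_min => /andP[we wr]; split; first exact: he.
    exists n, (r / 2); first by rewrite divr_gt0.
    split; first by have := reB _ _ _ wr; move: hr; lra.
    move=> v vw; apply: hf.
    have -> : v - z = (v - w) + (w - z) by rewrite addrA subrK.
    by apply: le_lt_trans (cnormD _ _) _; move: vw wr; lra.
  move=> z Uz; have [e e0 he] := oU z Uz.
  (* A depth [n] whose half plane contains every disc of radius at most 1 around [z]. *)
  have [n _ /(_ n (leqnn n)) /= hn] : \forall n \near \oo, - cre z - 2 < n%:R.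
    by near=> n; near: n; exact: nbhs_infty_gtr.
  pose r := Num.min e 1; have r0 : 0 < r by rewrite lt_min e0 ltr01.
  have r1 : r <= 1 by rewrite ge_min lexx orbT.
  have re_ : r <= e by rewrite ge_min lexx.
  exists (r / 8); first by rewrite divr_gt0.
  move=> w wz [Uw [k [q q0 [hq hk]]]]; split=> //; exists n, (r / 8); first by rewrite divr_gt0.
  split; first by move: hn r1; lra.
  pose q' := Num.min q (r / 8).
  have q'0 : 0 < q' by rewrite lt_min q0 divr_gt0.
  apply: (@vanish_near R (f n) z r w q' q'0 r0 wz) => v hv.
    apply: df; first by apply: he; apply: lt_le_trans hv re_.
    by have := reB _ _ _ hv; move: hn r1; lra.
  move: hv; rewrite lt_min => /andP[v1 v2]; apply: (f_eq k n v).
  - by have := reB _ _ _ v1; move: hq; lra.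
  - by have := reB _ _ _ v2; have := reB _ _ _ wz; move: hn r1 r0; lra.
  - exact: hk.
have [_ [n [r r0 [hr hf]]]] := UZ _ U2.
have h2 : f n (rC (-2)) = 0 by apply: hf; rewrite subrr cnorm0.
have : f 0%N (rC (-2)) = 0.
  by apply: (f_eq n 0%N) h2; move: hr r0; rewrite /=; lra.
rewrite /f /poles big_ord0 mulr1 /reg /= => E.
(* At [-2] the factor [z + 1] is [-1], whence the sign in the conclusion. *)
have e1 : rC (-2) + 1 = -1 :> R[i] by apply: complex_eq; rewrite !compE /=; lra.
rewrite e1 in E; move: E; set A := F _; set B := bdry _ _ _; set D := _ * mellin _ _ _.
move=> E; apply/eqP; rewrite -subr_eq0; apply/eqP.
by rewrite -[RHS]oppr0 -E; ring.
Unshelve. all: by end_near. Qed.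

End continuation.

(** * A concrete domain for the continuation *)

Section continuation_domain.
Context {R : realType}.
Implicit Types z w : R[i].

Definition halfplane (al be c : R) : set R[i] := [set z | c < al * cre z + be * cim z].

Lemma halfplane_open al be c : copen (halfplane al be c).
Proof.
move=> z hz; set v := al * cre z + be * cim z in hz.
have K0 : 0 < `|al| + `|be| + 1 by rewrite ltr_wpDl// addr_ge0.
exists ((v - c) / (`|al| + `|be| + 1)); first by rewrite divr_gt0// subr_gt0.
move=> w; rewrite ltr_pdivlMr// => hw.
have -> : halfplane al be c w = (c < v + (al * cre (w - z) + be * cim (w - z))).
  by rewrite /halfplane /= !compE /v; congr (is_true (_ < _)); ring.
have h1 : `|al * cre (w - z)| <= `|al| * cnorm (w - z).
  by rewrite normrM ler_wpM2l// cre_le_cnorm.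
have h2 : `|be * cim (w - z)| <= `|be| * cnorm (w - z).
  by rewrite normrM ler_wpM2l// cim_le_cnorm.
have := cnorm_ge0 (w - z).
by move: h1 h2 hw; rewrite !ler_norml; clear; lra.
Qed.

Lemma copenU (A B : set R[i]) : copen A -> copen B -> copen (A `|` B).
Proof.
by move=> oA oB z [/oA|/oB] [e e0 he]; exists e => // w /he; [left|right].
Qed.

Lemma copenI (A B : set R[i]) : copen A -> copen B -> copen (A `&` B).
Proof.
move=> oA oB z [/oA[d d0 hd] /oB[e e0 he]]; exists (Num.min d e); first by rewrite lt_min d0.
by move=> w; rewrite lt_min => /andP[/hd ? /he].
Qed.

(* A connected neighbourhood of [-2] and of the half plane [-1 < Re z] avoiding the pole [-1]. *)
Definition cont_domain : set R[i] :=
  halfplane 1 0 (-1) `|` (halfplane 1 0 (-3) `&` halfplane (-1) 1 (3 / 2)).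

Lemma cont_domain_open : copen cont_domain.
Proof. by apply: copenU; last apply: copenI; exact: halfplane_open. Qed.

(** The point [2 i] lies in all three half planes, so both convex pieces are seen from it. *)
Lemma cont_domain_connected : cconnected cont_domain.
Proof.
pose p : R[i] := Complex 0 2.
have p1 : halfplane 1 0 (-1) p by rewrite /halfplane /=; lra.
have p2 : halfplane 1 0 (-3) p by rewrite /halfplane /=; lra.
have p3 : halfplane (-1) 1 (3 / 2) p by rewrite /halfplane /=; lra.
apply: (@starshaped_connected _ _ p); first by left.
move=> z [z1|[z2 z3]] t t01; [left|right; split]; exact: convex_halfplane.
Qed.

(** On the real axis [y - x] equals 1 at [-1] and 2 at [-2]; the threshold [3 / 2] separates the
    pole from the point of evaluation. *)
Lemma cont_domain_re z : cont_domain z -> -3 < cre z /\ z != -1.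
Proof.
rewrite /cont_domain /halfplane /= => hz; split; first by case: hz => [|[]]; lra.
by apply/eqP => E; case: hz => [|[]]; rewrite E creN cimN /=; lra.
Qed.
End continuation_domain.

(** * Translations, reflections and the symmetry of double integrals *)

Section shift_invariance.
Context {R : realType}.
Notation mu := (@lebesgue_measure R).
Local Open Scope ereal_scope.

(** Lebesgue measure is determined by its values on the intervals []x, y]], so [phi] pushes it
    forward to itself. *)
Lemma measure_preserving_integral (phi : R -> R) (D : set R) (f : R -> \bar R) :
  measurable_fun setT phi ->
  (forall x y : R, (x < y)%R -> mu (phi @^-1` `]x, y]) = (y - x)%:E) ->
  measurable D -> measurable_fun D f -> (forall x, D x -> 0 <= f x) ->
  \int[mu]_(y in D) f y = \int[mu]_(x in phi @^-1` D) f (phi x).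
Proof.
move=> mphi hphi mD mf f0.
rewrite -(@ge0_integral_pushforward _ _ (measurableTypeR R) (measurableTypeR R) R phi mphi _ D f)//;
  last by move=> y; rewrite inE; exact: f0.
apply: eq_measure_integral => A mA _.
apply: lebesgue_measure_unique => // X [[x y] /= _ <-].
rewrite /pushforward.
have [xy|yx] := ltP x y.
  by rewrite hphi// lebesgue_measure_itv/= lte_fin xy EFinB.
by rewrite set_itv_ge -?leNgt ?bnd_simp// preimage_set0 !measure0.
Qed.

Lemma shift_integral (c : R) (D : set R) (f : R -> \bar R) :
  measurable D -> measurable_fun D f -> (forall x, D x -> 0 <= f x) ->
  \int[mu]_(y in D) f y = \int[mu]_(x in [set x | D (x + c)%R]) f (x + c)%R.
Proof.
apply: (measure_preserving_integral (fun x => (x + c)%R)).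
  by apply: measurable_funD => //; exact: measurable_cst.
move=> x y xy; have -> : (fun x => (x + c)%R) @^-1` `]x, y] = `](x - c)%R, (y - c)%R]%classic.
  by apply/seteqP; split => t /=; rewrite !in_itv/= ltrBlDr lerBrDr.
rewrite lebesgue_measure_itv/= lte_fin ltrD2r xy -EFinB; congr (_%:E); ring.
Qed.

Lemma reflect_integral (c : R) (D : set R) (f : R -> \bar R) :
  measurable D -> measurable_fun D f -> (forall x, D x -> 0 <= f x) ->
  \int[mu]_(y in D) f y = \int[mu]_(x in [set x | D (c - x)%R]) f (c - x)%R.
Proof.
apply: (measure_preserving_integral (fun x => (c - x)%R)).
  by apply: measurable_funB => //; exact: measurable_cst.
move=> x y xy; have -> : (fun x => (c - x)%R) @^-1` `]x, y] = `[(c - y)%R, (c - x)%R[%classic.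
  apply/seteqP; split => t /=; rewrite !in_itv/=.
    by move=> /andP[h1 h2]; apply/andP; split; lra.
  by move=> /andP[h1 h2]; apply/andP; split; lra.
rewrite lebesgue_measure_itv/= lte_fin; have -> : (c - y < c - x)%R by lra.
by rewrite -EFinB; congr (_%:E); ring.
Qed.

Lemma itv_oc_split (x y z : R) (f : R -> \bar R) : (x <= y <= z)%R ->
  measurable_fun setT f -> (forall t, 0 <= f t) ->
  \int[mu]_(t in `]x, z]) f t = \int[mu]_(t in `]x, y]) f t + \int[mu]_(t in `]y, z]) f t.
Proof.
move=> /andP[xy yz] mf f0.
rewrite -ge0_integral_setU//=; last 2 first.
- by apply: measurable_funTS.
- apply/disj_setPS => t [] /=; rewrite !in_itv/= => /andP[_ ty] /andP[yt _].
  by move: (lt_le_trans yt ty); rewrite ltxx.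
congr (integral mu _ _); apply/seteqP; split => t /=; rewrite !in_itv/=.
  by move=> /andP[xt tz]; have [ty|yt] := leP t y; [left|right]; rewrite ?xt ?tz.
move=> [/andP[xt ty]|/andP[yt tz]]; first by rewrite xt (le_trans ty).
by rewrite tz (le_lt_trans xy yt).
Qed.

(** Cut []c, L + c]] at [L] and move the last piece back by one period. *)
Lemma period_shift (L c : R) (h : R -> \bar R) : (0 <= c <= L)%R ->
  measurable_fun setT h -> (forall x, 0 <= h x) -> (forall x, h (x + L)%R = h x) ->
  \int[mu]_(x in `]0%R, L]) h (x + c)%R = \int[mu]_(x in `]0%R, L]) h x.
Proof.
move=> /andP[c0 cL] mh h0 ph.
have mT (D : set R) : measurable_fun D h by exact: measurable_funTS.
have -> : \int[mu]_(x in `]0%R, L]) h (x + c)%R = \int[mu]_(y in `]c, (L + c)%R]) h y.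
  rewrite [RHS](shift_integral c)//.
  have -> // : [set x | `]c, (L + c)%R]%classic (x + c)%R] = `]0%R, L]%classic.
  by apply/seteqP; split => t /=; rewrite !in_itv/= => /andP[? ?]; apply/andP; split; lra.
rewrite (itv_oc_split c L (L + c)%R)//; last by rewrite cL lerDl.
rewrite (itv_oc_split 0%R c L) ?c0// addeC; congr (_ + _).
rewrite [LHS](shift_integral L)//.
have -> : [set x | `]L, (L + c)%R]%classic (x + L)%R] = `]0%R, c]%classic.
  by apply/seteqP; split => t /=; rewrite !in_itv/= => /andP[? ?]; apply/andP; split; lra.
by apply: eq_integral => x _; exact: ph.
Qed.

Lemma rect_tonelli_swap (A B : set R) (f : R * R -> \bar R) : measurable A -> measurable B ->
  measurable_fun setT f -> (forall p, 0 <= f p) ->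
  \int[mu]_(s in A) \int[mu]_(t in B) f (s, t) = \int[mu]_(t in B) \int[mu]_(s in A) f (s, t).
Proof.
move=> mA mB mf f0; rewrite -iterated_patch fubini_tonelli.
- have -> : (fun y => \int[mu]_x (f \_ (A `*` B)) (x, y)) =
    (fun y => \int[mu]_x ((fun p => f (p.2, p.1)) \_ (B `*` A)) (y, x)).
    apply/funext => y; apply: eq_integral => x _.
    rewrite !patch_rect !patchE.
    by case: (x \in A); case: (y \in B).
  by rewrite (iterated_patch B A (fun p => f (p.2, p.1))).
- by apply/(measurable_restrictT f); [exact: measurableX|exact: measurable_funTS].
- by move=> p; apply: erestrict_ge0.
Qed.

Lemma measurable_inner_integral (B : set R) (f : R * R -> \bar R) : measurable B ->
  measurable_fun setT f -> (forall p, 0 <= f p) ->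
  measurable_fun setT (fun s => \int[mu]_(t in B) f (s, t)).
Proof.
move=> mB mf f0.
have mfB : measurable_fun setT (f \_ (setT `*` B)).
  by apply/(measurable_restrictT f); [exact: measurableX|exact: measurable_funTS].
have f0B p : 0 <= (f \_ (setT `*` B)) p by apply: erestrict_ge0.
have := measurable_fun_fubini_tonelli_F (m2 := mu) _ mfB f0B.
apply: eq_measurable_fun => s _; rewrite /fubini_F [RHS]integral_mkcond; apply: eq_integral => t _.
by rewrite patch_rect patchE in_setT.
Qed.

(** Put [t = s + tau]. The integral over [s] at fixed [tau] is unchanged under [tau -> L - tau], by
    symmetry and periodicity, so the range []a, L]] contributes as much as []0, a]]. Nonnegative
    extended values let Tonelli apply without integrability. *)
Lemma symmetric_halving (L a : R) (f : R * R -> \bar R) : (0 < L)%R -> a = (L / 2)%R ->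
  measurable_fun setT f -> (forall p, 0 <= f p) ->
  (forall s t, f ((s + L)%R, t) = f (s, t)) -> (forall s t, f (s, (t + L)%R) = f (s, t)) ->
  (forall s t, f (s, t) = f (t, s)) ->
  \int[mu]_(s in `[0%R, L]) \int[mu]_(t in `[0%R, L]) f (s, t) =
  2%:E * \int[mu]_(s in `[0%R, L]) \int[mu]_(t in `]0%R, a]) f (s, (s + t)%R).
Proof.
move=> L0 aE mf f0 p1 p2 sym.
have mI (x y : R) : measurable (`]x, y]%classic : set R) by [].
have aL : (0 <= a <= L)%R by rewrite aE; apply/andP; split; lra.
have mslice s : measurable_fun setT (fun t => f (s, t)).
  by apply: measurableT_comp mf _; exact: measurable_pair1.
pose F (p : R * R) := f (p.1, (p.1 + p.2)%R).
have mF : measurable_fun setT F.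
  apply: measurableT_comp mf _; apply: measurable_fun_pair => //.
  by apply: measurable_funD.
have mFslice t : measurable_fun setT (fun s => F (s, t)).
  by apply: measurableT_comp mF _; exact: measurable_pair2.
have mFslice1 s : measurable_fun setT (fun t => F (s, t)).
  by apply: measurableT_comp mF _; exact: measurable_pair1.
have F0 p : 0 <= F p by exact: f0.
have E1 s : \int[mu]_(t in `[0%R, L]) f (s, t) = \int[mu]_(t in `]0%R, L]) f (s, t).
  by rewrite integral_itv_obnd_cbnd//; exact: measurable_funTS.
under eq_integral do rewrite E1.
rewrite -integral_itv_obnd_cbnd; last first.
  by apply: measurable_funTS; exact: measurable_inner_integral.
rewrite -[in RHS]integral_itv_obnd_cbnd; last first.
  by apply: measurable_funTS; exact: (measurable_inner_integral _ F).
transitivity (\int[mu]_(s in `]0%R, L]) \int[mu]_(t in `]0%R, L]) F (s, t)).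
  apply: eq_integral => s; rewrite inE/= in_itv/= => /andP[s0 sL].
  rewrite -(period_shift L s (fun t => f (s, t)))//; last by rewrite ltW.
  by apply: eq_integral => t _; rewrite /F/= addrC.
transitivity (\int[mu]_(s in `]0%R, L]) (\int[mu]_(t in `]0%R, a]) F (s, t) +
    \int[mu]_(t in `]a, L]) F (s, t))).
  by apply: eq_integral => s _; exact: itv_oc_split.
rewrite ge0_integralD//=; last 4 first.
- by move=> s _; exact: integral_ge0.
- by apply: measurable_funTS; exact: measurable_inner_integral.
- by move=> s _; exact: integral_ge0.
- by apply: measurable_funTS; exact: measurable_inner_integral.
suff -> : \int[mu]_(s in `]0%R, L]) \int[mu]_(t in `]a, L]) F (s, t) =
   \int[mu]_(s in `]0%R, L]) \int[mu]_(t in `]0%R, a]) F (s, t) by rewrite mule_natl mule2n.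
rewrite !rect_tonelli_swap//.
pose k t := \int[mu]_(s in `]0%R, L]) F (s, t).
have mk : measurable_fun setT k.
  apply: (measurable_inner_integral `]0%R, L] (fun p => F (p.2, p.1))) => //.
  by apply: measurableT_comp mF _; exact: measurable_swap.
have k0 t : 0 <= k t by exact: integral_ge0.
(* Translating [s] by [L - t] turns the pair [(s, s + t)] into [(s + L - t, s + L)], which is
   [(s, s + L - t)] up to symmetry and a period. *)
have refl t : (0 <= t <= L)%R -> k (L - t)%R = k t.
  move=> tL; rewrite /k -(period_shift L (L - t)%R (fun s => F (s, t)))//.
  - apply: eq_integral => s _; rewrite /F/=.
    have -> : (s + (L - t) + t = s + L)%R by ring.
    by rewrite p2 sym.
  - by apply/andP; split; lra.
  - by move=> s; rewrite /F/= p1 addrAC p2.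
rewrite -[RHS](_ : \int[mu]_(t in `[0%R, a[) k t = _); last first.
  rewrite -(@integral_itv_obnd_cbnd _ 0%R (BLeft a)); last exact: measurable_funTS.
  by rewrite integral_itv_bndo_bndc//; exact: measurable_funTS.
rewrite [RHS](reflect_integral L `[0%R, a[ k)//; last exact: measurable_funTS.
have -> : [set x | `[0%R, a[%classic (L - x)%R] = `]a, L]%classic.
  apply/seteqP; split => t /=; rewrite !in_itv/= aE => /andP[? ?]; apply/andP; split; lra.
apply: eq_integral => t; rewrite inE/= in_itv/= => /andP[h1 h2].
by rewrite refl// h2 andbT; apply: le_trans (ltW h1); case/andP: aL.
Qed.

End shift_invariance.

(** * Real-valued double integrals over pairs of points *)

Section symmetric_pairs.
Context {R : realType}.
Notation mu := (@lebesgue_measure R).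
Variables (L a : R) (h : R -> R).
Implicit Types (s t : R) (f : R * R -> R).
Hypotheses (L0 : 0 < L) (aE : a = L / 2) (ih : rintegrable mu `]0, a] h).

(** The majorant [h] is prescribed for arc differences up to half a period; symmetry and periodicity
    carry it to the other half. *)
Definition symmetric_pair (f : R * R -> R) :=
  [/\ measurable_fun setT f, forall s t, f (s + L, t) = f (s, t), forall s t, f (s, t + L) = f (s, t),
   forall s t, f (s, t) = f (t, s) & forall s t, 0 < t <= a -> `|f (s, s + t)| <= h t].

Local Notation Q := (`[0, L]%classic `*` `]0, a]%classic).

Lemma symmetric_pair_box f : symmetric_pair f -> rintegrable mu2 Q (fun p => f (p.1, p.1 + p.2)).
Proof.
move=> [mf _ _ _ fh]; apply: (rect_integrable 0 L _ _ h) => //.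
  apply: measurable_funTS; apply: measurableT_comp mf _; apply: measurable_fun_pair => //.
  exact: measurable_funD.
by move=> s t _; rewrite /= in_itv/=; exact: fh.
Qed.

(** Finiteness at every [s] matters because an infinite inner integral would be turned into 0 by
    [fine]. The far half of the period is reflected onto the near half, where [h] applies. *)
Lemma symmetric_pair_slice f s : symmetric_pair f -> (forall p, 0 <= f p) -> 0 <= s <= L ->
  (\int[mu]_(t in `[0%R, L]) (f (s, t))%:E < +oo)%E.
Proof.
move=> [mf p1 p2 sym fh] f0 hs.
have mslice : measurable_fun setT (fun t : R => (f (s, t))%:E).
  by apply/measurable_EFinP; apply: measurableT_comp mf _; exact: measurable_pair1.
have mF : measurable_fun setT (fun t : R => (f (s, t + s))%:E).
  apply/measurable_EFinP; apply: measurableT_comp mf _; apply: measurable_fun_pair => //.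
  exact: measurable_funD.
rewrite -integral_itv_obnd_cbnd; last exact: measurable_funTS.
rewrite -(period_shift L s (fun t => (f (s, t))%:E))//; last 2 first.
- by move=> t; rewrite lee_fin.
- by move=> t; rewrite p2.
have a0 : 0 < a by rewrite aE divr_gt0.
have aL : a <= L by rewrite aE ler_pdivrMr// ler_peMr ?(ltW L0)// ler1n.
rewrite (itv_oc_split 0 a L)//; last 2 first.
- by rewrite (ltW a0).
- by move=> t; rewrite lee_fin.
have [mh ltho] := integrableP _ _ _ ih.
have bound (F : R -> R) : measurable_fun setT F -> (forall t, 0 < t <= a -> 0 <= F t <= h t) ->
    (\int[mu]_(t in `]0%R, a]) (F t)%:E < +oo)%E.
  move=> mF' hF; apply: le_lt_trans ltho; apply: ge0_le_integral => //=.
  - by move=> t; rewrite in_itv/= lee_fin => /hF /andP[].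
  - by apply/measurable_EFinP; exact: measurable_funTS.
  - by apply/measurable_EFinP; apply: measurableT_comp => //; exact/measurable_EFinP.
  - move=> t; rewrite ?in_itv/= => /hF /andP[_ Fh]; rewrite lee_fin.
    by apply: le_trans Fh (ler_norm _).
apply: lte_add_pinfty.
  apply: bound; first exact/measurable_EFinP.
  by move=> t ht; rewrite f0 addrC (le_trans (ler_norm _))// fh.
rewrite (reflect_integral L)//; last 2 first.
- exact: measurable_funTS.
- by move=> t _; rewrite lee_fin.
have -> : [set x | `]a, L]%classic (L - x)] = `[0, a[%classic.
  by apply/seteqP; split => t /=; rewrite !in_itv/= aE => /andP[? ?]; apply/andP; split; lra.
have mG : measurable_fun setT (fun t : R => f (s, L - t + s)).
  apply: measurableT_comp mf _; apply: measurable_fun_pair => //.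
  by apply: measurable_funD => //; apply: measurable_funB.
rewrite -(@integral_itv_obnd_cbnd _ 0 (BLeft a)); last first.
  by apply/measurable_EFinP; exact: measurable_funTS.
rewrite integral_itv_bndo_bndc//; last by apply/measurable_EFinP; exact: measurable_funTS.
apply: bound => // t ht; rewrite f0/=.
have -> : L - t + s = (s - t) + L by ring.
rewrite p2 sym (le_trans (ler_norm _))//.
by rewrite -{2}(subrK t s) fh.
Qed.

Lemma symmetric_pair_ge0 f : symmetric_pair f -> (forall p, 0 <= f p) ->
  rintegrable mu `[0, L] (fun s => \int[mu]_(t in `[0, L]) f (s, t)) /\
  \int[mu]_(s in `[0, L]) \int[mu]_(t in `[0, L]) f (s, t) = 2 * \int[mu2]_(p in Q) f (p.1, p.1 + p.2).
Proof.
move=> sf f0; have [mf p1 p2 sym fh] := sf.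
have ib := symmetric_pair_box f sf.
have e1 s : 0 <= s <= L -> (\int[mu]_(t in `[0, L]) f (s, t))%:E = (\int[mu]_(t in `[0%R, L]) (f (s, t))%:E)%E.
  move=> hs; rewrite /Rintegral fineK//= ge0_fin_numE; first exact: symmetric_pair_slice.
  by apply: integral_ge0 => t _; rewrite lee_fin.
have H : (\int[mu]_(s in `[0%R, L]) (\int[mu]_(t in `[0, L]) f (s, t))%R%:E =
    2%:E * \int[mu2]_(p in Q) (f (p.1, p.1 + p.2)%R)%:E)%E.
  rewrite rect_tonelli//; last 2 first.
  - by case/integrableP: ib.
  - by move=> p _; rewrite lee_fin.
  rewrite -(symmetric_halving L a (fun p => (f p)%:E))//; last 4 first.
  - exact/measurable_EFinP.
  - by move=> s t; rewrite p1.
  - by move=> s t; rewrite p2.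
  - by move=> s t; rewrite sym.
  by apply: eq_integral => s; rewrite inE/= in_itv/=; exact: e1.
have cE : (\int[mu2]_(p in Q) f (p.1, p.1 + p.2))%:E = (\int[mu2]_(p in Q) (f (p.1, p.1 + p.2)%R)%:E)%E.
  rewrite /Rintegral fineK//; apply: integrable_fin_num ib => //; exact: measurableX.
rewrite -cE in H; split; last by rewrite {1}/Rintegral H.
apply/integrableP; split.
  apply/measurable_EFinP.
  have -> : (fun s => \int[mu]_(t in `[0, L]) f (s, t)) =
     fine \o (fun s => \int[mu]_(t in `[0%R, L]) (f (s, t))%:E)%E by [].
  apply: measurable_funTS; apply: measurableT_comp; first exact: fine_measurable.
  apply: (measurable_inner_integral _ (fun p => (f p)%:E)) => //.
  exact/measurable_EFinP.
under eq_integral => s _ do rewrite /= ger0_norm ?Rintegral_ge0//.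
by rewrite H -EFinM ltry.
Qed.

(** Positive and negative parts inherit the symmetries and the majorant. *)
Lemma symmetric_pair_integral f : symmetric_pair f ->
  \int[mu]_(s in `[0, L]) \int[mu]_(t in `[0, L]) f (s, t) = 2 * \int[mu2]_(p in Q) f (p.1, p.1 + p.2).
Proof.
move=> [mf p1 p2 sym fh].
pose fp p := Num.max (f p) 0; pose fm p := Num.max (- f p) 0.
have fE p : f p = fp p - fm p.
  by rewrite /fp /fm; have [?|?] := leP (f p) 0; have [?|?] := leP (- f p) 0; lra.
have fp0 p : 0 <= fp p by rewrite le_max lexx orbT.
have fm0 p : 0 <= fm p by rewrite le_max lexx orbT.
have np p : fp p <= `|f p| by rewrite ge_max ler_norm normr_ge0.
have nm p : fm p <= `|f p| by rewrite ge_max -normrN ler_norm normr_ge0.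
have sp : symmetric_pair fp.
  split=> [|s t|s t|s t|s t ht]; rewrite /fp ?p1 ?p2//; last 2 first.
  - by rewrite sym.
  - by rewrite ger0_norm ?fp0// (le_trans (np _))// fh.
    by apply: measurable_maxr => //.
have sm : symmetric_pair fm.
  split=> [|s t|s t|s t|s t ht]; rewrite /fm ?p1 ?p2//; last 2 first.
  - by rewrite sym.
  - by rewrite ger0_norm ?fm0// (le_trans (nm _))// fh.
    by apply: measurable_maxr => //; apply: measurableT_comp.
have [ip Ep] := symmetric_pair_ge0 fp sp fp0.
have [im Em] := symmetric_pair_ge0 fm sm fm0.
have slice k s : symmetric_pair k -> (forall p, 0 <= k p) -> 0 <= s <= L -> rintegrable mu `[0, L] (fun t => k (s, t)).
  move=> sk k0 hs; apply/integrableP; split.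
    apply/measurable_EFinP; apply: measurable_funTS; case: sk => mk _ _ _ _.
    by apply: measurableT_comp mk _; exact: measurable_pair1.
  under eq_integral => t _ do rewrite /= ger0_norm//.
  exact: symmetric_pair_slice.
have -> : \int[mu2]_(p in Q) f (p.1, p.1 + p.2) =
   \int[mu2]_(p in Q) (fp (p.1, p.1 + p.2) - fm (p.1, p.1 + p.2)).
  by apply: eq_Rintegral => p _.
rewrite RintegralB//; [|exact: measurableX|exact: symmetric_pair_box|exact: symmetric_pair_box].
rewrite mulrBr -Ep -Em -RintegralB//.
apply: eq_Rintegral => s; rewrite inE/= in_itv/= => hs.
rewrite -RintegralB//; [|exact: slice|exact: slice].
by apply: eq_Rintegral => t _.
Qed.

End symmetric_pairs.

(** * The energy function as an integral over the half-length box *)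

Section energy_function.
Context {R : realType}.
Variables (L : R) (g : R -> hpt R).
Hypothesis knot : legendrian_knot L g.
Implicit Types (s t : R) (z : R[i]).
Notation mu := (@lebesgue_measure R).
Notation T := (reach L).
Local Notation L0 := (knot_length_gt0 L g knot).
Local Notation a := (half L).

Lemma dH_ell s t : 0 < t < T -> 0 < dH (g s) (g (s + t)) /\ ln (dH (g s) (g (s + t))) = ell g s t.
Proof.
move=> ht; have d0 : 0 < dist4 g s t.
  by rewrite (dist4E L g)// mulr_gt0 ?(gauge_gt0 L g knot)// exprn_gt0//; case/andP: ht.
by rewrite dH_dist4 powR_gt0// ln_powR /ell mulrC.
Qed.

Lemma cpowR_cexpt (d : R) z : 0 < d -> cpowR d z = cexpt z (ln d).
Proof. by move=> d0; rewrite /cpowR /cexpt /powR gt_eqF. Qed.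

Lemma dH_sym (p q : hpt R) : dH p q = dH q p.
Proof. by rewrite /dH /koranyi_norm /hmul /hinv /hx /hy /hu /=; congr powR; ring. Qed.

Lemma dH_periodic s t : dH (g (s + L)) (g t) = dH (g s) (g t).
Proof. by rewrite (knot_periodic L g knot). Qed.

Lemma measurable_dH : measurable_fun setT (fun p : R * R => dH (g p.1) (g p.2)).
Proof.
have mc (f : R -> R) : smooth_fun f -> measurable_fun setT (fun p : R * R => f p.1) /\
    measurable_fun setT (fun p : R * R => f p.2).
  move=> /smooth_continuous /continuous_measurable_fun mf.
  by split; apply: measurableT_comp mf _; [exact: measurable_fst|exact: measurable_snd].
have [x1 x2] := mc _ (smooth_x L g knot); have [y1 y2] := mc _ (smooth_y L g knot).
have [u1 u2] := mc _ (smooth_u L g knot).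
have -> : (fun p : R * R => dH (g p.1) (g p.2)) = (fun p =>
  powR (((cx g p.2 - cx g p.1) ^+ 2 + (cy g p.2 - cy g p.1) ^+ 2) ^+ 2 +
    16 * (cu g p.2 - cu g p.1 - 2^-1 * (cx g p.1 * cy g p.2 - cy g p.1 * cx g p.2)) ^+ 2) (4^-1)).
  by apply/funext => p; have := dH_dist4 g p.1 (p.2 - p.1); rewrite /dist4 /vert addrC subrK.
apply: (measurableT_comp (f := fun v : R => powR v 4^-1)); first exact: measurable_powR.
apply: measurable_funD.
  by apply: measurable_funX; apply: measurable_funD; apply: measurable_funX; exact: measurable_funB.
apply: measurable_funM; first exact: measurable_cst.
apply: measurable_funX; apply: measurable_funB; first exact: measurable_funB.
by apply: measurable_funM; [exact: measurable_cst|apply: measurable_funB; exact: measurable_funM].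
Qed.

(** The two coordinates of the complex power are symmetric functions of the two points, majorized by
    a multiple of [t^(Re z)], which is integrable for [-1 < Re z]. *)
Lemma BK_mellin z : -1 < cre z -> BK L g z = 2 * mellin L g 0 one z.
Proof.
move=> hz.
have [K K0 hK] := dens_bound L g knot 0 one (cre z) (smooth_one L 0).
have iK : rintegrable mu `]0, a] (fun t => K * expR (cre z * ln t)).
  by apply: rintegrableZ => //; apply: power_integrable => //; exact: half_gt0 knot.
have main (i : bool) : \int[mu]_(s in `[0, L]) \int[mu]_(t in `[0, L]) cproj i (cpowR (dH (g s) (g t)) z) =
    2 * \int[mu2]_(p in box L) cproj i (kernel g 0 one z p.1 p.2).
  rewrite (symmetric_pair_integral L a (fun t => K * expR (cre z * ln t)) L0 erefl iK
    (fun p => cproj i (cpowR (dH (g p.1) (g p.2)) z))).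
    congr (_ * _); apply: eq_Rintegral => -[s t]; rewrite inE => -[_ /=].
    rewrite in_itv/= => /(half_strip L g knot) ht; have [d0 dl] := dH_ell s t ht.
    by rewrite cpowR_cexpt// dl /kernel /dens /one expr0 mulr1 -[Complex 1 0]/(1 : R[i]) mul1r.
  split.
  - have md := measurable_dH.
    have ml : measurable_fun setT (fun p : R * R => cim z * ln (dH (g p.1) (g p.2))).
      by apply: measurable_funM => //; apply: measurableT_comp md; exact: measurable_ln.
    have mp : measurable_fun setT (fun p : R * R => powR (dH (g p.1) (g p.2)) (cre z)).
      exact: measurableT_comp (measurable_powR _) md.
    by case: i => /=; apply: measurable_funM mp _; apply: measurableT_comp ml;
      apply: continuous_measurable_fun; [exact: continuous_cos|exact: continuous_sin].
  - by move=> s t /=; rewrite dH_periodic.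
  - by move=> s t /=; rewrite dH_sym dH_periodic dH_sym.
  - by move=> s t /=; rewrite dH_sym.
  move=> s t ht /=; have hT := half_strip L g knot t ht.
  have [d0 dl] := dH_ell s t hT; rewrite cpowR_cexpt// dl.
  apply: le_trans (cproj_le i _) _; have := hK s t hT; rewrite addr0.
  rewrite /dens /one expr0 mulr1 normr1 mul1r; apply: le_trans.
  have := cnorm_bcexpt 1 z (ell g s t).
  by rewrite -[Complex 1 0]/(1 : R[i]) mul1r normr1 mul1r => ->.
have := main true; have := main false; rewrite /= => h1 h2.
rewrite /BK h1 h2 /mellin /cint; apply: complex_eq; rewrite ?creM ?cimM /=; ring.
Qed.

End energy_function.

(** * Conjugation and derivatives of complex-valued paths *)

Section complex_paths.
Context {R : realType}.
Implicit Types (z w c l m : R[i]) (f h : R -> R[i]) (a b t : R).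

Lemma cconjD z w : cconj (z + w) = cconj z + cconj w.
Proof. by apply: complex_eq; rewrite /cconj ?compE //= ?compE ?opprD. Qed.
Lemma cconjN z : cconj (- z) = - cconj z.
Proof. by apply: complex_eq; rewrite /cconj ?compE //= ?compE. Qed.
Lemma cconjM z w : cconj (z * w) = cconj z * cconj w.
Proof. by apply: complex_eq; rewrite /cconj ?compE /= ?compE ?mulrN ?mulNr ?opprK ?opprD. Qed.
Lemma cconjK z : cconj (cconj z) = z.
Proof. by apply: complex_eq; rewrite /= ?opprK. Qed.
Lemma cconj_rC a : cconj (rC a) = rC a.
Proof. by apply: complex_eq; rewrite /= ?oppr0. Qed.
Lemma rC0 : rC (0 : R) = 0. Proof. by []. Qed.
Lemma rC1 : rC (1 : R) = 1. Proof. by []. Qed.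
Lemma rCD a b : rC (a + b) = rC a + rC b.
Proof. by apply: complex_eq; rewrite ?compE /= ?addr0. Qed.
Lemma rCN a : rC (- a) = - rC a.
Proof. by apply: complex_eq; rewrite ?compE /= ?oppr0. Qed.
Lemma rCM a b : rC (a * b) = rC a * rC b.
Proof. by apply: complex_eq; rewrite ?compE /= ?mulr0 ?mul0r ?subr0 ?addr0. Qed.
Lemma rC_inj : injective (@rC R).
Proof. by move=> a b []. Qed.
Lemma rC_eq0 a : (rC a == 0) = (a == 0).
Proof. by rewrite -(inj_eq rC_inj). Qed.
Lemma rCV a : rC (a^-1) = (rC a)^-1.
Proof.
have [->|a0] := eqVneq a 0; first by rewrite invr0 rC0 invr0.
by apply: (mulfI (x := rC a)); rewrite ?rC_eq0// -rCM !divff ?rC_eq0.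
Qed.
Lemma rC_real z : cim z = 0 -> z = rC (cre z).
Proof. by case: z => x y /= ->. Qed.
Lemma cconj_real z : cim z = 0 -> cconj z = z.
Proof. by case: z => x y /= ->; rewrite /cconj /= oppr0. Qed.
Lemma cim_conj z : z = cconj z -> cim z = 0.
Proof. by case: z => x y [] /eqP; rewrite eq_sym eqNr => /eqP. Qed.
Lemma rC_conj z : z = cconj z -> z = rC (cre z).
Proof. by move=> /cim_conj; exact: rC_real. Qed.

Definition csq z : R := cre z ^+ 2 + cim z ^+ 2.
Lemma mul_cconj z : z * cconj z = rC (csq z).
Proof. by apply: complex_eq; rewrite ?compE /= ?/csq; ring. Qed.
Lemma csq_gt0 z : (0 < csq z) = (z != 0).
Proof. by rewrite -cnorm_gt0 /cnorm sqrtr_gt0. Qed.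
Lemma csq_eq0 z : (csq z == 0) = (z == 0).
Proof.
have := csq_gt0 z; rewrite lt_neqAle /csq addr_ge0 ?sqr_ge0// andbT eq_sym.
by move=> /(congr1 negb); rewrite !negbK.
Qed.
Lemma cconj_eq0 z : (cconj z == 0) = (z == 0).
Proof. by rewrite -csq_eq0 /csq /= sqrrN -csq_eq0. Qed.
Lemma cinvE z : z^-1 = Complex (cre z / csq z) (- cim z / csq z).
Proof.
have [->|z0] := eqVneq z 0; first by rewrite invr0 /=; apply: complex_eq; rewrite /= ?oppr0 ?mul0r.
have q0 : csq z != 0 by rewrite csq_eq0.
apply: (mulfI z0); rewrite divff//; apply: complex_eq; rewrite ?compE /=; last by field.
by move: q0; rewrite /csq => q0; field.
Qed.

Lemma cconj0 : cconj (0 : R[i]) = 0. Proof. exact: cconj_rC. Qed.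
Lemma cconj1 : cconj (1 : R[i]) = 1. Proof. exact: cconj_rC. Qed.
Lemma cconjV z : cconj z^-1 = (cconj z)^-1.
Proof.
have [->|z0] := eqVneq z 0; first by rewrite invr0 cconj0 invr0.
by apply: (mulfI (x := cconj z)); rewrite ?cconj_eq0// -cconjM !divff ?cconj_eq0// cconj1.
Qed.
Lemma rC2 : rC (2 : R) = 2. Proof. by apply: complex_eq; rewrite /= ?addr0. Qed.
Lemma cconj2 : cconj (2 : R[i]) = 2. Proof. by rewrite -rC2 cconj_rC. Qed.
Definition conjE := (cconj0, cconj2, cconjK, cconj_rC, cconjM, cconjD, cconjN, cconjV).

Definition cdrv f t l := is_derive t 1 (fun x => cre (f x)) (cre l) /\ is_derive t 1 (fun x => cim (f x)) (cim l).

Lemma cdrv_eq f t l m : cdrv f t l -> l = m -> cdrv f t m. Proof. by move=> h <-. Qed.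
Lemma cdrv_uniq f t l m : cdrv f t l -> cdrv f t m -> l = m.
Proof.
move=> [h1 h2] [k1 k2]; apply: complex_eq.
  by rewrite -(drv_D1 _ _ _ h1) (drv_D1 _ _ _ k1).
by rewrite -(drv_D1 _ _ _ h2) (drv_D1 _ _ _ k2).
Qed.
Lemma cdrv_cst c t : cdrv (fun=> c) t 0. Proof. by split; exact: drv_cst. Qed.
Lemma cdrv_rC (p : R -> R) t d : is_derive t 1 p d -> cdrv (fun x => rC (p x)) t (rC d).
Proof. by move=> h; split => //; exact: drv_cst. Qed.
Lemma cdrv_add f h t l m : cdrv f t l -> cdrv h t m -> cdrv (fun x => f x + h x) t (l + m).
Proof.
move=> [f1 f2] [h1 h2]; split; rewrite ?creD ?cimD.
  by rewrite (_ : (fun x => _) = (fun x => cre (f x) + cre (h x))); [exact: drv_add|apply/funext => x; rewrite creD].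
by rewrite (_ : (fun x => _) = (fun x => cim (f x) + cim (h x))); [exact: drv_add|apply/funext => x; rewrite cimD].
Qed.
Lemma cdrv_mul f h t l m : cdrv f t l -> cdrv h t m -> cdrv (fun x => f x * h x) t (l * h t + f t * m).
Proof.
move=> [f1 f2] [h1 h2]; split.
  rewrite (_ : (fun x => _) = (fun x => cre (f x) * cre (h x) - cim (f x) * cim (h x))); last first.
    by apply/funext => x; rewrite creM.
  apply: drv_eq (drv_sub _ _ _ _ _ (drv_mul _ _ _ _ _ f1 h1) (drv_mul _ _ _ _ _ f2 h2)) _.
  by rewrite !compE; ring.
rewrite (_ : (fun x => _) = (fun x => cre (f x) * cim (h x) + cim (f x) * cre (h x))); last first.
  by apply/funext => x; rewrite cimM.
apply: drv_eq (drv_add _ _ _ _ _ (drv_mul _ _ _ _ _ f1 h2) (drv_mul _ _ _ _ _ f2 h1)) _.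
by rewrite !compE; ring.
Qed.
Lemma cdrv_scale c f t l : cdrv f t l -> cdrv (fun x => c * f x) t (c * l).
Proof. by move=> h; apply: cdrv_eq (cdrv_mul _ _ _ _ _ (cdrv_cst c t) h) _; rewrite mul0r add0r. Qed.
Lemma cdrv_opp f t l : cdrv f t l -> cdrv (fun x => - f x) t (- l).
Proof.
move=> h; apply: cdrv_eq _ (mulN1r l).
rewrite (_ : (fun x => - f x) = (fun x => -1 * f x)); first exact: cdrv_scale.
by apply/funext => x; rewrite mulN1r.
Qed.
Lemma cdrv_sub f h t l m : cdrv f t l -> cdrv h t m -> cdrv (fun x => f x - h x) t (l - m).
Proof. by move=> hf hh; apply: cdrv_add hf _; exact: cdrv_opp. Qed.
Lemma cdrv_conj f t l : cdrv f t l -> cdrv (fun x => cconj (f x)) t (cconj l).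
Proof. by move=> [h1 h2]; split => //=; exact: drv_opp. Qed.
Lemma cdrv_inv f t l : f t != 0 -> cdrv f t l -> cdrv (fun x => (f x)^-1) t (- l / f t ^+ 2).
Proof.
move=> f0 [h1 h2]; have q0 : csq (f t) != 0 by rewrite csq_eq0.
have hq := drv_inv (fun x => csq (f x)) _ _ q0 (drv_add _ _ _ _ _ (drv_pow _ 2 _ _ h1) (drv_pow _ 2 _ _ h2)).
have E : - l / f t ^+ 2 = - (l * ((f t)^-1 * (f t)^-1)) by rewrite -invfM mulNr -expr2.
split.
  rewrite (_ : (fun x => _) = (fun x => cre (f x) * (csq (f x))^-1)); last by apply/funext => x; rewrite cinvE.
  apply: drv_eq (drv_mul _ _ _ _ _ h1 hq) _; rewrite E cinvE !compE /=.
  by move: q0; rewrite /csq => q0; field.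
rewrite (_ : (fun x => _) = (fun x => - cim (f x) * (csq (f x))^-1)); last by apply/funext => x; rewrite cinvE.
apply: drv_eq (drv_mul _ _ _ _ _ (drv_opp _ _ _ h2) hq) _; rewrite E cinvE !compE /=.
by move: q0; rewrite /csq => q0; field.
Qed.
Lemma cdrv_div f h t l m : h t != 0 -> cdrv f t l -> cdrv h t m ->
  cdrv (fun x => f x / h x) t ((l * h t - f t * m) / h t ^+ 2).
Proof.
move=> h0 hf hh; apply: cdrv_eq (cdrv_mul _ _ _ _ _ hf (cdrv_inv _ _ _ h0 hh)) _.
by field.
Qed.

End complex_paths.

(** * The sense of rotation of a regular path on the unit circle *)

Section circle_orientation.
Context {R : realType}.
Implicit Types (f df p q dp dq : R -> R) (t r a b x y : R).

(** The derivative may be discontinuous. By Rolle's theorem [f] is injective where it does not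
    vanish, hence strictly monotone, which fixes its sign. *)
Lemma derivative_sign f df a b x y : (forall t, is_derive t 1 f (df t)) ->
  (forall t, a < t < b -> df t != 0) -> a < x < b -> a < y < b -> 0 < df x -> 0 < df y.
Proof.
move=> fd nz hx hy dx.
have cf : continuous f by move=> t; exact: drv_cont (fd t).
have inj u v : a < u < b -> a < v < b -> u < v -> f u <> f v.
  move=> hu hv uv fE; have [t|t|c] := @Rolle R f u v uv _ _ fE.
  - by move=> _; case: (fd t).
  - exact: continuous_subspaceT.
  rewrite in_itv/= => /andP[uc cv] hc.
  have := nz c; rewrite -(drv_D1 _ _ _ (fd c)) (drv_D1 _ _ _ hc) eqxx.
  by case/andP: hu => au _; case/andP: hv => _ vb; rewrite (lt_trans au uc) (lt_trans cv vb) => /(_ isT).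
have [] := @itv_continuous_inj_mono R f `]a, b[%R.
- exact: continuous_subspaceT.
- move=> u v; rewrite !in_itv/= => hu hv fE; apply: contrapT => /eqP.
  by rewrite neq_lt => /orP[uv|vu]; [exact: inj uv fE|exact: inj vu (esym fE)].
- move=> mono; rewrite lt_neqAle eq_sym nz//= -(drv_D1 _ _ _ (fd y)).
  apply: (@incr_derive1_ge0_itv R f false true a b) => [t _|u v hu hv|].
  + by case: (fd t).
  + exact: mono.
  + by rewrite in_itv.
- move=> mono; have : df x <= 0.
    rewrite -(drv_D1 _ _ _ (fd x)).
    apply: (@decr_derive1_le0_itv R f false true a b) => [t _|u v hu hv|].
    + by case: (fd t).
    + exact: mono.
    + by rewrite in_itv.
  by rewrite leNgt dx.
Qed.

Lemma real_open_closed (A B : set R) : (forall x, A x -> exists2 e, 0 < e & forall y, `|y - x| < e -> A y) ->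
  (forall x, B x -> exists2 e, 0 < e & forall y, `|y - x| < e -> B y) ->
  (forall x, A x \/ B x) -> (forall x, A x -> ~ B x) -> A 0 -> forall x, A x.
Proof.
have ballP (E : set R) : (forall x, E x -> exists2 e, 0 < e & forall y, `|y - x| < e -> E y) -> open E.
  move=> hE; rewrite openE => x /hE [e e0 he]; apply/nbhs_ballP; exists e => // y /=.
  by rewrite /ball/= distrC; exact: he.
move=> /ballP oA /ballP oB AB nAB A0.
have cR : connected [set: R] by apply/connected_intervalP.
have -> : A = setT; last by [].
apply: cR; first by exists 0.
  by exists A => //; rewrite setTI.
exists (~` B); first exact: open_closedC.
apply/seteqP; split => [x Ax|x [_ nB]]; first by split => //; exact: nAB.
by case: (AB x).
Qed.

(* Near [r], the function [q * p r - p * q r] is the sine of the angle travelled from [r], and its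
   derivative is the angular velocity times the cosine of that angle. *)
Lemma circle_orientation p q dp dq : (forall t, is_derive t 1 p (dp t)) -> (forall t, is_derive t 1 q (dq t)) ->
  (forall t, p t ^+ 2 + q t ^+ 2 = 1) -> (forall t, dp t = 0 -> dq t = 0 -> False) ->
  0 < p 0 * dq 0 - q 0 * dp 0 -> forall r, 0 < p r * dq r - q r * dp r.
Proof.
move=> hp hq pq nz w0.
pose w t := p t * dq t - q t * dp t.
have orth t : p t * dp t + q t * dq t = 0.
  have h := drv_add _ _ _ _ _ (drv_pow _ 2 _ _ (hp t)) (drv_pow _ 2 _ _ (hq t)).
  have h1 : is_derive t 1 (fun x => p x ^+ 2 + q x ^+ 2) 0.
    by rewrite (_ : (fun x => _) = (fun=> 1)); [exact: drv_cst|apply/funext => x; rewrite pq].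
  have := drv_D1 _ _ _ h; rewrite (drv_D1 _ _ _ h1) /= !expr1; lra.
(* The velocity is orthogonal to the radius, so it is the rotated radius times [w]: [w] is the
   angular velocity. *)
have dpE t : dp t = - q t * w t.
  rewrite -[LHS]mulr1 -(pq t) /w.
  have -> : dp t * (p t ^+ 2 + q t ^+ 2) = p t * (p t * dp t + q t * dq t) - q t * (p t * dq t - q t * dp t) by ring.
  by rewrite orth; ring.
have dqE t : dq t = p t * w t.
  rewrite -[LHS]mulr1 -(pq t) /w.
  have -> : dq t * (p t ^+ 2 + q t ^+ 2) = q t * (p t * dp t + q t * dq t) + p t * (p t * dq t - q t * dp t) by ring.
  by rewrite orth; ring.
have wnz t : w t != 0.
  by apply/eqP => wE; apply: (nz t); [rewrite dpE wE mulr0|rewrite dqE wE mulr0].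
have loc r : exists2 e, 0 < e & forall x y, `|x - r| < e -> `|y - r| < e -> 0 < w x -> 0 < w y.
  pose f t := q t * p r - p t * q r.
  pose cs t := p t * p r + q t * q r.
  have fd t : is_derive t 1 f (w t * cs t).
    apply: drv_eq (drv_sub _ _ _ _ _ (drv_mul _ _ _ _ _ (hq t) (drv_cst (p r) t))
      (drv_mul _ _ _ _ _ (hp t) (drv_cst (q r) t))) _.
    by rewrite dpE dqE /cs; ring.
  have ccs : {for r, continuous cs}.
    exact: drv_cont (drv_add _ _ _ _ _ (drv_mul _ _ _ _ _ (hp r) (drv_cst (p r) r))
      (drv_mul _ _ _ _ _ (hq r) (drv_cst (q r) r))).
  have : cs t @[t --> r] --> cs r by exact: ccs.
  have cr : cs r = 1 by rewrite /cs -!expr2 pq.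
  rewrite cr => /cvgrPdist_lt /(_ 1 ltr01) /nbhs_ballP [e /= e0 he].
  have pos t : `|t - r| < e -> 0 < cs t.
    by move=> tr; have := he t; rewrite /ball/= distrC => /(_ tr); rewrite ltr_norml => /andP[_]; lra.
  have itv t : `|t - r| < e -> r - e < t < r + e.
    by rewrite ltr_norml => /andP[h1 h2]; apply/andP; split; lra.
  exists e => // x y hx hy wx.
  have := derivative_sign f (fun t => w t * cs t) (r - e) (r + e) x y fd _ (itv x hx) (itv y hy).
  rewrite !pmulr_lgt0 ?pos//; apply => // t /andP[t1 t2].
  by rewrite mulf_neq0// gt_eqF// pos// ltr_norml; apply/andP; split; lra.
have self x e : 0 < e -> `|x - x| < e by rewrite subrr normr0.
apply: (real_open_closed [set t | 0 < w t] [set t | w t < 0]) => //.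
- move=> x wx; have [e e0 he] := loc x; exists e => // y xy; apply: he wx => //; exact: self.
- move=> x /= wx; have [e e0 he] := loc x; exists e => // y xy.
  have := wnz y; rewrite /= neq_lt => /orP[//|wy].
  by have := he y x xy (self x e e0) wy; rewrite ltNge (ltW wx).
- by move=> x; apply/orP; rewrite orbC -neq_lt.
- by move=> x /= w1 w2; move: (lt_trans w1 w2); rewrite ltxx.
Qed.

End circle_orientation.

(** * Conics of null vectors, and directions carried along them *)

Section conic.
Context {R : realType}.
Implicit Types (z w A B al be ga kap : R[i]).

(** The triple is a complex multiple of [(1, lam, lam^2)] with [lam] real, or of [(0, 0, 1)]; the
    last hypothesis excludes zero. Then [(cs, sn)] is the stereographic image of [lam] on the unit
    circle, which includes the case [al = 0] as the point [(-1, 0)]. *)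
Lemma conic_angle al be ga kap mm : al * cconj ga = cconj al * ga -> al * cconj be = cconj al * be ->
  2 * (be * cconj be) = al * cconj ga + cconj al * ga -> al + kap * be + mm * ga = 1 ->
  let cs := cre ((al - ga) / (al + ga)) in let sn := cre (2 * be / (al + ga)) in
  [/\ al + ga != 0, al - ga = (al + ga) * rC cs, 2 * be = (al + ga) * rC sn & cs ^+ 2 + sn ^+ 2 = 1 :> R].
Proof.
move=> h1 h2 h3 h4 cs sn.
have two0 : (2 : R[i]) != 0 by rewrite pnatr_eq0.
have [a0|a0] := eqVneq al 0.
  have b0 : be = 0.
    move: h3; rewrite a0 cconj0 !mul0r addr0.
    by move/eqP; rewrite !mulf_eq0 (negbTE two0) cconj_eq0 orbb /= => /eqP.
  have g0 : ga != 0.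
    by apply/eqP => g0; move: h4; rewrite a0 b0 g0 !mulr0 !addr0 => /eqP; rewrite eq_sym oner_eq0.
  rewrite /cs /sn a0 b0 sub0r add0r mulNr divff// mulr0 mul0r; split => //.
  - by rewrite creN rCN [cre 1]/= rC1 mulrN1.
  - by rewrite [cre 0]/= rC0 !mulr0.
  - by rewrite /=; ring.
have ca0 : cconj al != 0 by rewrite cconj_eq0.
pose lam := cre (be / al).
have bE : be = al * rC lam.
  rewrite -rC_conj; first by field.
  have : cconj be = cconj al * be / al by rewrite -h2; field.
  move=> e; rewrite cconjM e.
  rewrite cconjV.
  by field; rewrite a0 ca0.
have gE : ga = al * rC (lam ^+ 2).
  have : 2 * (cconj al * ga) = 2 * (cconj al * (al * rC (lam ^+ 2))).
    rewrite mulr_natl mulr2n -{1}h1 -h3 bE cconjM cconj_rC expr2 rCM; ring.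
  by move=> /(mulfI two0) /(mulfI ca0).
have d0 : 1 + lam ^+ 2 != 0 by rewrite gt_eqF// ltr_wpDr// sqr_ge0.
have sE : al + ga = al * rC (1 + lam ^+ 2) by rewrite gE rCD rC1; ring.
have s0 : al + ga != 0 by rewrite sE mulf_neq0 ?rC_eq0.
have csE : (al - ga) / (al + ga) = rC ((1 - lam ^+ 2) / (1 + lam ^+ 2)).
  move: d0 sE; rewrite gE; move: (lam ^+ 2) => q; rewrite -rC_eq0 => d0 ->.
  by rewrite rCM rCV; move: d0; rewrite !rCD rCN rC1 => d0; field; rewrite a0 d0.
have snE : 2 * be / (al + ga) = rC (2 * lam / (1 + lam ^+ 2)).
  move: d0 sE; rewrite bE; move: (lam ^+ 2) => q; rewrite -rC_eq0 => d0 ->.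
  by rewrite !rCM rCV rC2; move: d0; rewrite !rCD rC1 => d0; field; rewrite a0 d0.
have e1 : rC cs = (al - ga) / (al + ga) by rewrite /cs csE.
have e2 : rC sn = 2 * be / (al + ga) by rewrite /sn snE.
split => //.
- by rewrite e1; field.
- by rewrite e2; field.
- by rewrite /cs csE /sn snE /=; field.
Qed.

End conic.

(* A curve on an [R]-circle through the origin and a point, in the coordinates [ze = z] and
   [B = |z|^2 + 4iu]; the point has coordinates [(w, A)]. *)
Section direction_transport.
Context {R : realType}.
Variables (w A : R[i]).
Hypotheses (A0 : A != 0) (AE : A + cconj A = 2 * (w * cconj w)).

Local Notation A' := (cconj A).
Local Notation w' := (cconj w).
(** With [B], the values [conic_al] and [conic_be] are the coordinates of the lift
    [(- B / 2, ze, 1)] in the basis [(0, 0, 1)], [(0, 1, kap)], [(- 1 / 2, w / A, 1 / A)]: the lift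
    of the origin, a vector for the direction, and the lift of the other point divided by [A]. The
    relation [conic_third] is the last entry of this expansion. *)
Definition conic_al (ze B : R[i]) := (B + A' - 2 * ze * w') / A'.
Definition conic_be (ze B : R[i]) := ze - w * B / A.
Definition conic_kap := 2 * w' / A'.
Local Notation al := conic_al.
Local Notation be := conic_be.
Local Notation kap := conic_kap.

Let A'0 : A' != 0. Proof. by rewrite cconj_eq0. Qed.
Let A'E : A' = 2 * (w * w') - A. Proof. by rewrite -AE; ring. Qed.

Lemma conic_third ze B : al ze B + kap * be ze B + A^-1 * B = 1.
Proof.
rewrite /al /kap /be.
have -> : (B + A' - 2 * ze * w') / A' + 2 * w' / A' * (ze - w * B / A) + A^-1 * B =
  1 + B * (A + A' - 2 * (w * w')) / (A * A') by field; rewrite ?A0 ?A'0.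
by rewrite AE subrr mulr0 mul0r addr0.
Qed.

Lemma conic_null ze B : B + cconj B = 2 * (ze * cconj ze) ->
  2 * (be ze B * cconj (be ze B)) = al ze B * cconj B + cconj (al ze B) * B.
Proof.
move=> BE; rewrite /be /al !conjE.
have -> : 2 * ((ze - w * B / A) * (cconj ze - w' * cconj B / A')) =
  2 * (ze * cconj ze) + (- 2 * ze * w' * cconj B * A - 2 * cconj ze * w * B * A') / (A * A')
  + 2 * (w * w') * (B * cconj B) / (A * A') by field; rewrite ?A0 ?A'0.
by rewrite -BE -AE; field; rewrite ?A0 ?A'0.
Qed.

(** By [conic_angle] the path becomes a point on the unit circle going from [(1, 0)] to [(-1, 0)]. A
    stationary angle would force a stationary path, so the rotation keeps its initial sense. At the
    arrival [sn] decreases, and [dze r = - dsn A^2 / (2 conj A)] is a positive multiple of [A^3]. *)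
Lemma direction_transport (ze B dze dB : R -> R[i]) (k r : R) :
  (forall t, cdrv ze t (dze t)) -> (forall t, cdrv B t (dB t)) ->
  (forall t, B t + cconj (B t) = 2 * (ze t * cconj (ze t))) ->
  (forall t, al (ze t) (B t) * cconj (B t) = cconj (al (ze t) (B t)) * B t) ->
  (forall t, al (ze t) (B t) * cconj (be (ze t) (B t)) = cconj (al (ze t) (B t)) * be (ze t) (B t)) ->
  (forall t, dze t = 0 -> dB t = 0 -> False) ->
  ze 0 = 0 -> B 0 = 0 -> 0 < k -> dze 0 = rC k -> dB 0 = 0 -> ze r = w -> B r = A ->
  exists2 rho : R, 0 < rho & dze r = rC rho * A ^+ 3.
Proof.
move=> hze hB BE r1 r2 nz ze0 B0 k0 dze0 dB0 zer Br.
pose a t := al (ze t) (B t); pose b t := be (ze t) (B t).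
pose da t := (dB t - 2 * dze t * w') / A'; pose db t := dze t - w * dB t / A.
have ha t : cdrv a t (da t).
  have h := cdrv_add _ _ _ _ _ (hB t) (cdrv_cst A' t).
  have h' := cdrv_sub _ _ _ _ _ h (cdrv_mul _ _ _ _ _ (cdrv_scale 2 _ _ _ (hze t)) (cdrv_cst w' t)).
  by apply: cdrv_eq (cdrv_mul _ _ _ _ _ h' (cdrv_cst A'^-1 t)) _; rewrite /da; field.
have hb t : cdrv b t (db t).
  have h := cdrv_mul _ _ _ _ _ (cdrv_scale w _ _ _ (hB t)) (cdrv_cst A^-1 t).
  by apply: cdrv_eq (cdrv_sub _ _ _ _ _ (hze t) h) _; rewrite /db; field.
have CA t := conic_angle (a t) (b t) (B t) kap A^-1 (r1 t) (r2 t) (conic_null _ _ (BE t)) (conic_third _ _).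
pose cs t := cre ((a t - B t) / (a t + B t)); pose sn t := cre (2 * b t / (a t + B t)).
have s0 t : a t + B t != 0 by case: (CA t).
have hs t := cdrv_add _ _ _ _ _ (ha t) (hB t).
pose dcs t := cre (((da t - dB t) * (a t + B t) - (a t - B t) * (da t + dB t)) / (a t + B t) ^+ 2).
pose dsn t := cre ((2 * db t * (a t + B t) - 2 * b t * (da t + dB t)) / (a t + B t) ^+ 2).
have hcs (t : R) : is_derive t 1 (cs : R -> R) (dcs t).
  by case: (cdrv_div _ _ _ _ _ (s0 t) (cdrv_sub _ _ _ _ _ (ha t) (hB t)) (hs t)).
have hsn (t : R) : is_derive t 1 (sn : R -> R) (dsn t).
  by case: (cdrv_div _ _ _ _ _ (s0 t) (cdrv_scale 2 _ _ _ (hb t)) (hs t)).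
have E1 t : da t - dB t = (da t + dB t) * rC (cs t) + (a t + B t) * rC (dcs t).
  apply: (cdrv_uniq _ _ _ _ (cdrv_sub _ _ _ _ _ (ha t) (hB t))).
  have -> : (fun t => a t - B t) = (fun t => (a t + B t) * rC (cs t)).
    by apply/funext => x; case: (CA x).
  by apply: cdrv_mul (hs t) _; apply: cdrv_rC; exact: hcs.
have E2 t : 2 * db t = (da t + dB t) * rC (sn t) + (a t + B t) * rC (dsn t).
  apply: (cdrv_uniq _ _ _ _ (cdrv_scale 2 _ _ _ (hb t))).
  have -> : (fun t => 2 * b t) = (fun t => (a t + B t) * rC (sn t)).
    by apply/funext => x; case: (CA x).
  by apply: cdrv_mul (hs t) _; apply: cdrv_rC; exact: hsn.
have E3 t : da t + kap * db t + A^-1 * dB t = 0.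
  rewrite /da /db /kap.
  have -> : (dB t - 2 * dze t * w') / A' + 2 * w' / A' * (dze t - w * dB t / A) + A^-1 * dB t =
    dB t * (A + A' - 2 * (w * w')) / (A * A') by field; rewrite ?A0 ?A'0.
  by rewrite AE subrr mulr0 mul0r.
have two0 : (2 : R[i]) != 0 by rewrite pnatr_eq0.
have daE t : 2 * da t = (da t + dB t) * (1 + rC (cs t)) + (a t + B t) * rC (dcs t).
  by rewrite mulrDr mulr1 -addrA -E1; ring.
have dBE t : 2 * dB t = (da t + dB t) * (1 - rC (cs t)) - (a t + B t) * rC (dcs t).
  by rewrite mulrBr mulr1 -addrA -opprD -E1; ring.
have aE t : 2 * a t = (a t + B t) * (1 + rC (cs t)).
  by case: (CA t) => _ e _ _; rewrite mulrDr mulr1 -e; ring.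
have bE t : 2 * b t = (a t + B t) * rC (sn t) by case: (CA t).
have BBE t : 2 * B t = (a t + B t) * (1 - rC (cs t)).
  by case: (CA t) => _ e _ _; rewrite mulrBr mulr1 -e; ring.
(* In terms of the angle, twice the coordinates are [a + B] times [1 + cs], [sn] and [1 - cs]; the
   normalization [conic_third] then reads [(a + B) U = 2]. *)
pose U t := 1 + rC (cs t) + kap * rC (sn t) + A^-1 * (1 - rC (cs t)).
have UE t : (a t + B t) * U t = 2.
  have -> : (a t + B t) * U t = (a t + B t) * (1 + rC (cs t)) + kap * ((a t + B t) * rC (sn t)) +
    A^-1 * ((a t + B t) * (1 - rC (cs t))) by rewrite /U; ring.
  by rewrite -aE -bE -BBE -[RHS]mulr1 -(conic_third (ze t) (B t)) -/(a t) -/(b t); ring.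
have dUE t : (da t + dB t) * U t + (a t + B t) * (rC (dcs t) + kap * rC (dsn t) - A^-1 * rC (dcs t)) = 0.
  have -> : (da t + dB t) * U t + (a t + B t) * (rC (dcs t) + kap * rC (dsn t) - A^-1 * rC (dcs t)) =
    ((da t + dB t) * (1 + rC (cs t)) + (a t + B t) * rC (dcs t)) +
    kap * ((da t + dB t) * rC (sn t) + (a t + B t) * rC (dsn t)) +
    A^-1 * ((da t + dB t) * (1 - rC (cs t)) - (a t + B t) * rC (dcs t)) by rewrite /U; ring.
  by rewrite -daE -E2 -dBE -[RHS](mulr0 2) -(E3 t); ring.
have U0 t : U t != 0.
  by apply/eqP => u0; move: (UE t); rewrite u0 mulr0 => /eqP; rewrite eq_sym (negbTE two0).
have csn t : cs t ^+ 2 + sn t ^+ 2 = 1 by case: (CA t).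
(* If the angle is stationary, so is [a + B] by [dUE], hence [B], [b] and finally [ze]. *)
have spd t : dcs t = 0 -> dsn t = 0 -> False.
  move=> e1 e2; have := dUE t; rewrite e1 e2 rC0 !mulr0 subr0 addr0 mulr0 addr0.
  move/eqP; rewrite mulf_eq0 (negbTE (U0 t)) orbF => /eqP dm0.
  have dB0' : dB t = 0.
    by apply: (mulfI two0); rewrite dBE dm0 e1 rC0 mul0r mulr0 subr0 mulr0.
  apply: (nz t) => //.
  by apply: (mulfI two0); move: (E2 t); rewrite dm0 /db dB0' e2 rC0 mul0r !mulr0 mul0r subr0 addr0.
have a0E : a 0 = 1 by rewrite /a /al ze0 B0 add0r mulr0 mul0r subr0 divff.
have cs0 : cs 0 = 1 by rewrite /cs a0E B0 subr0 addr0 divr1.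
have sn0 : sn 0 = 0 by rewrite /sn /b /be ze0 B0 mulr0 mul0r subr0 mulr0 mul0r.
have dsn0 : dsn 0 = 2 * k.
  move: (E2 0); rewrite /db dze0 dB0 mulr0 mul0r subr0 sn0 rC0 mulr0 add0r a0E B0 addr0 mul1r => e.
  by apply: rC_inj; rewrite -e rCM rC2.
have W := circle_orientation cs sn dcs dsn hcs hsn csn spd.
have {W} := W _ r; rewrite cs0 sn0 dsn0 mul0r subr0 mul1r mulr_gt0// => /(_ isT).
have ar : a r = 0.
  by rewrite /a /al zer Br AE -mulrA subrr mul0r.
have br : b r = 0 by rewrite /b /be zer Br mulfK// subrr.
have csr : cs r = -1 by rewrite /cs ar Br sub0r add0r mulNr divff.
have snr : sn r = 0 by rewrite /sn br mulr0 mul0r.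
have dcsr : dcs r = 0.
  have h := drv_add _ _ _ _ _ (drv_pow _ 2 _ _ (hcs r)) (drv_pow _ 2 _ _ (hsn r)).
  have h1 : is_derive r 1 (fun x => cs x ^+ 2 + sn x ^+ 2) 0.
    by rewrite (_ : (fun x => _) = (fun=> 1)); [exact: drv_cst|apply/funext => x; rewrite csn].
  by have := drv_D1 _ _ _ h; rewrite (drv_D1 _ _ _ h1) csr snr /=; lra.
rewrite csr snr mul0r subr0 mulN1r oppr_gt0 => ds0.
exists (- dsn r / (2 * csq A)).
  by rewrite divr_gt0 ?oppr_gt0// mulr_gt0// csq_gt0.
have rC1' : rC (-1 : R) = -1 by rewrite rCN rC1.
have Ur : U r = 2 / A by rewrite /U csr snr rC0 rC1'; field.
have dm : da r + dB r = - (A ^+ 2 * kap * rC (dsn r)) / 2.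
  have := dUE r; rewrite Ur dcsr rC0 ar Br add0r mulr0 subr0 add0r => e.
  apply: (mulIf (x := 2 / A)); first by rewrite mulf_neq0 ?invr_eq0.
  by apply/eqP; rewrite -subr_eq0 -e; apply/eqP; field; rewrite A0.
have dBr : dB r = da r + dB r.
  by apply: (mulfI two0); rewrite dBE csr dcsr rC0 rC1'; ring.
have dbr : 2 * db r = A * rC (dsn r).
  by rewrite E2 snr rC0 mulr0 add0r ar Br add0r.
have -> : dze r = db r + w * dB r / A by rewrite /db; ring.
apply: (mulfI two0); rewrite mulrDr dbr dBr dm.
rewrite rCM rCV rCM -mul_cconj rCN rC2.
rewrite /kap.
have -> : A * rC (dsn r) + 2 * (w * (- (A ^+ 2 * (2 * w' / A') * rC (dsn r)) / 2) / A) =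
  A * rC (dsn r) * (A' - 2 * (w * w')) / A' by field; rewrite ?A0 ?A'0.
by rewrite -AE; field; rewrite ?A0 ?A'0.
Qed.

End direction_transport.

(** * Triple products and the tangent of an arbitrary path on an R-circle *)

Section rcircles.
Context {R : realType}.
Implicit Types (Z W : C3 R) (p q c d : hpt R) (S : set (hpt R)) (T : R[i]).

Lemma herm_scale (a b : R[i]) Z W : herm (c3scale a Z) (c3scale b W) = a * cconj b * herm Z W.
Proof. by rewrite /herm /c3scale /= !conjE; ring. Qed.

(** The triple Hermitian product, whose argument is Cartan's angular invariant, is real for vectors
    of a totally real subspace. Rescaling the lifts multiplies it by a positive real number. *)
Lemma rcircle_triple S p q c : rcircle S -> S p -> S q -> S c ->
  let X := herm (phi p) (phi q) * herm (phi q) (phi c) * herm (phi c) (phi p) in X = cconj X.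
Proof.
move=> [w1 [w2 [w3 [_ real _ ->]]]] [l1 [n1 [a1 [b1 [c1 e1]]]]] [l2 [n2 [a2 [b2 [c2 e2]]]]]
  [l3 [n3 [a3 [b3 [c3 e3]]]]] X.
have h12 := rC_real _ (real a1 b1 c1 a2 b2 c2).
have h23 := rC_real _ (real a2 b2 c2 a3 b3 c3).
have h31 := rC_real _ (real a3 b3 c3 a1 b1 c1).
rewrite -e1 -e2 herm_scale in h12; rewrite -e2 -e3 herm_scale in h23.
rewrite -e3 -e1 herm_scale in h31.
have n0 : l1 * cconj l1 * (l2 * cconj l2) * (l3 * cconj l3) != 0.
  by rewrite !mulf_neq0 ?cconj_eq0.
have E : l1 * cconj l1 * (l2 * cconj l2) * (l3 * cconj l3) * X =
  (l1 * cconj l2 * herm (phi p) (phi q)) * (l2 * cconj l3 * herm (phi q) (phi c)) *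
  (l3 * cconj l1 * herm (phi c) (phi p)) by rewrite /X; ring.
apply: (mulfI n0); rewrite [LHS]E h12 h23 h31 -!rCM -[LHS]cconj_rC !rCM -h12 -h23 -h31 -E.
by rewrite !conjE; ring.
Qed.

(* The coordinates of [q^-1 * c], rotated so that the horizontal direction [T] becomes [1]. *)
Definition hz c : R[i] := Complex (hx c) (hy c).
Definition rel_z q T c : R[i] := cconj T * (hz c - hz q).
Definition rel_B q c : R[i] := Complex ((hx c - hx q) ^+ 2 + (hy c - hy q) ^+ 2)
  (4 * (hu c - hu q - 2^-1 * (hx q * hy c - hy q * hx c))).

Lemma rel_z_norm q T c d : T * cconj T = 1 ->
  rel_z q T c * cconj (rel_z q T d) = (hz c - hz q) * cconj (hz d - hz q).
Proof.
move=> T1; rewrite /rel_z cconjM cconjK.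
transitivity (T * cconj T * ((hz c - hz q) * cconj (hz d - hz q))); first by ring.
by rewrite T1 mul1r.
Qed.

Lemma rel_B_sum q T c : T * cconj T = 1 ->
  rel_B q c + cconj (rel_B q c) = 2 * (rel_z q T c * cconj (rel_z q T c)).
Proof.
move=> T1; rewrite rel_z_norm// mul_cconj -rC2 -rCM.
by apply: complex_eq; rewrite ?compE /= /csq ?compE /=; ring.
Qed.

(** Translation by [q] and rotation by [T] act unitarily, so [phi c] may be replaced by the vector
    [(- rel_B / 2, rel_z, 1)]. *)
Lemma herm_phi q T c d : T * cconj T = 1 ->
  herm (phi c) (phi d) = - (rel_B q c + cconj (rel_B q d)) / 2 + rel_z q T c * cconj (rel_z q T d).
Proof.
move=> T1; rewrite rel_z_norm//.
have two0 : (2 : R[i]) != 0 by rewrite pnatr_eq0.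
apply: (mulfI two0); transitivity (- (rel_B q c + cconj (rel_B q d)) + 2 * ((hz c - hz q) * cconj (hz d - hz q)));
  last by field.
rewrite -rC2; apply: complex_eq; by rewrite /herm !compE /=; field.
Qed.

Lemma rel_z0 q T : rel_z q T q = 0. Proof. by rewrite /rel_z subrr mulr0. Qed.
Lemma rel_B0 q : rel_B q q = 0. Proof. by apply: complex_eq; rewrite /=; ring. Qed.

Lemma rel_B_eq0 p q : rel_B q p = 0 -> p = q.
Proof.
case: p => [[px py] pu]; case: q => [[qx qy] qu].
rewrite /rel_B /hx /hy /hu /= => -[/eqP].
rewrite paddr_eq0 ?sqr_ge0// !sqrf_eq0 !subr_eq0 => /andP[/eqP -> /eqP ->] h.
by congr (_, _); lra.
Qed.

(** The expression [y] is the derivative of a triple product in which one point leaves the origin in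
    the direction [rC k]. Its imaginary part, reduced by the relation between [a] and [b], is the
    reality of [a] times the conjugate of [conic_be]. *)
Lemma tangency_real (w A a b z : R[i]) (k : R) : A != 0 -> k != 0 -> 
  let y := - cconj A / 2 * a * (- (0 + cconj 0) / 2 + - (A + cconj 0) * 0 + w * cconj (rC k)) *
     (- (0 + cconj b) / 2 + 0 * cconj z) + - cconj A / 2 * a * (- (A + cconj 0) / 2 + w * cconj 0) *
       (- (0 + 0) / 2 + - (0 + cconj b) * 0 + (rC k * cconj z + 0 * 0)) in
  cconj y = y -> a * cconj b = cconj a * b -> a * cconj (z - w * b / A) = cconj a * (z - w * b / A).
Proof.
move=> A0 k0; rewrite /= !conjE => e2 e1; have A'0 : cconj A != 0 by rewrite cconj_eq0.
have k0' : rC k != 0 by rewrite rC_eq0.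
have e3 : rC k / 4 * (cconj A * a * (w * cconj b + A * cconj z) - A * cconj a * (cconj w * b + cconj A * z)) = 0.
  apply/eqP; move/eqP: e2; rewrite -subr_eq0 => /eqP e2; rewrite -[X in _ == X]oppr0 -[in X in _ == X]e2.
  by apply/eqP; field.
move/eqP: e3; rewrite mulf_eq0 mulf_eq0 (negbTE k0') invr_eq0 pnatr_eq0 /= => /eqP e3.
have n0 : A * cconj A != 0 by rewrite mulf_neq0.
apply: (mulfI n0); apply/eqP; rewrite -subr_eq0.
have -> : A * cconj A * (a * (cconj z - cconj w * cconj b / cconj A)) - A * cconj A * (cconj a * (z - w * b / A)) =
    (cconj A * a * (w * cconj b + A * cconj z) - A * cconj a * (cconj w * b + cconj A * z)) -
    (A * cconj w + cconj A * w) * (a * cconj b - cconj a * b) by field; rewrite ?A0 ?A'0.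
by rewrite e3 e1 subrr mulr0 subrr.
Qed.

(** Triple products replace an explicit description of the circle: the triple of [c t], [p] and [q]
    gives the first reality condition of [direction_transport], and the second is infinitesimal,
    obtained by letting a third point of the path leave [q]. *)
Lemma rcircle_direction S (c : R -> hpt R) p q T k r : T * cconj T = 1 -> p <> q ->
  rcircle S -> S p -> S q -> regular_path_in S c -> c 0 = q -> 0 < k ->
  (D1 (cx c) 0, D1 (cy c) 0, D1 (cu c) 0) =
    (k * cre T, k * cim T, k * (2^-1 * (hx q * cim T - hy q * cre T))) ->
  c r = p ->
  exists2 rho : R, 0 < rho & Complex (D1 (cx c) r) (D1 (cy c) r) = rC rho * (T * rel_B q p ^+ 3).
Proof.
move=> T1 pq cS Sp Sq [cinS cd creg] c0 k0 [dx0 dy0 du0] cr.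
set A := rel_B q p; pose w := rel_z q T p.
have A0 : A != 0 by apply/eqP => /rel_B_eq0.
have AE : A + cconj A = 2 * (w * cconj w) by exact: rel_B_sum.
have A'0 : cconj A != 0 by rewrite cconj_eq0.
pose ze t := rel_z q T (c t); pose B t := rel_B q (c t).
pose dz t := Complex (D1 (cx c) t) (D1 (cy c) t).
pose dze t := cconj T * dz t.
pose dB t := Complex (2 * (hx (c t) - hx q) * D1 (cx c) t + 2 * (hy (c t) - hy q) * D1 (cy c) t)
  (4 * (D1 (cu c) t - 2^-1 * (hx q * D1 (cy c) t - hy q * D1 (cx c) t))).
have [dx dy du] := all_and3 cd.
have hx' (t : R) : is_derive t 1 (fun t => hx (c t)) (D1 (cx c) t) := D1_drv (cx c) t (dx t).
have hy' (t : R) : is_derive t 1 (fun t => hy (c t)) (D1 (cy c) t) := D1_drv (cy c) t (dy t).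
have hu' (t : R) : is_derive t 1 (fun t => hu (c t)) (D1 (cu c) t) := D1_drv (cu c) t (du t).
have dzE t : cdrv (fun t => hz (c t)) t (dz t) by split => /=.
have hze t : cdrv ze t (dze t).
  by apply: cdrv_eq (cdrv_scale _ _ _ _ (cdrv_sub _ _ _ _ _ (dzE t) (cdrv_cst (hz q) t))) _; rewrite subr0.
have hB t : cdrv B t (dB t).
  split => /=.
    apply: drv_eq (drv_add _ _ _ _ _ (drv_pow _ 2 _ _ (drv_sub _ _ _ _ _ (hx' t) (drv_cst (hx q) t)))
      (drv_pow _ 2 _ _ (drv_sub _ _ _ _ _ (hy' t) (drv_cst (hy q) t)))) _.
    by rewrite /= !expr1 !subr0.
  apply: drv_eq (drv_scale 4 _ _ _ (drv_sub _ _ _ _ _ (drv_sub _ _ _ _ _ (hu' t) (drv_cst (hu q) t))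
    (drv_scale 2^-1 _ _ _ (drv_sub _ _ _ _ _ (drv_scale (hx q) _ _ _ (hy' t)) (drv_scale (hy q) _ _ _ (hx' t)))))) _.
  by rewrite subr0.
have ze0 : ze 0 = 0 by rewrite /ze c0 rel_z0.
have B0 : B 0 = 0 by rewrite /B c0 rel_B0.
have dze0 : dze 0 = rC k.
  have -> : dze 0 = rC k * (T * cconj T).
    rewrite /dze /dz dx0 dy0 -[in RHS](complex_eta T).
    by apply: complex_eq; rewrite ?compE /= ?compE /=; ring.
  by rewrite T1 mulr1.
have dB0 : dB 0 = 0 by apply: complex_eq; rewrite /= ?c0 ?dx0 ?dy0 ?du0; ring.
have two0 : (2 : R[i]) != 0 by rewrite pnatr_eq0.
have BE t : B t + cconj (B t) = 2 * (ze t * cconj (ze t)) by exact: rel_B_sum.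
have hcp t : herm (phi (c t)) (phi p) = - cconj A / 2 * conic_al w A (ze t) (B t).
  by rewrite (herm_phi q T)// -/(ze t) -/(B t) -/w -/A /conic_al; field.
have r1 t : conic_al w A (ze t) (B t) * cconj (B t) = cconj (conic_al w A (ze t) (B t)) * B t.
  have := rcircle_triple S (c t) p q cS (cinS t) Sp Sq; rewrite /= hcp (herm_phi q T p q)//.
  rewrite (herm_phi q T q)// rel_z0 rel_B0 cconj0 !mulr0 mul0r !addr0 add0r -/A -/(B t).
  move: (conic_al _ _ _ _) => a; rewrite !conjE => h.
  have n0 : - (A * cconj A) / 8 != 0 by rewrite mulf_neq0 ?oppr_eq0 ?mulf_neq0// invr_eq0 pnatr_eq0.
  apply: (mulfI n0); transitivity (- cconj A / 2 * a * (- A / 2) * (- cconj (B t) / 2)); first by field.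
  by rewrite h; field.
have r2 t : conic_al w A (ze t) (B t) * cconj (conic_be w A (ze t) (B t)) =
    cconj (conic_al w A (ze t) (B t)) * conic_be w A (ze t) (B t).
  (* The triple of [c t], [p] and [c t'] is real for all [t'], hence so is its derivative at
     [t' = 0], where [c t'] leaves [q] in the direction [T]. *)
  pose Y t' := herm (phi (c t)) (phi p) * herm (phi p) (phi (c t')) * herm (phi (c t')) (phi (c t)).
  have YE : Y = fun t' => herm (phi (c t)) (phi p) * (- (A + cconj (B t')) * 2^-1 + w * cconj (ze t')) *
       (- (B t' + cconj (B t)) * 2^-1 + ze t' * cconj (ze t)).
    apply/funext => t'; rewrite /Y (herm_phi q T p)// (herm_phi q T (c t') (c t))//.
  have Y0 : (fun t' => cim (Y t')) = (fun=> 0).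
    by apply/funext => t'; exact: cim_conj (rcircle_triple S _ _ _ cS (cinS t) Sp (cinS t')).
  have c1 := cdrv_mul _ _ _ _ _ (cdrv_opp _ _ _ (cdrv_add _ _ _ _ _ (cdrv_cst A 0) (cdrv_conj _ _ _ (hB 0)))) (cdrv_cst 2^-1 0).
  have c2 := cdrv_scale w _ _ _ (cdrv_conj _ _ _ (hze 0)).
  have c3 := cdrv_mul _ _ _ _ _ (cdrv_opp _ _ _ (cdrv_add _ _ _ _ _ (hB 0) (cdrv_cst (cconj (B t)) 0))) (cdrv_cst 2^-1 0).
  have c4 := cdrv_mul _ _ _ _ _ (hze 0) (cdrv_cst (cconj (ze t)) 0).
  have [_ +] := cdrv_mul _ _ _ _ _ (cdrv_scale (herm (phi (c t)) (phi p)) _ _ _ (cdrv_add _ _ _ _ _ c1 c2)) (cdrv_add _ _ _ _ _ c3 c4).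
  move: YE => /(congr1 (fun F : R -> R[i] => fun t' => cim (F t'))); rewrite Y0 => <- hd.
  have := drv_D1 _ _ _ hd; rewrite (drv_D1 _ _ _ (drv_cst 0 0)) => /esym /cconj_real.
  rewrite ze0 B0 dze0 dB0 hcp => e.
  exact: (tangency_real w A _ (B t) (ze t) k A0 (lt0r_neq0 k0) e (r1 t)).
have T0 : cconj T != 0.
  by apply/eqP => T0; move/eqP: T1; rewrite T0 mulr0 eq_sym oner_eq0.
have nz t : dze t = 0 -> dB t = 0 -> False.
  move=> /eqP; rewrite mulf_eq0 (negbTE T0) /= => /eqP [e1 e2] [_].
  rewrite e1 e2 => e3; have /eqP := creg t; rewrite e1 e2; apply.
  by congr (_, _); lra.
have zer : ze r = w by rewrite /ze cr.
have Br : B r = A by rewrite /B cr.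
have [rho rho0 e] := direction_transport w A A0 AE ze B dze dB k r hze hB BE r1 r2 nz ze0 B0 k0 dze0 dB0 zer Br.
exists rho => //; rewrite -/(dz r) -[LHS]mul1r -T1 -mulrA -/(dze r) e; ring.
Qed.

End rcircles.

(** * Construction of an R-circle through two points with given tangent *)

Section rcircle_existence.
Context {R : realType}.
Variables (p q : hpt R) (T w A : R[i]).
Hypotheses (T1 : T * cconj T = 1) (pq : p <> q) (wE : rel_z q T p = w) (BE : rel_B q p = A).
Implicit Types (Z W : C3 R) (a b c x : R) (rho : R).

(** The unitary map that rotates by [T] and then translates the origin to [q]. *)
Definition frame Z : C3 R :=
  ((Z.1.1 - cconj (hz q) * T * Z.1.2 + (phi q).1.1 * Z.2, T * Z.1.2 + hz q * Z.2), Z.2).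

Lemma frame_herm Z W : herm (frame Z) (frame W) = herm Z W.
Proof.
have E : (phi q).1.1 = - (hz q * cconj (hz q)) - cconj (phi q).1.1.
  by apply: complex_eq; rewrite ?compE /= ?compE /=; field.
have -> : herm (frame Z) (frame W) = herm Z W + Z.2 * cconj W.2 * ((phi q).1.1 + hz q * cconj (hz q) + cconj (phi q).1.1)
  + (T * cconj T - 1) * Z.1.2 * cconj W.1.2.
  by rewrite /herm /frame /= !conjE; ring.
by rewrite T1 {1}E; ring.
Qed.

Local Notation kap := (conic_kap w A).

Let A0 : A != 0. Proof. by rewrite -BE; apply/eqP => /rel_B_eq0. Qed.
Let A'0 : cconj A != 0. Proof. by rewrite cconj_eq0. Qed.
Let AE : A + cconj A = 2 * (w * cconj w). Proof. by rewrite -BE -wE; exact: rel_B_sum. Qed.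
Let T0 : T != 0. Proof. by apply/eqP => T0; move/eqP: T1; rewrite T0 mul0r eq_sym oner_eq0. Qed.
Let two0 : (2 : R[i]) != 0. Proof. by rewrite pnatr_eq0. Qed.

(** [w1] is the lift of [q], [w3] the lift of [p] divided by [A], and [w2] has the direction [T] at
    [q]. With the last entry [kap] of [w2] the Gram matrix becomes real, as computed in
    [frame_real]. *)
Definition w1 := frame ((0, 0), 1).
Definition w2 := frame ((0, 1), kap).
Definition w3 := frame ((- 2^-1, w / A), A^-1).

Lemma comb_frame (a b c : R[i]) :
  c3comb a b c w1 w2 w3 = frame ((- c / 2, b + c * (w / A)), a + b * kap + c / A).
Proof.
rewrite /c3comb /c3add /c3scale /w1 /w2 /w3 /frame /=.
by congr (_, _, _); move: (A^-1) => Ai; move: (2^-1 : R[i]) => h; ring.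
Qed.

Lemma frame_real a b c a' b' c' :
  herm (c3comb (rC a) (rC b) (rC c) w1 w2 w3) (c3comb (rC a') (rC b') (rC c') w1 w2 w3) =
  rC (b * b' - (a * c' + c * a') / 2).
Proof.
rewrite !comb_frame frame_herm /herm /= /conic_kap !conjE.
rewrite rCD rCN !rCM rCV rC2 rCD !rCM.
move: (rC a) (rC b) (rC c) (rC a') (rC b') (rC c') => {}a {}b {}c {}a' {}b' {}c'.
transitivity (b * b' - (a * c' + c * a') / 2 - c * c' / (2 * A * cconj A) * (A + cconj A - 2 * (w * cconj w))).
  by field; rewrite ?A0 ?A'0.
by rewrite AE subrr mulr0 subr0.
Qed.

Definition through : set (hpt R) := [set p | exists lam : R[i], lam != 0 /\
  exists a b c : R, c3scale lam (phi p) = c3comb (rC a) (rC b) (rC c) w1 w2 w3].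

Lemma rcircle_through : rcircle through.
Proof.
exists w1, w2, w3; split => //.
- move=> a b c; rewrite comb_frame /frame /= => -[h1 h2 h3].
  move: h1 h2; rewrite h3 !mulr0 !addr0 => h1 /eqP; rewrite mulf_eq0 (negbTE T0) /= => /eqP h2.
  move: h1; rewrite h2 mulr0 subr0 => /eqP; rewrite mulf_eq0 invr_eq0 (negbTE two0) orbF oppr_eq0 => /eqP c0.
  move: h2 h3; rewrite c0 !mul0r !addr0 => ->; rewrite mul0r addr0 => ->; by split.
- by move=> a b c a' b' c'; rewrite frame_real.
(* The vector [w1 + w3] has norm [-1]. *)
- by exists 1, 0, 1; rewrite frame_real /=; lra.
Qed.

(* As [rho] runs through the reals, [l * rho / (rho + l)] misses only the value [l] of the projective
   line; [l] is chosen so that the circle can meet the point at infinity only there. *)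
Definition avoid : R := if cre (w / A) == 0 then 1 else - (cre (w / A))^-1.
Local Notation l := avoid.
(** The null vectors of the real span are the multiples of [sg^2 w1 + sg ta w2 + ta^2 w3]; [nn] is
    the last entry of this vector, which vanishes exactly when the point is at infinity. *)
Let sg rho : R[i] := rC (rho + l).
Let ta rho : R[i] := rC (l * rho).
Let nn rho : R[i] := sg rho * sg rho + kap * (sg rho * ta rho) + ta rho * ta rho * A^-1.
Let ze rho : R[i] := (sg rho * ta rho + ta rho * ta rho * (w / A)) / nn rho.
Let B rho : R[i] := ta rho * ta rho / nn rho.

Lemma avoid_neq0 : l != 0.
Proof. by rewrite /avoid; case: ifP => [_|/negbT ?]; rewrite ?oner_neq0 ?oppr_eq0 ?invr_eq0. Qed.

Lemma nn_sum rho : nn rho + cconj (nn rho) =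
  2 * ((sg rho + ta rho * (w / A)) * cconj (sg rho + ta rho * (w / A))).
Proof.
rewrite /nn /sg /ta /conic_kap !conjE.
move: (rC (rho + l)) (rC (l * rho)) => s t.
transitivity (2 * ((s + t * (w / A)) * (s + t * (cconj w / cconj A))) +
   t * t / (A * cconj A) * (A + cconj A - 2 * (w * cconj w))).
  by field; rewrite ?A0 ?A'0.
by rewrite AE subrr mulr0 addr0.
Qed.

(** By [nn_sum] a zero of [nn] is a zero of [sg + ta (w / A)]. When [w / A] has nonzero real part,
    the choice of [avoid] makes the real part of this sum the nonzero constant [avoid]. Otherwise
    only [rho = -1] is left, where [sg = 0] and [nn] is the inverse of [A]. *)
Lemma nn_neq0 rho : nn rho != 0.
Proof.
apply/eqP => n0; have := nn_sum rho; rewrite n0 cconj0 addr0 => /esym /eqP.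
rewrite !mulf_eq0 (negbTE two0) cconj_eq0 orbb /= => /eqP e.
have /(congr1 (@cre R)) := e; rewrite /sg /ta creD creM /= mul0r subr0 /avoid.
case: ifP => [/eqP x0|/negbT x0]; last first.
  have -> : rho - (cre (w / A))^-1 + - (cre (w / A))^-1 * rho * cre (w / A) = - (cre (w / A))^-1 by field.
  by move/eqP; rewrite oppr_eq0 invr_eq0 (negbTE x0).
rewrite x0 mulr0 addr0 => r1; have rE : rho = -1 by lra.
have lE : l = 1 by rewrite /avoid x0 eqxx.
have s0 : sg rho = 0 by rewrite /sg lE rE addNr.
have t1 : ta rho = -1 by rewrite /ta lE rE mul1r rCN rC1.
move: n0; rewrite /nn s0 t1 !mul0r mulr0 !add0r mulrNN !mul1r => /eqP.
by rewrite invr_eq0 (negbTE A0).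
Qed.

(** The translation to [q] is undone in the vertical coordinate: the imaginary part of [B] is four
    times the vertical coordinate relative to [q]. *)
Definition circle_path rho : hpt R := let z := hz q + T * ze rho in
  ((cre z, cim z), hu q + cim (B rho) / 4 + 2^-1 * (hx q * cim z - hy q * cre z)).

Lemma B_sum rho : B rho + cconj (B rho) = 2 * (ze rho * cconj (ze rho)).
Proof.
have n0 := nn_neq0 rho; have n0' : cconj (nn rho) != 0 by rewrite cconj_eq0.
have := nn_sum rho; rewrite /B /ze.
have cs : cconj (sg rho) = sg rho by rewrite /sg cconj_rC.
have ct : cconj (ta rho) = ta rho by rewrite /ta cconj_rC.
move: (sg rho) (ta rho) (nn rho) (w / A) cs ct n0 n0' => s t n x cs ct n0 n0'.
rewrite !conjE cs ct; move: (cconj n) (cconj x) n0' => n' x' n0' e.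
transitivity (t * t * (n + n') / (n * n')); first by field; rewrite ?n0 ?n0'.
by rewrite e; field; rewrite ?n0 ?n0'.
Qed.

Lemma phi_circle_path rho : phi (circle_path rho) = frame ((- B rho / 2, ze rho), 1).
Proof.
have T1' := T1; have := B_sum rho; rewrite /phi /frame /= !mulr1 /hx /hy /hu /=.
move: (B rho) (ze rho) => b z bE; congr (_, _, _); last by rewrite complex_eta addrC.
have e : cre b = csq z.
  move: bE; rewrite mul_cconj -rC2 -rCM => /(congr1 (@cre R)); rewrite creD /=; lra.
have e2 : csq T = 1.
  by move: T1'; rewrite mul_cconj => /(congr1 (@cre R)).
have -> : - b / 2 = rC (- 2^-1) * b by rewrite rCN rCV rC2; field.
 move: e e2; rewrite /csq => e e2; apply: complex_eq; rewrite !compE /= ?compE /=.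
  have e3 : cre z ^+ 2 + cim z ^+ 2 = (cre T ^+ 2 + cim T ^+ 2) * (cre z ^+ 2 + cim z ^+ 2) by rewrite e2 mul1r.
  by rewrite e e3 /hx /hy /hu; field.
by rewrite /hx /hy /hu; field.
Qed.

Lemma through_path rho : through (circle_path rho).
Proof.
exists (nn rho); split; first exact: nn_neq0.
exists ((rho + l) * (rho + l)), ((rho + l) * (l * rho)), (l * rho * (l * rho)).
rewrite comb_frame phi_circle_path.
have n0 := nn_neq0 rho.
have -> : forall Z, c3scale (nn rho) (frame Z) = frame ((nn rho * Z.1.1, nn rho * Z.1.2), nn rho * Z.2).
  by move=> Z; rewrite /c3scale /frame /=; congr (_, _, _); ring.
rewrite /= mulr1 !rCM -/(sg rho) -!rCM -/(ta rho) !rCM -/(sg rho) -!rCM -/(ta rho).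
congr (frame (_, _, _)).
- by rewrite /B rCM -/(ta rho); field.
- by rewrite /ze mulrC divfK// !rCM -/(sg rho) -!rCM -/(ta rho) rCM.
- by rewrite /nn !rCM -!rCM -/(ta rho) !rCM -/(sg rho) ; ring.
Qed.

Let dn rho : R[i] := 2 * sg rho + kap * (ta rho + sg rho * rC l) + 2 * ta rho * rC l * A^-1.
Let dze rho : R[i] := ((ta rho + sg rho * rC l + 2 * ta rho * rC l * (w / A)) * nn rho -
   (sg rho * ta rho + ta rho * ta rho * (w / A)) * dn rho) / nn rho ^+ 2.
Let dB rho : R[i] := (2 * ta rho * rC l * nn rho - ta rho * ta rho * dn rho) / nn rho ^+ 2.

Lemma drv_circle_path rho : cdrv ze rho (dze rho) /\ cdrv B rho (dB rho).
Proof.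
have hs : cdrv sg rho 1.
  apply: cdrv_eq (cdrv_rC _ _ _ (drv_add _ _ _ _ _ (drv_id rho) (drv_cst l rho))) _.
  by rewrite addr0.
have ht : cdrv ta rho (rC l).
  by apply: cdrv_eq (cdrv_rC _ _ _ (drv_scale l _ _ _ (drv_id rho))) _; rewrite mulr1.
have hst := cdrv_mul _ _ _ _ _ hs ht; have htt := cdrv_mul _ _ _ _ _ ht ht.
have hn : cdrv nn rho (dn rho).
  apply: cdrv_eq (cdrv_add _ _ _ _ _ (cdrv_add _ _ _ _ _ (cdrv_mul _ _ _ _ _ hs hs) (cdrv_scale kap _ _ _ hst))
    (cdrv_mul _ _ _ _ _ htt (cdrv_cst A^-1 rho))) _.
  by rewrite /dn; ring.
have n0 := nn_neq0 rho; split.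
  apply: cdrv_eq (cdrv_div _ _ _ _ _ n0 (cdrv_add _ _ _ _ _ hst (cdrv_mul _ _ _ _ _ htt (cdrv_cst (w / A) rho))) hn) _.
  by rewrite /dze; congr (_ / _); ring.
apply: cdrv_eq (cdrv_div _ _ _ _ _ n0 htt hn) _.
by rewrite /dB; congr (_ / _); ring.
Qed.

(** Zero velocity would make the derivative of [(sg^2, sg ta, ta^2)] proportional to the vector
    itself, with factor [dn / nn]. For a parametrized conic this forces [dn = 0] and then
    [sg = ta = 0]. *)
Lemma circle_path_immersed rho : dze rho = 0 -> dB rho = 0 -> False.
Proof.
have n0 := nn_neq0 rho => e1 e2.
have q0 : (nn rho ^+ 2)^-1 != 0 by rewrite invr_eq0 expf_neq0.
have e3 : 2 * ta rho * rC l * nn rho = ta rho * ta rho * dn rho.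
  by move/eqP: e2; rewrite mulf_eq0 (negbTE q0) orbF subr_eq0 => /eqP.
have e4 : (ta rho + sg rho * rC l) * nn rho = sg rho * ta rho * dn rho.
  move/eqP: e1; rewrite mulf_eq0 (negbTE q0) orbF mulrDl (mulrDl _ _ (dn rho)).
  rewrite (mulrAC (ta rho * ta rho)) -e3 (mulrAC _ (w / A)) opprD addrACA subrr addr0 subr_eq0.
  by move/eqP.
have nE : nn rho * A = (sg rho * sg rho) * A + kap * A * (sg rho * ta rho) + ta rho * ta rho.
  by rewrite /nn; field.
have dnE : dn rho * A = 2 * sg rho * A + kap * A * (ta rho + sg rho * rC l) + 2 * ta rho * rC l.
  by rewrite /dn; field.
have e5 : 2 * sg rho * nn rho = sg rho * sg rho * dn rho.
  apply: (mulIf A0); apply/eqP; rewrite -subr_eq0.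
  have -> : 2 * sg rho * nn rho * A - sg rho * sg rho * dn rho * A =
    nn rho * (dn rho * A - kap * A * (ta rho + sg rho * rC l) - 2 * ta rho * rC l) -
    dn rho * (nn rho * A - kap * A * (sg rho * ta rho) - ta rho * ta rho).
    by rewrite nE dnE; ring.
  have -> : nn rho * (dn rho * A - kap * A * (ta rho + sg rho * rC l) - 2 * ta rho * rC l) -
    dn rho * (nn rho * A - kap * A * (sg rho * ta rho) - ta rho * ta rho) =
    - kap * A * ((ta rho + sg rho * rC l) * nn rho) + kap * A * (sg rho * ta rho * dn rho)
    - 2 * ta rho * rC l * nn rho + ta rho * ta rho * dn rho by ring.
  by rewrite e3 e4; apply/eqP; ring.
(* This combination is a nonzero constant: [sg] and [ta] cannot vanish together, and its square
   annihilates [dn]. *)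
have e6 : rC l * sg rho - ta rho = rC (l ^+ 2).
  by rewrite /sg /ta -rCM -rCN -rCD; congr rC; ring.
have l0 : rC (l ^+ 2) != 0 by rewrite rC_eq0 expf_neq0// avoid_neq0.
have dn0 : dn rho = 0.
  have : (rC l * sg rho - ta rho) ^+ 2 * dn rho = 0.
    have -> : (rC l * sg rho - ta rho) ^+ 2 * dn rho = rC l ^+ 2 * (sg rho * sg rho * dn rho) -
       2 * rC l * (sg rho * ta rho * dn rho) + ta rho * ta rho * dn rho by ring.
    by rewrite -e3 -e4 -e5; ring.
  by rewrite e6 => /eqP; rewrite mulf_eq0 expf_eq0 (negbTE l0) /= => /eqP.
have l0' : rC l != 0 by rewrite rC_eq0 avoid_neq0.
move: e3 e5; rewrite dn0 !mulr0 => /eqP; rewrite !mulf_eq0 (negbTE two0) (negbTE l0') (negbTE n0) !orbF /= => /eqP t0 /eqP.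
rewrite !mulf_eq0 (negbTE two0) (negbTE n0) !orbF /= => /eqP s0.
by move: e6; rewrite s0 t0 mulr0 subr0 => /esym /eqP; rewrite (negbTE l0).
Qed.

Lemma drv_circle_coords rho :
  [/\ is_derive rho 1 (cx circle_path) (cre (T * dze rho)),
     is_derive rho 1 (cy circle_path) (cim (T * dze rho)) &
     is_derive rho 1 (cu circle_path)
       (cim (dB rho) / 4 + 2^-1 * (hx q * cim (T * dze rho) - hy q * cre (T * dze rho)))].
Proof.
have [h1 h2] := drv_circle_path rho.
have [hr hi] := cdrv_add _ _ _ _ _ (cdrv_cst (hz q) rho) (cdrv_scale T _ _ _ h1).
rewrite add0r in hr hi; split => //.
rewrite (_ : cu circle_path = fun rho => hu q + 4^-1 * cim (B rho) +
   2^-1 * (hx q * cim (hz q + T * ze rho) - hy q * cre (hz q + T * ze rho))); last first.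
  by apply/funext => x; rewrite /cu /circle_path /hu /= [cim _ / 4]mulrC.
apply: drv_eq (drv_add _ _ _ _ _ (drv_add _ _ _ _ _ (drv_cst (hu q) rho) (drv_scale 4^-1 _ _ _ h2.2))
  (drv_scale 2^-1 _ _ _ (drv_sub _ _ _ _ _ (drv_scale (hx q) _ _ _ hi) (drv_scale (hy q) _ _ _ hr)))) _.
by rewrite add0r mulrC.
Qed.

Lemma regular_circle_path : regular_path_in through circle_path.
Proof.
split => [r|r|r]; first exact: through_path.
  by have [[? _] [? _] [? _]] := drv_circle_coords r.
have [h1 h2 h3] := drv_circle_coords r; have [k1 k2] := drv_circle_path r.
rewrite (drv_D1 _ _ _ h1) (drv_D1 _ _ _ h2) (drv_D1 _ _ _ h3); apply/eqP => -[e1 e2].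
rewrite e1 e2 !mulr0 subr0 mulr0 addr0 => e3.
have z0 : dze r = 0.
  have : T * dze r = 0 by apply: complex_eq; rewrite ?e1 ?e2.
  by move/eqP; rewrite mulf_eq0 (negbTE T0) => /eqP.
(* The vertical coordinate controls only the imaginary part of [dB]; the real part comes from
   differentiating [B_sum]. *)
apply: (circle_path_immersed r z0); apply: complex_eq; last by rewrite /=; lra.
have bE : (fun x => B x + cconj (B x)) = (fun x => 2 * (ze x * cconj (ze x))).
  by apply/funext => x; exact: B_sum.
have := cdrv_add _ _ _ _ _ k2 (cdrv_conj _ _ _ k2); rewrite bE => h.
have := cdrv_uniq _ _ _ _ h (cdrv_scale 2 _ _ _ (cdrv_mul _ _ _ _ _ k1 (cdrv_conj _ _ _ k1))).
rewrite z0 cconj0 mul0r mulr0 addr0 mulr0 => /(congr1 (@cre R)); rewrite creD /=; lra.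
Qed.

Lemma circle_path0 : circle_path 0 = q.
Proof.
have t0 : ta 0 = 0 by rewrite /ta mulr0.
rewrite /circle_path /ze /B t0 !mulr0 !mul0r addr0 mul0r mulr0 addr0 /hx /hy /hu /=.
by case: (q) => [[x y] u]; rewrite /hx /hy /=; congr (_, _, _); ring.
Qed.

Lemma circle_path1 : circle_path (- l) = p.
Proof.
have s0 : sg (- l) = 0 by rewrite /sg addNr.
have l0 := avoid_neq0.
have t0 : ta (- l) != 0 by rewrite /ta rC_eq0 mulrN oppr_eq0 mulf_neq0.
have nE : nn (- l) = ta (- l) * ta (- l) * A^-1 by rewrite /nn s0 !mul0r mulr0 !add0r.
have zE : ze (- l) = w by rewrite /ze nE s0 mul0r add0r; field; rewrite ?A0 ?t0.
have bE : B (- l) = A by rewrite /B nE; field; rewrite ?A0 ?t0.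
have e : hz q + T * ze (- l) = hz p.
  by rewrite zE -wE /rel_z mulrA T1 mul1r addrC subrK.
rewrite /circle_path e bE -BE /hz /rel_B /hx /hy /hu /=.
by case: (p) => [[x y] u]; case: (q) => [[x' y'] u'] /=; congr (_, _, _); field.
Qed.

Lemma circle_path_start :
  (D1 (cx circle_path) 0, D1 (cy circle_path) 0, D1 (cu circle_path) 0) =
   (1 * cre T, 1 * cim T, 1 * (2^-1 * (hx q * cim T - hy q * cre T))).
Proof.
have [h1 h2 h3] := drv_circle_coords 0.
rewrite (drv_D1 _ _ _ h1) (drv_D1 _ _ _ h2) (drv_D1 _ _ _ h3) !mul1r.
have t0 : ta 0 = 0 by rewrite /ta mulr0.
have sE : sg 0 = rC l by rewrite /sg add0r.
have l0 : rC l != 0 by rewrite rC_eq0 avoid_neq0.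
have nE : nn 0 = rC l * rC l by rewrite /nn sE t0 !mulr0 mul0r !addr0.
have -> : dze 0 = 1 by rewrite /dze nE t0 sE; move: (dn 0) (rC l) l0 => d x x0; field; rewrite ?x0.
have -> : dB 0 = 0 by rewrite /dB t0 !mulr0 !mul0r subrr mul0r.
by rewrite mulr1 /= mul0r add0r.
Qed.

End rcircle_existence.

(** * The cosine of the angle *)

Section theta_value.
Context {R : realType}.
Variables (L : R) (g : R -> hpt R).
Hypothesis knot : legendrian_knot L g.
Implicit Types s t : R.

Definition tangent s : R[i] := Complex (D1 (cx g) s) (D1 (cy g) s).

Lemma tangent_unit s : tangent s * cconj (tangent s) = 1.
Proof. by rewrite mul_cconj /csq /= (knot_unit_speed L g knot). Qed.

Lemma cnorm_csq (z : R[i]) : cnorm z ^+ 2 = csq z.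
Proof. by rewrite /cnorm sqr_sqrtr// addr_ge0// sqr_ge0. Qed.

Lemma cnorm_tangent s : cnorm (tangent s) = 1.
Proof. by rewrite /cnorm /= (knot_unit_speed L g knot) sqrtr1. Qed.

Lemma cnorm_conj (z : R[i]) : cnorm (cconj z) = cnorm z.
Proof. by rewrite /cnorm /= sqrrN. Qed.

Lemma cnorm_rC (x : R) : 0 <= x -> cnorm (rC x) = x.
Proof. by move=> x0; rewrite /cnorm /= expr0n addr0 sqrtr_sqr ger0_norm. Qed.

Lemma start_eq (c : R -> hpt R) t k :
  (k * D1 (cx g) t, k * D1 (cy g) t, k * D1 (cu g) t) =
  (k * cre (tangent t), k * cim (tangent t), k * (2^-1 * (hx (g t) * cim (tangent t) - hy (g t) * cre (tangent t)))).
Proof. by rewrite (knot_contact L g knot). Qed.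

(** The angle is chosen among the solutions of [theta_rel]: every solution must have this cosine,
    and one must exist. The positive factor [rho] from the parametrization cancels against the
    speed. *)
Lemma cos_thetaK s t : g s <> g t ->
  cos (thetaK L g s t) =
  cre (cconj (tangent s) * (tangent t * rel_B (g t) (g s) ^+ 3)) / cnorm (rel_B (g t) (g s)) ^+ 3.
Proof.
move=> pq; set A := rel_B _ _; set v := RHS.
have A0 : A != 0 by apply/eqP => /rel_B_eq0.
have nA : 0 < cnorm A by rewrite cnorm_gt0.
have speed (c : R -> hpt R) r rho : 0 < rho -> Complex (D1 (cx c) r) (D1 (cy c) r) = rC rho * (tangent t * A ^+ 3) ->
    Num.sqrt (D1 (cx c) r ^+ 2 + D1 (cy c) r ^+ 2) = rho * cnorm A ^+ 3 /\
    D1 (cx g) s * D1 (cx c) r + D1 (cy g) s * D1 (cy c) r = rho * (v * cnorm A ^+ 3).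
  move=> rho0 e; split.
    rewrite -[LHS]/(cnorm (Complex (D1 (cx c) r) (D1 (cy c) r))) e.
    by rewrite cnormM cnorm_rC ?ltW// cnormM cnorm_tangent mul1r cnormX.
  rewrite /v divfK ?expf_neq0 ?gt_eqF//.
  transitivity (cre (cconj (tangent s) * Complex (D1 (cx c) r) (D1 (cy c) r))); first by rewrite creM /=; ring.
  by rewrite e mulrCA [LHS]creM /= mul0r subr0.
have uniq th : theta_rel L g s t th -> cos th = v.
  move=> [_ [S [c [k [r [[cS Sp Sq reg] [c0 k0 dc] cr E]]]]]].
  rewrite (start_eq c) in dc.
  have [rho rho0 e] := rcircle_direction S c (g s) (g t) (tangent t) k r (tangent_unit t) pq cS Sp Sq reg c0 k0 dc cr.
  have [e1 e2] := speed c r rho rho0 e; rewrite e1 e2 in E.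
  apply: (mulIf (x := rho * cnorm A ^+ 3)); first by rewrite mulf_neq0 ?expf_neq0 ?gt_eqF.
  by rewrite E; ring.
have exist : exists th, theta_rel L g s t th.
  have v1 : -1 <= v <= 1.
    rewrite -ler_norml /v normrM normfV [X in _ / X]ger0_norm ?exprn_ge0 ?cnorm_ge0//.
    rewrite ler_pdivrMr ?exprn_gt0// mul1r; apply: le_trans (cre_le_cnorm _) _.
    by rewrite cnormM cnorm_conj cnormM !cnorm_tangent !mul1r cnormX.
  exists (acos v); split; first by rewrite acos_ge0// acos_lepi.
  pose T := tangent t; have T1 := tangent_unit t.
  pose w := rel_z (g t) T (g s).
  (* The constructed path is at [q] for parameter 0; at [- avoid] it has [sg = 0], which is the lift
     of [p]. *)
  exists (through (g t) T w A), (circle_path (g t) T w A), 1, (- avoid w A).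
  have reg := regular_circle_path (g s) (g t) T w A T1 pq erefl erefl.
  have c0 := circle_path0 (g t) T w A.
  have c1 := circle_path1 (g s) (g t) T w A T1 pq erefl erefl.
  have d0 := circle_path_start (g s) (g t) T w A T1 pq erefl erefl.
  have cS := rcircle_through (g s) (g t) T w A T1 pq erefl erefl.
  have [inS _ _] := reg.
  have Sp : through (g t) T w A (g s) by rewrite -c1.
  have Sq : through (g t) T w A (g t) by rewrite -{2}c0.
  split => //.
  - by split => //; rewrite d0 (start_eq (circle_path (g t) T w A)).
  - have [rho rho0 e] := rcircle_direction _ _ (g s) (g t) T 1 _ T1 pq cS Sp Sq reg c0 ltr01 d0 c1.
    have [-> ->] := speed _ _ rho rho0 e.
    by rewrite acosK ?in_itv//=; ring.
by have /uniq := xgetPex 0 exist.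
Qed.

End theta_value.

(** * The energy density as a derivative along the knot *)

Section energy_density.
Context {R : realType}.
Variables (L : R) (g : R -> hpt R).
Hypothesis knot : legendrian_knot L g.
Implicit Types s t : R.
Notation T := (reach L).
Local Notation tg := (tangent g).
Local Notation ell := (ell g).
Local Notation corr := (corr g).

Definition chord s t : R[i] := rel_B (g (s + t)) (g s).
Definition angle_term s t : R[i] := cconj (tg s) * (tg t * rel_B (g t) (g s) ^+ 3).
Definition energy_density s t : R :=
  (1 - cre (angle_term s t) / cnorm (rel_B (g t) (g s)) ^+ 3) / cnorm (rel_B (g t) (g s)).

Lemma chord_dist4 s t : csq (chord s t) = dist4 g s t.
Proof. by rewrite /csq /chord /rel_B /dist4 /vert /cx /cy /cu /=; ring. Qed.

Lemma cnorm_chord s t : cnorm (rel_B (g t) (g s)) = dH (g s) (g t) ^+ 2.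
Proof.
have -> : t = s + (t - s) by ring.
rewrite dH_dist4 -/(chord s (t - s)).
have d0 := dist4_ge0 g s (t - s).
have e0 := powR_ge0 (dist4 g s (t - s)) 4^-1.
rewrite -[RHS]powR_mulrn// -powRrM (_ : 4^-1 * 2 = 2^-1 :> R); last by field.
by rewrite powR12_sqrt// -chord_dist4.
Qed.

(** When the two points coincide, both sides are 0 by the convention for division by zero. *)
Lemma energy_integrandE s t : energy_integrand L g s t = energy_density s t.
Proof.
rewrite /energy_integrand /energy_density -cnorm_chord.
have [e|ne] := pselect (g s = g t).
  by rewrite e rel_B0 cnorm0 invr0 !mulr0.
by rewrite (cos_thetaK L g knot).
Qed.

Lemma chord_conj s t : rel_B (g s) (g t) = cconj (rel_B (g t) (g s)).
Proof. by apply: complex_eq; rewrite /=; ring. Qed.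

Lemma energy_density_sym s t : energy_density s t = energy_density t s.
Proof.
rewrite /energy_density /angle_term (chord_conj t s) cnorm_conj; congr ((1 - _ / _) / _).
set A := rel_B _ _; set p := tg s; set q := tg t.
transitivity (cre (cconj (cconj p * (q * cconj A ^+ 3)))); first by [].
rewrite !conjE; congr cre.
ring.
Qed.

Lemma tangent_periodic : periodic L tg.
Proof.
move=> s; rewrite /tangent (periodic_D1 L _ (smooth_x L g knot) (periodic_x L g knot)).
by rewrite (periodic_D1 L _ (smooth_y L g knot) (periodic_y L g knot)).
Qed.

Lemma energy_density_periodic s t : energy_density (s + L) t = energy_density s t.
Proof. by rewrite /energy_density /angle_term tangent_periodic (knot_periodic L g knot). Qed.

Lemma energy_density_ge0 s t : 0 <= energy_density s t.
Proof.
rewrite /energy_density; set A := rel_B _ _.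
have [A0|A0] := eqVneq A 0; first by rewrite A0 cnorm0 invr0 mulr0.
have nA : 0 < cnorm A by rewrite cnorm_gt0.
apply: divr_ge0; last exact: ltW.
rewrite subr_ge0 ler_pdivrMr ?exprn_gt0// mul1r.
apply: le_trans (ler_norm _) _; apply: le_trans (cre_le_cnorm _) _.
by rewrite cnormM cnorm_conj cnormM !(cnorm_tangent L g knot) !mul1r cnormX.
Qed.

(* The partial derivative of [ln (dH (g s) (g (s + t)))] in its first point. *)
Definition slope s t : R := cre (tg s * cconj (hz (g s) - hz (g (s + t))) / chord s t).
Definition slope_rate s t : R := cre (tg s * cconj (tg (s + t)) * cconj (chord s t) / chord s t ^+ 2).

Lemma cdrv_point s : cdrv (fun x => hz (g x)) s (tg s).
Proof. by split; [exact: drv_x L g knot s|exact: drv_y L g knot s]. Qed.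

Lemma cdrv_point_shift s t : cdrv (fun x => hz (g (s + x))) t (tg (s + t)).
Proof.
split; first exact: (drv_shift (cx g) s t _ (drv_x L g knot (s + t))).
exact: (drv_shift (cy g) s t _ (drv_y L g knot (s + t))).
Qed.

Lemma cdrv_tangent_shift s t : exists d, cdrv (fun x => tg (s + x)) t d.
Proof.
exists (Complex (D1 (D1 (cx g)) (s + t)) (D1 (D1 (cy g)) (s + t))); split.
  exact: (drv_shift (D1 (cx g)) s t _ (drv_x1 L g knot (s + t))).
exact: (drv_shift (D1 (cy g)) s t _ (drv_y1 L g knot (s + t))).
Qed.

Lemma cdrv_chord s t : cdrv (chord s) t (- (2 * cconj (tg (s + t)) * (hz (g s) - hz (g (s + t))))).
Proof.
have hx' := drv_shift (cx g) s t _ (drv_x L g knot (s + t)).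
have hy' := drv_shift (cy g) s t _ (drv_y L g knot (s + t)).
have hv := drv_vert0 L g knot s t.
rewrite -rC2; split.
  rewrite (_ : (fun x => _) = (fun x => (cx g s - cx g (s + x)) ^+ 2 + (cy g s - cy g (s + x)) ^+ 2)) //.
  apply: drv_eq (drv_add _ _ _ _ _ (drv_pow _ 2 _ _ (drv_sub _ _ _ _ _ (drv_cst (cx g s) t) hx'))
    (drv_pow _ 2 _ _ (drv_sub _ _ _ _ _ (drv_cst (cy g s) t) hy'))) _.
  by rewrite !compE /= ?compE /= /cx /cy; ring.
rewrite (_ : (fun x => _) = (fun x => - 4 * vert g s x)); last first.
  by apply/funext => x; rewrite /chord /rel_B /vert /cx /cy /cu /=; ring.
apply: drv_eq (drv_scale (-4) _ _ _ hv) _.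
by rewrite !compE /= ?compE /= /cx /cy; field.
Qed.

Lemma chord_neq0 s t : 0 < t < L -> chord s t != 0.
Proof. by move=> ht; rewrite -csq_eq0 chord_dist4 gt_eqF// (dist4_gt0 L g knot). Qed.

Lemma strip_period t : 0 < t < T -> 0 < t < L.
Proof. by move=> /andP[-> h]; exact: lt_trans h (reach_lt L g knot). Qed.

Lemma chord_norm2 s t : chord s t + cconj (chord s t) =
  2 * ((hz (g s) - hz (g (s + t))) * cconj (hz (g s) - hz (g (s + t)))).
Proof.
rewrite mul_cconj -rC2 -rCM; apply: complex_eq; rewrite ?compE /= ?/csq ?compE /=; ring.
Qed.

(** The quotient rule produces [2 |gap|^2 - chord] in the numerator, where [gap] is the horizontal
    difference; by [chord_norm2] this is the conjugate of [chord]. *)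
Lemma drv_slope s t : 0 < t < T -> is_derive t 1 (slope s) (slope_rate s t).
Proof.
move=> ht; have A0 := chord_neq0 s t (strip_period t ht).
have h1 := cdrv_conj _ _ _ (cdrv_sub _ _ _ _ _ (cdrv_cst (hz (g s)) t) (cdrv_point_shift s t)).
have [+ _] := cdrv_div _ _ _ _ _ A0 (cdrv_scale (tg s) _ _ _ h1) (cdrv_chord s t).
move=> h; apply: drv_eq h _; rewrite /slope_rate; congr (cre (_ / _)).
rewrite sub0r; have := chord_norm2 s t.
move: (chord s t) (cconj (chord s t)) (hz (g s) - hz (g (s + t))) (tg s) (tg (s + t)) => a a' d p q e.
transitivity (p * cconj q * (2 * (d * cconj d) - a)); first by rewrite !conjE; ring.
by rewrite -e; ring.
Qed.

Lemma expR_ell s t : 0 < t < T -> expR (-2 * ell s t) = (cnorm (chord s t))^-1.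
Proof.
move=> ht; have d0 := dist4_gt0 L g knot s t (strip_period t ht).
have -> : cnorm (chord s t) = expR (2 * ell s t).
  rewrite /cnorm -/(csq _) chord_dist4 -powR12_sqrt ?ltW// /powR gt_eqF//; congr expR.
  by rewrite /ell; field.
by rewrite -expRN mulNr.
Qed.

(** With [a] the chord, [conj p q a^3 / |a|^4] is the conjugate of [p conj q conj a / a^2], so the
    cosine term is [slope_rate]. *)
Lemma energy_densityE s t : 0 < t < T -> energy_density s (s + t) = expR (-2 * ell s t) - slope_rate s t.
Proof.
move=> ht; rewrite expR_ell// /energy_density /slope_rate /angle_term -/(chord s t).
have A0 := chord_neq0 s t (strip_period t ht).
have nA : cnorm (chord s t) != 0 by rewrite gt_eqF// cnorm_gt0.
move: (chord s t) (tg s) (tg (s + t)) A0 nA => a p q A0 nA.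
have A'0 : cconj a != 0 by rewrite cconj_eq0.
rewrite mulrBl mul1r; congr (_ - _).
transitivity (cre (cconj (p * cconj q * cconj a / a ^+ 2))); last by [].
have -> : cconj (p * cconj q * cconj a / a ^+ 2) = cconj p * (q * a ^+ 3) * rC ((cnorm a ^+ 4)^-1).
  have -> : cnorm a ^+ 4 = csq a ^+ 2 by rewrite -cnorm_csq -exprM.
  by rewrite rCV (expr2 (csq a)) rCM -!mul_cconj expr2 !conjE; field; rewrite ?A0 ?A'0.
by rewrite [RHS]creM [cre (rC _)]/= [cim (rC _)]/= mulr0 subr0; field; exact: nA.
Qed.

(* An antiderivative of [- energy_density s (s + t) - 2 t^2 (corr s t) exp(-2 ell s t)] vanishing at [0]. *)
Definition defect s t : R := t * expR (-2 * ell s t) + slope s t.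

(** As [ell' = (1 + t^2 corr) / t], the derivative of [t exp (-2 ell)] is
    [- exp (-2 ell) (1 + 2 t^2 corr)]. *)
Lemma drv_defect s t : 0 < t < T -> is_derive t 1 (defect s)
  (- (energy_density s (s + t) + 2 * (dens 2 corr s t * expR (-2 * ell s t)))).
Proof.
move=> ht; have t0 := pos_neq0 _ _ ht.
have he := drv_exp _ _ _ (drv_scale (-2) _ _ _ (drv_ell L g knot s t ht)).
apply: drv_eq (drv_add _ _ _ _ _ (drv_mul _ _ _ _ _ (drv_id t) he) (drv_slope s t ht)) _.
by rewrite energy_densityE// /dens; field.
Qed.

End energy_density.

(** * Cancellation of the singularities at the diagonal *)

Section defect.
Context {R : realType}.
Variables (L : R) (g : R -> hpt R).
Hypothesis knot : legendrian_knot L g.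
Implicit Types s t : R.
Notation T := (reach L).
Local Notation L0 := (knot_length_gt0 L g knot).
Local Notation T0 := (reach_gt0 L g knot).
Local Notation x1 := (D1 (cx g)).
Local Notation y1 := (D1 (cy g)).
Local Notation tg := (tangent g).
Local Notation ell := (ell g).

(** The divided difference minus the derivative at the base point [s], over [t]; [quo2] plays the
    same role at the other end [s + t]. It is expressed through functions already known to be
    tame. *)
Definition bend (f : R -> R) s t : R := quo1 (D1 f) s t - quo2 f s t.
Definition bend2 s t : R := bend (cx g) s t * bend (cx g) s t + bend (cy g) s t * bend (cy g) s t.
(** The numerator of [slope] beyond its leading term, as read off in [slopeE]; its last term comes
    from the vertical displacement. *)
Definition turn2 s t : R := 2^-1 * (hor2 g s t - bend2 s t) + hor2 g s t +
  t * t * (2^-1 * (hor2 g s t - bend2 s t) * hor2 g s t) -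
  4 * (vert3 g s t * (bend (cx g) s t * quo1 (cy g) s t - bend (cy g) s t * quo1 (cx g) s t)).

Lemma bendE (f : R -> R) s t : 0 < t < T -> quo1 f s t = D1 f s + t * bend f s t.
Proof.
by move=> ht; rewrite /bend mulrBr -(quo1E L (D1 f) s t ht) (quo2E L f s t ht); ring.
Qed.

Lemma tame_bend n f : smooth_fun f -> periodic L f -> tame T n (bend f).
Proof.
move=> sf pf; apply: tameB; last exact: (tame_quo2 L L0 T T0 n f sf pf).
exact: (tame_quo1 L L0 T T0 n _ (smooth_D1 f sf) (periodic_D1 L f sf pf)).
Qed.

Lemma tame_turn2 n : tame T n turn2.
Proof.
have bx := tame_bend n _ (smooth_x L g knot) (periodic_x L g knot).
have by_ := tame_bend n _ (smooth_y L g knot) (periodic_y L g knot).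
have h2 := tame_hor2 L g knot n.
have t1 := tame_tau T n T0.
have b2 : tame T n bend2 by apply: tameD; exact: tameM.
have hb := tameZ T n 2^-1 _ (tameB T n _ _ h2 b2).
apply: tameB.
  apply: tameD; first exact: tameD.
  by apply: tameM; exact: tameM.
apply: tameZ; apply: tameM; first exact: tame_vert3.
apply: tameB; apply: tameM => //.
  exact: (tame_quo1 L L0 T T0 n _ (smooth_y L g knot) (periodic_y L g knot)).
exact: (tame_quo1 L L0 T T0 n _ (smooth_x L g knot) (periodic_x L g knot)).
Qed.

Lemma slopeE s t : 0 < t < T -> slope g s t = - (1 + t ^+ 2 * turn2 s t) / (t * gauge g s t).
Proof.
move=> ht; have t0 := pos_neq0 _ _ ht.
have g0 : gauge g s t != 0 by rewrite gt_eqF// (gauge_gt0 L g knot).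
have d0 : dist4 g s t != 0 by rewrite gt_eqF// (dist4_gt0 L g knot)// (strip_period L g knot).
have A0 := chord_neq0 L g knot s t (strip_period L g knot t ht).
rewrite /slope.
have -> : tg s * cconj (hz (g s) - hz (g (s + t))) / chord g s t =
  tg s * cconj (hz (g s) - hz (g (s + t))) * cconj (chord g s t) * rC (dist4 g s t)^-1.
  rewrite -chord_dist4 rCV -mul_cconj; field; rewrite ?A0 ?cconj_eq0 ?A0//.
rewrite [LHS]creM [cre (rC _)]/= [cim (rC _)]/= mulr0 subr0.
have dx : hx (g (s + t)) - hx (g s) = t * quo1 (cx g) s t by exact: quo1E ht.
have dy : hy (g (s + t)) - hy (g s) = t * quo1 (cy g) s t by exact: quo1E ht.
have hzE : hz (g s) - hz (g (s + t)) = Complex (- (t * quo1 (cx g) s t)) (- (t * quo1 (cy g) s t)).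
  by apply: complex_eq; rewrite ?compE /= -?dx -?dy ?opprB.
have chE : chord g s t = Complex (t ^+ 2 * hor g s t) (- (4 * t ^+ 3 * vert3 g s t)).
  apply: complex_eq; rewrite /=.
    rewrite -[hx _ - _]opprB -[hy (g s) - _]opprB dx dy /hor; ring.
  transitivity (- (4 * vert g s t)); first by rewrite /vert /cx /cy /cu; ring.
  by rewrite /vert3; field.
rewrite hzE chE (dist4E L g s t ht).
have e1 := bendE (cx g) s t ht; have e2 := bendE (cy g) s t ht.
have us := knot_unit_speed L g knot s.
have hE := horE L g knot s t ht.
have hor' : hor g s t = quo1 (cx g) s t ^+ 2 + quo1 (cy g) s t ^+ 2 by [].
(* Polarization for the unit tangent at [s] and the chord over [t], whose difference is [t] times
   the bend. *)
have p1 : 2 * (x1 s * quo1 (cx g) s t + y1 s * quo1 (cy g) s t) = 1 + hor g s t - t ^+ 2 * bend2 s t.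
  transitivity ((x1 s ^+ 2 + y1 s ^+ 2) + hor g s t - t ^+ 2 * bend2 s t); last by rewrite us.
  by rewrite hor' /bend2 e1 e2; ring.
have p2 : x1 s * quo1 (cy g) s t - y1 s * quo1 (cx g) s t =
  t * (bend (cy g) s t * quo1 (cx g) s t - bend (cx g) s t * quo1 (cy g) s t) by rewrite e1 e2; ring.
move: p1 p2 => p1; set X := quo1 (cx g) s t; set Y := quo1 (cy g) s t => p2.
have -> : cre (tg s * cconj (Complex (- (t * X)) (- (t * Y))) *
   cconj (Complex (t ^+ 2 * hor g s t) (- (4 * t ^+ 3 * vert3 g s t)))) =
  - t ^+ 3 * (hor g s t * (2^-1 * (2 * (x1 s * X + y1 s * Y))) + 4 * t * vert3 g s t * (x1 s * Y - y1 s * X)).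
  by rewrite !creM cimM /=; field.
rewrite p1 p2 hE /turn2 -/X -/Y; field.
by rewrite g0 t0.
Qed.

(** With [r] the square root of [gauge], the two terms are [1 / (t r)] and
    [- (1 + t^2 turn2) / (t r^2)]: their poles cancel because [r - 1 = t^2 gauge2 / (r + 1)]. *)
Lemma defect_bound : exists K, forall s t, 0 < t < T -> `|defect g s t| <= K * t.
Proof.
have [C hC] := tame_bounded _ _ _ (tame_gauge2 L g knot 0).
have [D hD] := tame_bounded _ _ _ (tame_turn2 0).
have [c c0 hc] := gauge_lower L g knot.
exists ((C + D) / c) => s t ht; have /andP[tp _] := ht.
have t0 := pos_neq0 _ _ ht; have g0 := gauge_gt0 L g knot s t ht.
pose r := Num.sqrt (gauge g s t); have r0 : 0 < r by rewrite sqrtr_gt0.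
have rr : gauge g s t = r ^+ 2 by rewrite sqr_sqrtr// ltW.
have eE : expR (-2 * ell s t) = (t ^+ 2 * r)^-1.
  rewrite (expR_ell L g knot)// /cnorm -/(csq _) chord_dist4 (dist4E L g s t ht).
  rewrite sqrtrM ?exprn_ge0 ?(ltW tp)//; congr ((_ * _)^-1).
  by rewrite (_ : t ^+ 4 = (t ^+ 2) ^+ 2) ?sqrtr_sqr ?ger0_norm ?sqr_ge0// -exprM.
have g2E : gauge2 g s t = (r ^+ 2 - 1) / t ^+ 2.
  by rewrite -rr (gaugeE L g knot s t ht); field.
have -> : defect g s t = t / gauge g s t * (gauge2 g s t / (r + 1) - turn2 s t).
  rewrite /defect eE slopeE// g2E rr; field.
  by rewrite t0 (lt0r_neq0 r0) (lt0r_neq0 (addr_gt0 r0 ltr01)).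
rewrite normrM normrM (gtr0_norm tp) normfV (gtr0_norm g0) -mulrA mulrC.
rewrite ler_wpM2r ?(ltW tp)// mulrC.
have h1 : `|gauge2 g s t / (r + 1)| <= C.
  rewrite normrM normfV (gtr0_norm (addr_gt0 r0 ltr01)) ler_pdivrMr ?addr_gt0//.
  apply: le_trans (hC s t ht) _; rewrite mulrDr mulr1 lerDr mulr_ge0 ?(ltW r0)//.
  by apply: le_trans (hC s t ht).
apply: ler_pM => //; first by rewrite invr_ge0 ltW.
  by apply: le_trans (ler_normB _ _) _; apply: lerD h1 (hD s t ht).
by rewrite lef_pV2 ?posrE// hc.
Qed.

Lemma defect_cvg0 s : defect g s t @[t --> 0^'+] --> 0.
Proof.
have [K hK] := defect_bound.
apply/cvgrPdist_le => e e0; near=> t.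
have tp : 0 < t by [].
have tT : t < T by near: t; apply: nbhs_right_lt; exact: T0.
have te : t < e / (`|K| + 1) by near: t; apply: nbhs_right_lt; rewrite divr_gt0// ltr_wpDl.
rewrite sub0r normrN; apply: le_trans (hK s t _) _; first by rewrite tp.
rewrite ltr_pdivlMr ?ltr_wpDl// in te.
apply: le_trans (ltW te); rewrite mulrC ler_wpM2l ?(ltW tp)//.
by have := ler_norm K; lra.
Unshelve. all: by end_near. Qed.

End defect.

(** * The slope at opposite points *)

Section slope_integral.
Context {R : realType}.
Variables (L : R) (g : R -> hpt R).
Hypothesis knot : legendrian_knot L g.
Implicit Types s t : R.
Notation mu := (@lebesgue_measure R).
Local Notation a := (half L).
Local Notation L0 := (knot_length_gt0 L g knot).
Local Notation tg := (tangent g).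

Let ha : 0 < a < L.
Proof. by rewrite (half_gt0 L g knot)/= /half; have := L0; lra. Qed.

Lemma cdrv_tangent s : cdrv tg s (Complex (D1 (D1 (cx g)) s) (D1 (D1 (cy g)) s)).
Proof. by split; [exact: drv_x1 L g knot s|exact: drv_y1 L g knot s]. Qed.

Lemma cdrv_gap s : cdrv (fun s => hz (g s) - hz (g (s + a))) s (tg s - tg (s + a)).
Proof.
apply: cdrv_sub; first exact: cdrv_point knot s.
have := cdrv_point_shift L g knot a s; rewrite addrC => h.
by rewrite (_ : (fun x : R => hz (g (x + a))) = (fun x => hz (g (a + x)))) //; apply/funext => x; rewrite addrC.
Qed.

Lemma cdrv_half_chord s : cdrv (fun s => chord g s a) s
  (2 * (tg s * cconj (hz (g s) - hz (g (s + a)))) - 2 * cconj (tg (s + a)) * (hz (g s) - hz (g (s + a)))).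
Proof.
have dx := drv_x L g knot; have dy := drv_y L g knot; have du := drv_u L g knot.
have sh (f : R -> R) d : is_derive (s + a) 1 f d -> is_derive s 1 (fun x => f (x + a)) d.
  move=> h; have := drv_shift f a s d; rewrite addrC => /(_ h).
  by rewrite (_ : (fun x => f (x + a)) = (fun x => f (a + x))) //; apply/funext => x; rewrite addrC.
have sx := sh _ _ (dx (s + a)); have sy := sh _ _ (dy (s + a)); have su := sh _ _ (du (s + a)).
rewrite -rC2; split.
  rewrite (_ : (fun x => _) = (fun x => (cx g x - cx g (x + a)) ^+ 2 + (cy g x - cy g (x + a)) ^+ 2)) //.
  apply: drv_eq (drv_add _ _ _ _ _ (drv_pow _ 2 _ _ (drv_sub _ _ _ _ _ (dx s) sx))
    (drv_pow _ 2 _ _ (drv_sub _ _ _ _ _ (dy s) sy))) _.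
  by rewrite !compE /= ?compE /= /cx /cy; ring.
rewrite (_ : (fun x => _) = (fun x => 4 * (cu g x - cu g (x + a) -
    2^-1 * (cx g (x + a) * cy g x - cy g (x + a) * cx g x)))) //.
apply: drv_eq (drv_scale 4 _ _ _ (drv_sub _ _ _ _ _ (drv_sub _ _ _ _ _ (du s) su)
  (drv_scale 2^-1 _ _ _ (drv_sub _ _ _ _ _ (drv_mul _ _ _ _ _ sx (dy s)) (drv_mul _ _ _ _ _ sy (dx s)))))) _.
by rewrite !(knot_contact L g knot) !compE /= ?compE /= /cx /cy; field.
Qed.

Lemma slope_continuous : continuous (fun s => slope g s a).
Proof.
move=> s; have A0 := chord_neq0 L g knot s a ha.
have hm := cdrv_mul _ _ _ _ _ (cdrv_tangent s) (cdrv_conj _ _ _ (cdrv_gap s)).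
have [h _] := cdrv_div _ (fun s => chord g s a) _ _ _ A0 hm (cdrv_half_chord s).
exact: drv_cont h.
Qed.

Lemma slope_periodic : periodic L (fun s => slope g s a).
Proof.
move=> s; rewrite /slope /chord addrAC !(knot_periodic L g knot).
by rewrite (tangent_periodic L g knot).
Qed.

(** Both ends move. Since [s + a + a = s + L], the partial derivative at the second end is the slope
    seen from the opposite point. *)
Lemma drv_half_ell s : is_derive s 1 (fun s => ell g s a) (slope g s a + slope g (s + a) a).
Proof.
have A0 := chord_neq0 L g knot s a ha.
have d0 : 0 < dist4 g s a by exact: (dist4_gt0 L g knot).
have [h1 h2] := cdrv_half_chord s.
have hq := drv_add _ _ _ _ _ (drv_pow _ 2 _ _ h1) (drv_pow _ 2 _ _ h2).
have e : (fun s => cre (chord g s a) ^+ 2 + cim (chord g s a) ^+ 2) = (fun s => dist4 g s a).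
  by apply/funext => x; rewrite -chord_dist4.
rewrite e in hq.
have hl := drv_scale 4^-1 _ _ _ (drv_ln (fun s => dist4 g s a) _ _ d0 hq).
rewrite (_ : (fun s => _) = (fun s => 4^-1 * ln (dist4 g s a))); last by apply/funext => x; rewrite /ell mulrC.
apply: drv_eq hl _.
have aa : s + a + a = s + L by rewrite /half; lra.
have e2 : chord g (s + a) a = cconj (chord g s a).
  by rewrite /chord aa (knot_periodic L g knot) chord_conj.
rewrite /slope e2 aa (knot_periodic L g knot).
rewrite -chord_dist4.
have q0 : csq (chord g s a) != 0 by rewrite csq_eq0.
have -> : hz (g (s + a)) - hz (g s) = - (hz (g s) - hz (g (s + a))) by rewrite opprB.
move: (chord g s a) (hz (g s) - hz (g (s + a))) (tg s) (tg (s + a)) q0 => A d p q q0.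
rewrite -rC2 !cinvE !compE /= ?compE /= ?compE /= /csq /= ?sqrrN.
by move: q0; rewrite /csq => q0; field.
Qed.

(** The two slopes in [drv_half_ell] sum to the derivative of a periodic function, and their
    integrals agree by translation, so each is zero. *)
Lemma slope_integral0 : (\int[mu]_(s in `[0, L]) slope g s a)%R = 0.
Proof.
have cs := slope_continuous; have ps := slope_periodic.
have csa : continuous (fun s => slope g (s + a) a).
  by move=> s; apply: (@continuous_comp _ _ _ (fun s => s + a) (fun s => slope g s a)); [apply: cvgD; [exact: cvg_id|exact: cvg_cst]|exact: cs].
have i1 : rintegrable mu `[0, L] (fun s => slope g s a) by apply: cont_on_integrable => s _; exact: cs.
have i2 : rintegrable mu `[0, L] (fun s => slope g (s + a) a) by apply: cont_on_integrable => s _; exact: csa.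
have sum0 : (\int[mu]_(s in `[0, L]) slope g s a)%R + (\int[mu]_(s in `[0, L]) slope g (s + a) a)%R = 0.
  rewrite -RintegralD//.
  have := sint_FTC (fun s => ell g s a) (fun s => slope g s a + slope g (s + a) a) 0 L L0.
  move=> H; transitivity (ell g L a - ell g 0 a).
    by apply: H => s _; [exact: drv_half_ell|apply: cvgD; [exact: cs|exact: csa]].
  have e : dist4 g L a = dist4 g 0 a by have := dist4_periodic L g knot a 0; rewrite add0r.
  by rewrite /ell e subrr.
suff shift : (\int[mu]_(s in `[0, L]) slope g (s + a) a)%R = (\int[mu]_(s in `[0, L]) slope g s a)%R.
  by move: sum0; rewrite shift -mulr2n => /eqP; rewrite mulrn_eq0 => /eqP.
(* Adding the constant [M] makes the integrand nonnegative, as [period_shift] requires. *)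
have [M hM] := periodic_bounded L L0 _ cs ps.
have ic : rintegrable mu `[0, L] (fun=> M) by apply: cont_on_integrable => s _; exact: cvg_cst.
have pos s : 0 <= slope g s a + M.
  by have := hM s; rewrite ler_norml => /andP[h _]; rewrite -lerBlDr sub0r.
have mS : measurable_fun setT (fun s : R => slope g s a + M).
  by apply: continuous_measurable_fun => s; apply: cvgD; [exact: cs|exact: cvg_cst].
have mSa : measurable_fun setT (fun s : R => slope g (s + a) a + M).
  by apply: continuous_measurable_fun => s; apply: cvgD; [exact: csa|exact: cvg_cst].
have H : (\int[mu]_(s in `[0, L]) (slope g (s + a) a + M))%R = (\int[mu]_(s in `[0, L]) (slope g s a + M))%R.
  rewrite /Rintegral; congr fine.
  rewrite -integral_itv_obnd_cbnd; last by apply/measurable_EFinP; exact: measurable_funTS.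
  rewrite -[RHS]integral_itv_obnd_cbnd; last by apply/measurable_EFinP; exact: measurable_funTS.
  apply: (period_shift L a (fun s => (slope g s a + M)%:E)).
  - by case/andP: ha => h1 h2; rewrite !ltW.
  - exact/measurable_EFinP.
  - by move=> s; rewrite lee_fin.
  - by move=> s; rewrite ps.
have D (k : R -> R) : rintegrable mu `[0, L] k -> (\int[mu]_(s in `[0, L]) (k s + M))%R =
    (\int[mu]_(s in `[0, L]) k s)%R + (\int[mu]_(s in `[0, L]) M)%R.
  by move=> ik; rewrite -RintegralD.
by move: H; rewrite (D _ i2) (D _ i1) => /addIr.
Qed.

End slope_integral.

(** * Linearity of real integrals *)

Section linear_integral.
Context {d : measure_display} {T : measurableType d} {R : realType}.
Variable (mu : {measure set T -> \bar R}).
Implicit Types (D : set T) (f h : T -> R).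

Lemma rintD D f h : measurable D -> rintegrable mu D f -> rintegrable mu D h ->
  \int[mu]_(t in D) (f t + h t) = \int[mu]_(t in D) f t + \int[mu]_(t in D) h t.
Proof. by move=> mD hf hh; rewrite -RintegralD. Qed.

Lemma rintZ D (k : R) f : measurable D -> rintegrable mu D f ->
  \int[mu]_(t in D) (k * f t) = k * \int[mu]_(t in D) f t.
Proof. by move=> mD hf; rewrite -RintegralZl. Qed.

Lemma rint_bound D f h : measurable D -> rintegrable mu D f -> rintegrable mu D h ->
  (forall t, D t -> `|f t| <= h t) -> `|\int[mu]_(t in D) f t| <= \int[mu]_(t in D) h t.
Proof.
move=> mD hf hh fh; apply: le_trans (le_normr_Rintegral mD hf) _.
by apply: le_Rintegral => //; exact: (integrable_abse hf).
Qed.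

Lemma rint0 D f : (forall t, f t = 0) -> \int[mu]_(t in D) f t = 0.
Proof. by move=> f0; rewrite /Rintegral integral0_eq// => t _; rewrite f0. Qed.

End linear_integral.

(** * Comparison of the energy integral with the value at -2 *)

Section energy_integral.
Context {R : realType}.
Variables (L : R) (g : R -> hpt R).
Hypothesis knot : legendrian_knot L g.
Implicit Types s t : R.
Notation mu := (@lebesgue_measure R).
Notation T := (reach L).
Local Notation a := (half L).
Local Notation L0 := (knot_length_gt0 L g knot).
Local Notation a0 := (half_gt0 L g knot).
Local Notation tg := (tangent g).
Local Notation ell := (ell g).
Local Notation corr := (corr g).
Local Notation density := (energy_density g).

Lemma rint_cst_oc (k : R) : (\int[mu]_(t in `]0, a]) k)%R = k * a.
Proof.
rewrite Rintegral_cst//; congr (_ * _).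
have -> : a = fine a%:E by [].
congr fine; apply: etrans (lebesgue_measure_itv `]0, a]%R) _ => /=.
by rewrite lte_fin a0 -EFinB subr0.
Qed.

Lemma measurable_density : measurable_fun setT (fun p : R * R => density p.1 p.2).
Proof.
pose cmeas (f : R * R -> R[i]) := measurable_fun setT (fun p => cre (f p)) /\ measurable_fun setT (fun p => cim (f p)).
have mM f h : cmeas f -> cmeas h -> cmeas (fun p => f p * h p).
  move=> [f1 f2] [h1 h2]; split.
    rewrite (_ : (fun p => _) = (fun p => cre (f p) * cre (h p) - cim (f p) * cim (h p))).
      by apply: measurable_funB; exact: measurable_funM.
    by apply/funext => p; rewrite creM.
  rewrite (_ : (fun p => _) = (fun p => cre (f p) * cim (h p) + cim (f p) * cre (h p))).
    by apply: measurable_funD; exact: measurable_funM.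
  by apply/funext => p; rewrite cimM.
have mc (f : R -> R) : smooth_fun f -> measurable_fun setT (fun p : R * R => f p.1) /\
    measurable_fun setT (fun p : R * R => f p.2).
  move=> /smooth_continuous /continuous_measurable_fun mf.
  by split; apply: measurableT_comp mf _; [exact: measurable_fst|exact: measurable_snd].
have sx := smooth_x L g knot; have sy := smooth_y L g knot.
have [x1 x2] := mc _ sx; have [y1 y2] := mc _ sy.
have [u1 u2] := mc _ (smooth_u L g knot).
have [p1 p2] := mc _ (smooth_D1 _ sx); have [q1 q2] := mc _ (smooth_D1 _ sy).
have mA : cmeas (fun p : R * R => rel_B (g p.2) (g p.1)).
  split.
    by apply: measurable_funD; apply: measurable_funX; exact: measurable_funB.
  apply: measurable_funM; first exact: measurable_cst.
  apply: measurable_funB; first exact: measurable_funB.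
  by apply: measurable_funM; [exact: measurable_cst|apply: measurable_funB; exact: measurable_funM].
have mp : cmeas (fun p : R * R => cconj (tg p.1)) by split => //=; exact: measurableT_comp.
have mq : cmeas (fun p : R * R => tg p.2) by [].
have [mX _] := mM _ _ mp (mM _ _ mq (mM _ _ mA (mM _ _ mA mA))).
have mN : measurable_fun setT (fun p : R * R => cnorm (rel_B (g p.2) (g p.1))).
  rewrite (_ : (fun p : R * R => _) = (fun p => dH (g p.1) (g p.2) ^+ 2)).
    by apply: measurable_funX; exact: measurable_dH knot.
  by apply/funext => p; rewrite cnorm_chord.
have mV (f : R * R -> R) : (forall p, 0 <= f p) -> measurable_fun setT f -> measurable_fun setT (fun p => (f p)^-1).
  move=> f0 mf; rewrite (_ : (fun p => _) = (fun p => powR (f p) (-1))).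
    exact: measurableT_comp (measurable_powR _) mf.
  by apply/funext => p; rewrite powRN powRr1.
have mN3 := measurable_funX 3 mN.
rewrite /energy_density; apply: measurable_funM; last first.
  by apply: mV => // p; exact: cnorm_ge0.
apply: measurable_funB; first exact: measurable_cst.
by apply: measurable_funM => //; apply: mV => // p; rewrite exprn_ge0// cnorm_ge0.
Qed.

(** The integrand of [mellin 2 corr] at [-2]. It is bounded, as [t^2] balances the inverse square of
    the distance. *)
Definition weight s t : R := dens 2 corr s t * expR (-2 * ell s t).

Lemma weight_bound : exists K, forall s t, 0 < t < T -> `|weight s t| <= K.
Proof.
have [K _ hK] := dens_bound L g knot 2 corr (-2) (smooth_corr L g knot 0).
exists K => s t ht; have := hK s t ht.
have -> : `|weight s t| = `|dens 2 corr s t| * expR (-2 * ell s t).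
  by rewrite [LHS]normrM (ger0_norm (expR_ge0 _)).
by rewrite addNr mul0r expR0 mulr1.
Qed.

Lemma weight_continuous s t : 0 < t < T -> {for t, continuous (weight s)}.
Proof.
move=> ht; have [hc _] := tame_dtau _ _ _ (tame_corr L g knot 1).
have [d hd] := dens_derivable 2 corr s t _ (hc s t ht).
exact: drv_cont (drv_mul _ _ _ _ _ hd (drv_exp _ _ _ (drv_scale (-2) _ _ _ (drv_ell L g knot s t ht)))).
Qed.

Lemma density_continuous s t : 0 < t < T -> {for t, continuous (fun t => density s (s + t))}.
Proof.
move=> ht; have A0 := chord_neq0 L g knot s t (strip_period L g knot t ht).
have n0 : 0 < cnorm (chord g s t) by rewrite cnorm_gt0.
have hA := cdrv_chord L g knot s t; have [d hT] := cdrv_tangent_shift L g knot s t.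
have hA2 := cdrv_mul _ _ _ _ _ hA hA; have hA3 := cdrv_mul _ _ _ _ _ hA hA2.
have [hX _] := cdrv_scale (cconj (tg s)) _ _ _ (cdrv_mul _ _ _ _ _ hT hA3).
have cX := drv_cont _ _ _ hX.
have cN : {for t, continuous (fun t => cnorm (chord g s t))}.
  have [h1 h2] := hA; have hq := drv_add _ _ _ _ _ (drv_pow _ 2 _ _ h1) (drv_pow _ 2 _ _ h2).
  apply: (@continuous_comp _ _ _ (fun t => cre (chord g s t) ^+ 2 + cim (chord g s t) ^+ 2) Num.sqrt).
    exact: drv_cont hq.
  exact: sqrt_continuous.
have cI : {for t, continuous (fun t => (cnorm (chord g s t))^-1)} by apply: cvgV => //; rewrite gt_eqF.
rewrite /prop_for /continuous_at /energy_density /angle_term.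
apply: cvgM => //; apply: cvgB; first exact: cvg_cst.
apply: cvgM => //.
have -> : (fun x => (cnorm (rel_B (g (s + x)) (g s)) ^+ 3)^-1) =
  (fun x => (cnorm (chord g s x))^-1 * ((cnorm (chord g s x))^-1 * (cnorm (chord g s x))^-1)).
  by apply/funext => x; rewrite -exprVn !exprS expr0 mulr1.
rewrite -exprVn !exprS expr0 mulr1.
by apply: cvgM => //; exact: cvgM.
Qed.

(** The integral over [t] is read off from the primitive [defect], which vanishes at the diagonal;
    integrability of the density comes out of the same computation. *)
Lemma inner_integral s :
  rintegrable mu `]0, a] (weight s) /\
  (\int[mu]_(t in `]0%R, a]) (density s (s + t))%:E =
   (- defect g s a - 2 * (\int[mu]_(t in `]0, a]) weight s t)%R)%:E)%E.
Proof.
have [K hK] := weight_bound.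
have strip t : 0 < t <= a -> 0 < t < T by exact: half_strip knot t.
have mI : measurable (`]0, a]%classic : set R) by [].
have cw t : 0 < t <= a -> {for t, continuous (weight s)}.
  by move=> /strip; exact: weight_continuous.
have cd t : 0 < t <= a -> {for t, continuous (fun t => density s (s + t))}.
  by move=> /strip; exact: density_continuous.
have ic (k : R) : rintegrable mu `]0, a] (fun=> k).
  apply: (@integrableS _ _ _ mu `[0, a]) => //; first exact: subset_itv_oc_cc.
  by apply: cont_on_integrable => t _; exact: cvg_cst.
have iw : rintegrable mu `]0, a] (weight s).
  apply: (@rintegrable_le _ _ _ mu _ _ (fun=> K)) => //; first exact: cont_measurable_oc.
  by move=> t; rewrite /= in_itv/= => /strip; exact: hK.
(* The constant [2 K] compensates a negative [weight], so that [FTC_at0_ge0] applies. *)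
pose f t := density s (s + t) + (2 * weight s t + 2 * K).
pose F t := 2 * K * t - defect g s t.
have dF t : 0 < t <= a -> is_derive t 1 F (f t).
  move=> ht; apply: drv_eq (drv_sub _ _ _ _ _ (drv_scale (2 * K) _ _ _ (drv_id t)) (drv_defect L g knot s t (strip t ht))) _.
  by rewrite /f /weight; ring.
have cf t : 0 < t <= a -> {for t, continuous f}.
  move=> ht; apply: cvgD; first exact: cd.
  by apply: cvgD; [apply: cvgM; [exact: cvg_cst|exact: cw]|exact: cvg_cst].
have f0 t : 0 < t <= a -> 0 <= f t.
  move=> /strip ht; rewrite addr_ge0 ?(energy_density_ge0 L g knot)//.
  by have := hK s t ht; rewrite ler_norml => /andP[h _]; move: h; clear; lra.
have F0 : F t @[t --> 0^'+] --> 0.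
  rewrite -[X in _ --> X](subr0 0); apply: cvgB; last exact: defect_cvg0 knot s.
  rewrite -[X in _ --> X](mulr0 (2 * K)); apply: cvgM; first exact: cvg_cst.
  exact: cvg_at_right_filter cvg_id.
have H := FTC_at0_ge0 F f a 0 a0 dF cf f0 F0; rewrite subr0 in H.
have i_f : rintegrable mu `]0, a] f.
  apply/integrableP; split; first by apply/measurable_EFinP; exact: cont_measurable_oc.
  apply: le_lt_trans (ltry (F a)); rewrite -H le_eqVlt; apply/orP; left; apply/eqP.
  by apply: eq_integral => t; rewrite inE/= in_itv/= => ht; rewrite ger0_norm// f0.
have iw2 : rintegrable mu `]0, a] (fun t => 2 * weight s t) by exact: rintegrableZ.
have iwK : rintegrable mu `]0, a] (fun t => 2 * weight s t + 2 * K) by exact: rintegrableD.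
have id_ : rintegrable mu `]0, a] (fun t => density s (s + t)).
  have := rintegrableB mu _ _ _ mI i_f iwK; apply: rintegrable_eq => // t _.
  by rewrite /f addrK.
split => //.
have -> : (\int[mu]_(t in `]0%R, a]) (density s (s + t))%:E =
   (\int[mu]_(t in `]0, a]) density s (s + t))%R%:E)%E.
  by rewrite /Rintegral fineK//; exact: integrable_fin_num id_.
congr EFin.
have e1 : (\int[mu]_(t in `]0, a]) f t)%R = F a by rewrite /Rintegral H.
have e2 : (\int[mu]_(t in `]0, a]) f t)%R = (\int[mu]_(t in `]0, a]) density s (s + t))%R +
    (2 * (\int[mu]_(t in `]0, a]) weight s t)%R + 2 * K * a).
  transitivity ((\int[mu]_(t in `]0, a]) density s (s + t))%R + (\int[mu]_(t in `]0, a]) (2 * weight s t + 2 * K))%R).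
    exact: rintD.
  congr (_ + _).
  transitivity ((\int[mu]_(t in `]0, a]) (2 * weight s t))%R + (\int[mu]_(t in `]0, a]) (2 * K))%R); first exact: rintD.
  rewrite (rintZ mu _ 2 (weight s))//; congr (_ + _).
  exact: rint_cst_oc.
by move: e2; rewrite e1 /F; clear; lra.
Qed.

Lemma kernel_re m b s t : cre (kernel g m b (rC (-2)) s t) = dens m b s t * expR (-2 * ell s t).
Proof. by rewrite creM /= !mul0r cos0 subr0 mulr1. Qed.

Lemma kernel_im m b s t : cim (kernel g m b (rC (-2)) s t) = 0.
Proof. by rewrite cimM /= !mul0r sin0 !mulr0 addr0. Qed.

(** Integrated over [s], the slope part of [defect] vanishes. What remains of [- defect - 2 Q] is
    the real part of [- bdry 0 one - 2 mellin 2 corr] at [-2], which is that of [- reg]. *)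
Lemma energy_rhs_reg : energy_rhs L g = (cre (- (2 * reg L g (rC (-2)))))%:E.
Proof.
have mI : measurable (`[0, L]%classic : set R) by [].
have mJ : measurable (`]0, a]%classic : set R) by [].
have md := measurable_density.
transitivity (\int[mu]_(s in `[0%R, L]) \int[mu]_(t in `[0%R, L]) (density s t)%:E)%E.
  by apply: eq_integral => s _; apply: eq_integral => t _; rewrite (energy_integrandE L g knot).
rewrite (symmetric_halving L a (fun p => (density p.1 p.2)%:E) L0 erefl); last first.
- by move=> s t; rewrite /= energy_density_sym.
- by move=> s t; rewrite /= energy_density_sym (energy_density_periodic L g knot) energy_density_sym.
- by move=> s t; rewrite /= (energy_density_periodic L g knot).
- by move=> p; rewrite lee_fin (energy_density_ge0 L g knot).
- exact/measurable_EFinP.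
pose Q s := (\int[mu]_(t in `]0, a]) weight s t)%R.
have E s : (\int[mu]_(t in `]0%R, a]) (density s (s + t))%:E = (- defect g s a - 2 * Q s)%:E)%E.
  by case: (inner_integral s).
pose I s := - defect g s a - 2 * Q s.
have mIn : measurable_fun setT I.
  apply/measurable_EFinP; rewrite (_ : EFin \o I = (fun s => \int[mu]_(t in `]0%R, a]) (density s (s + t))%:E)%E).
    apply: (measurable_inner_integral _ (fun p => (density p.1 (p.1 + p.2))%:E)) => //.
      have mF : measurable_fun setT (fun p : R * R => (p.1, p.1 + p.2)).
        by apply: measurable_fun_pair => //; exact: measurable_funD.
      by apply/measurable_EFinP; exact: (measurableT_comp (f := fun p : R * R => density p.1 p.2) md mF).
    by move=> p; rewrite lee_fin (energy_density_ge0 L g knot).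
  by apply/funext => s; rewrite E.
have [K hK] := weight_bound.
have QK s : `|Q s| <= K * a.
  have [iw _] := inner_integral s.
  have ic : rintegrable mu `]0, a] (fun=> K).
    apply: (@integrableS _ _ _ mu `[0, a]) => //; first exact: subset_itv_oc_cc.
    by apply: cont_on_integrable => t _; exact: cvg_cst.
  rewrite -rint_cst_oc; apply: rint_bound => // t.
  by rewrite /= in_itv/= => /(half_strip L g knot); exact: hK.
have ib : rintegrable mu `[0, L] (fun s => a * expR (-2 * ell s a)).
  apply: rintegrable_eq (bdry_integrable L g knot 0 one (-2) (smooth_one L 0)) => // s _.
  by rewrite /dens /one expr1 mulr1 ger0_norm// ltW// a0.
have isl : rintegrable mu `[0, L] (fun s => slope g s a).
  by apply: cont_on_integrable => s _; exact: slope_continuous L g knot s.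
have idf : rintegrable mu `[0, L] (fun s => defect g s a) by exact: rintegrableD.
have iQ : rintegrable mu `[0, L] Q.
  apply: (@rintegrable_le _ _ _ mu _ _ (fun=> K * a)) => //; last first.
    by apply: cont_on_integrable => s _; exact: cvg_cst.
  rewrite (_ : Q = (fun s => 2^-1 * (- defect g s a - I s))); last by apply/funext => s; rewrite /I; field.
  apply: measurable_funM; first exact: measurable_cst.
  apply: measurable_funB; last exact: measurable_funTS.
  apply: measurableT_comp => //.
  by have /integrableP[/measurable_EFinP] := idf.
have iI : rintegrable mu `[0, L] I.
  apply: (rintegrable_eq mu _ (fun s => -1 * defect g s a + -2 * Q s)) => // [s _|].
    by rewrite /I mulN1r mulNr.
  by apply: rintegrableD => //; exact: rintegrableZ.
have -> : (\int[mu]_(s in `[0%R, L]) \int[mu]_(t in `]0%R, a]) (density (s, (s + t)%R).1 (s, (s + t)%R).2)%:E =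
   (\int[mu]_(s in `[0, L]) I s)%R%:E)%E.
  rewrite /Rintegral fineK; last exact: integrable_fin_num iI.
  by apply: eq_integral => s _; exact: E.
rewrite -EFinM; congr EFin.
have EI : (\int[mu]_(s in `[0, L]) I s)%R = - (\int[mu]_(s in `[0, L]) (a * expR (-2 * ell s a)))%R -
    2 * (\int[mu]_(s in `[0, L]) Q s)%R.
  transitivity (\int[mu]_(s in `[0, L]) (-1 * defect g s a + -2 * Q s))%R.
    by apply: eq_Rintegral => s _; rewrite mulN1r mulNr.
  transitivity ((\int[mu]_(s in `[0, L]) (-1 * defect g s a))%R + (\int[mu]_(s in `[0, L]) (-2 * Q s))%R).
    by apply: rintD => //; exact: rintegrableZ.
  rewrite (rintZ mu _ (-1) (fun s => defect g s a))// (rintZ mu _ (-2) Q)//.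
  have -> : (\int[mu]_(s in `[0, L]) defect g s a)%R =
     (\int[mu]_(s in `[0, L]) (a * expR (-2 * ell s a)))%R + (\int[mu]_(s in `[0, L]) slope g s a)%R by exact: rintD.
  by rewrite (slope_integral0 L g knot); ring.
have Eb : cre (bdry L g 0 one (rC (-2))) = (\int[mu]_(s in `[0, L]) (a * expR (-2 * ell s a)))%R.
  by apply: eq_Rintegral => s _; rewrite kernel_re /dens /one expr1 mulr1.
have Em : cre (mellin L g 2 corr (rC (-2))) = (\int[mu]_(s in `[0, L]) Q s)%R.
  transitivity (\int[mu2]_(p in box L) weight p.1 p.2)%R.
    by apply: eq_Rintegral => p _; rewrite kernel_re.
  apply: Rrect_fubini => //; last by move=> s _; case: (inner_integral s).
  have h2 : -1 - 2%:R < cre (rC (-2 : R)) by rewrite /=; lra.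
  have [ik _] := kernel_integrable L g knot 2 corr _ (smooth_corr L g knot 0) h2.
  by apply: rintegrable_eq ik; [exact: measurable_box|move=> p _; rewrite kernel_re].
rewrite EI -Em -Eb /reg -rC2; move: (mellin L g 2 corr _) (bdry L g 0 one _) => m b.
by rewrite !compE /=; ring.
Qed.

Lemma reg_im : cim (reg L g (rC (-2))) = 0.
Proof.
have zb : cim (bdry L g 0 one (rC (-2))) = 0 by apply: rint0 => s; exact: kernel_im.
have zm : cim (mellin L g 2 corr (rC (-2))) = 0 by apply: rint0 => p; exact: kernel_im.
move: zb zm; rewrite /reg; move: (mellin L g 2 corr _) (bdry L g 0 one _) => m b zb zm.
by rewrite !compE zb zm /=; ring.
Qed.

(** Since [reg] is differentiable for [-3 < Re z], dividing by [z + 1] leaves [-1] as the only point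
    to avoid. *)
Lemma BK_continuation_exists : exists (U : set R[i]) (F : R[i] -> R[i]), BK_continuation L g U F.
Proof.
exists cont_domain, (fun z => 2 * reg L g z / (z + 1)); split.
- exact: cont_domain_open.
- exact: cont_domain_connected.
- split => [z hz|]; first by left; rewrite /halfplane /=; lra.
  by right; split; rewrite /halfplane /=; lra.
- move=> z /cont_domain_re [hz z1]; apply: cdiffM.
    by apply: cdiffM; [exact: cdiff_cst|exact: reg_differentiable L g knot z hz].
  apply: cdiffV; last by apply: cdiffD; [exact: cdiff_id|exact: cdiff_cst].
  by rewrite addr_eq0.
move=> z hz; rewrite (BK_mellin L g knot)// -(regE L g knot)//.
have z1 : z + 1 != 0.
  by apply/eqP => /(congr1 (@cre R)); rewrite creD /=; lra.
by field.
Qed.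

End energy_integral.

Theorem theorem5p2 (R : realType) (L : R) (g : R -> hpt R) :
  legendrian_knot L g ->
  (exists (U : set R[i]) (F : R[i] -> R[i]), BK_continuation L g U F) /\
  (forall (U : set R[i]) (F : R[i] -> R[i]), BK_continuation L g U F ->
     (cre (F (rC (-2))))%:E = energy_rhs L g /\ cim (F (rC (-2))) = 0).
Proof.
move=> knot; split; first exact: BK_continuation_exists L g knot.
move=> U F [oU cU [hU U2] dF FE].
have E : F (rC (-2)) = - (2 * reg L g (rC (-2))).
  apply: (continuation_unique L g knot U F) => // z hz.
  by rewrite FE// (BK_mellin L g knot).
rewrite E (energy_rhs_reg L g knot); split => //.
by rewrite -rC2 cimN cimM (reg_im L g) [cim (rC 2)]/= mulr0 mul0r addr0 oppr0.
Qed.
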